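(* Let $k\in\{1,\ldots,5\}$ and $L>0$. Let $(u,p)$ with $u\in C^{k}([0,T],\mathcal V)$ and $p\in C^{k}([0,T],\mathcal H_{\mathcal Q})$ be the solution of the elliptic--parabolic problem $$a(u,v)-d(v,p)=\langle f,v\rangle,\qquad d(\dot u,q)+c(\dot p,q)+b(p,q)=\langle g,q\rangle\qquad\text{for all } v\in\mathcal V,\ q\in\mathcal Q \text{ and a.e. } t\in[0,T],$$ with consistent initial values $u(0)\in\mathcal V$, $p(0)\in\mathcal H_{\mathcal Q}$, for sufficiently smooth right-hand sides $f\colon[0,T]\to\mathcal V^*$ and $g\colon[0,T]\to\mathcal Q^*$. Let $\tau>0$ be the step size, $t^n=n\tau$, let $\mathrm{TOL}>0$ be a prescribed tolerance, and let initial data $(u^\ell,p^\ell)\in\mathcal V\times\mathcal H_{\mathcal Q}$, $\ell=0,\ldots,k-1$, be given. For $n\ge k$ with $t^n\le T$ let $(u^{n,J_n},p^{n,J_n})$ be the solution of the iteratively decoupled BDF-$k$ scheme with stabilization parameter $L$ (defined in the context), where $J_n$ is the number of inner iterations at time point $t^n$ determined by the stopping criterion with tolerance $\mathrm{TOL}$. Then $$\big\|u^{n,J_n}-u(t^n)\big\|_{\mathcal V}^2+\big\|p^{n,J_n}-p(t^n)\big\|_{\mathcal H_{\mathcal Q}}^2\ \lesssim\ \frac{\mathrm{TOL}^2}{\tau^3}+\tau^{2k}+\sum_{\ell=0}^{k-1}\big\|p^\ell-p(t^\ell)\big\|_{\mathcal H_{\mathcal Q}}^2,$$ with a hidden constant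 including a factor of the form $e^{C t^n}$ with some constant $C>0$. Here $x\lesssim y$ means that $x\le \widetilde C\,y$ with a generic constant $\widetilde C>0$ independent of spatial and temporal discretization parameters.
   Context: **Spaces and forms.** $\Omega\subseteq\mathbb R^m$, $m\in\{2,3\}$, is a bounded Lipschitz domain and $0<T<\infty$. Set $\mathcal V=[H_0^1(\Omega)]^m$, $\mathcal Q=H_0^1(\Omega)$, $\mathcal H_{\mathcal V}=[L^2(\Omega)]^m$, $\mathcal H_{\mathcal Q}=L^2(\Omega)$, with Gelfand triples $\mathcal V\hookrightarrow\mathcal H_{\mathcal V}\simeq\mathcal H_{\mathcal V}^*\hookrightarrow\mathcal V^*$ and $\mathcal Q\hookrightarrow\mathcal H_{\mathcal Q}\simeq\mathcal H_{\mathcal Q}^*\hookrightarrow\mathcal Q^*$. The bilinear forms $a\colon\mathcal V\times\mathcal V\to\mathbb R$, $b\colon\mathcal Q\times\mathcal Q\to\mathbb R$, $c\colon\mathcal H_{\mathcal Q}\times\mathcal H_{\mathcal Q}\to\mathbb R$ are symmetric, continuous and elliptic on their respective spaces, with ellipticity constants $c_a,c_b,c_c>0$ (e.g. $a(v,v)\ge c_a\|v\|_{\mathcal V}^2$) and continuity constants $C_a,C_b,C_c>0$. The bilinear form $d\colon\mathcal V\times\mathcal H_{\mathcal Q}\to\mathbb R$ is bounded: $d(v,q)\le C_d\|v\|_{\mathcal V}\|q\|_{\mathcal H_{\mathcal Q}}$ with $C_d>0$. Consistent initial values means $a(u(0),v)-d(v,p(0))=\langle f(0),v\rangle$ for all $v\in\mathcal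 V$. **BDF-$k$ coefficients.** $\xi_0,\ldots,\xi_k$ are defined by $\sum_{\ell=0}^k\xi_\ell s^\ell=\sum_{\ell=1}^k\frac1\ell(1-s)^\ell$. **Iteratively decoupled BDF-$k$ scheme.** For $\ell=0,\ldots,k-1$ put $u^{\ell,J_\ell}:=u^\ell$, $p^{\ell,J_\ell}:=p^\ell$. For $n\ge k$, given the values $(u^{n-\ell,J_{n-\ell}},p^{n-\ell,J_{n-\ell}})$, $\ell=1,\ldots,k$, and an initial guess $(u^{n,0},p^{n,0})$ (which can be chosen as the solution at the previous time step), define for $y\in\{u,p\}$ and $i\ge 0$ $$\Xi_k(y^{n,i})=\frac1\tau\Big(\xi_0y^{n,i}+\sum_{\ell=1}^k\xi_\ell\,y^{n-\ell,J_{n-\ell}}\Big),$$ and for $i=1,2,\ldots$ let $(u^{n,i},p^{n,i})$ be the solution of $$a(u^{n,i},v)-d(v,p^{n,i})=\langle f(t^n),v\rangle,$$ $$d(\Xi_k(u^{n,i-1}),q)+c(\Xi_k(p^{n,i}),q)+b(p^{n,i},q)+L\,\big(\Xi_k(p^{n,i})-\Xi_k(p^{n,i-1}),q\big)_{\mathcal H_{\mathcal Q}}=\langle g(t^n),q\rangle$$ for all $v\in\mathcal V$, $q\in\mathcal Q$ (the second equation is solved first for $p^{n,i}$, then the first one for $u^{n,i}$). **Stopping criterion.** $J_n$ is the smallest $i\ge1$ such that $$\tfrac{c_a}{2}\|u^{n,i}-u^{n,i-1}\|_{\mathcal V}^2+\big(c_c+\tfrac L2\big)\|p^{n,i}-p^{n,i-1}\|_{\mathcal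 H_{\mathcal Q}}^2+\tfrac{\tau}{\xi_0}c_b\|p^{n,i}-p^{n,i-1}\|_{\mathcal Q}^2\le\mathrm{TOL}^2.$$
   Formalization: The initial data are additionally assumed consistent, a(u^l,v)-d(v,p^l)=<f(t^l),v> for all v and l<k; otherwise the bound, which contains only errors of p^l, fails (k=1, p^0=p(0), u^0=u(0)+w with d(w,.) nonzero). ''Sufficiently smooth'' f, g is read as C^{k+1}. *)

(* Defs.v *)
From HB Require Import structures.
From mathcomp Require Import all_boot all_order all_algebra.
From mathcomp Require Import all_classical all_reals all_analysis.

Set Implicit Arguments.
Unset Strict Implicit.
Unset Printing Implicit Defensive.

Import Order.TTheory GRing.Theory Num.Theory.
Import numFieldNormedType.Exports.

Local Open Scope classical_set_scope.
Local Open Scope ring_scope.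

Section lebesgue_step.
Context (R : realType) (n : nat).
Local Notation Rm := (measurableTypeR R).
Variable mu : {sigma_finite_measure set (n.-tuple Rm) -> \bar R}.

Definition tuple_cons (z : Rm * n.-tuple Rm) : n.+1.-tuple Rm :=
  [the n.+1.-tuple Rm of z.1 :: z.2].

Lemma measurable_tuple_cons : measurable_fun setT tuple_cons.
Proof. exact: measurable_cons. Qed.

Definition lebesgue_step (A : set (n.+1.-tuple Rm)) : \bar R :=
  (@lebesgue_measure R \x mu)%E (tuple_cons @^-1` A).

Let mpre A : measurable A -> measurable (tuple_cons @^-1` A).
Proof.
by move=> mA; rewrite -[X in measurable X]setTI; exact: measurable_tuple_cons.
Qed.

Let step0 : lebesgue_step set0 = 0%E.
Proof. by rewrite /lebesgue_step preimage_set0 measure0. Qed.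

Let step_ge0 A : (0 <= lebesgue_step A)%E.
Proof. exact: measure_ge0. Qed.

Let step_sigma_additive : semi_sigma_additive lebesgue_step.
Proof.
move=> F mF tF mUF; rewrite /lebesgue_step preimage_bigcup.
apply: measure_semi_sigma_additive.
- by move=> i; exact: mpre.
- apply/trivIsetP => /= i j _ _ ij; rewrite -preimage_setI.
  by move/trivIsetP : tF => /(_ _ _ _ _ ij) ->//; rewrite preimage_set0.
- by rewrite -preimage_bigcup; exact: mpre.
Qed.

HB.instance Definition _ := isMeasure.Build _ _ _ lebesgue_step
  step0 step_ge0 step_sigma_additive.

Let step_sigma_finite : sigma_finite setT lebesgue_step.
Proof.
have /sigma_finiteP[F [FT ndF Foo]] := sigma_finiteT (@lebesgue_measure R).
have /sigma_finiteP[G [GT ndG Goo]] := sigma_finiteT mu.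
pose unc (t : n.+1.-tuple Rm) : Rm * n.-tuple Rm := (thead t, [tuple of behead t]).
have unK z : unc (tuple_cons z) = z.
  by case: z => x t; rewrite /unc /tuple_cons; congr pair; apply/val_inj.
have munc : measurable_fun setT unc.
  apply/measurable_fun_pairP; split; first exact: measurable_tnth.
  exact: measurable_behead.
exists (fun i => unc @^-1` (F i `*` G i)) => [|i].
  rewrite -preimage_bigcup (_ : \bigcup_i (F i `*` G i) = setT) ?preimage_setT//.
  apply/seteqP; split=> // -[x y] _.
  have [i _ Fx] : (\bigcup_i F i) x by rewrite -FT.
  have [j _ Gy] : (\bigcup_i G i) y by rewrite -GT.
  exists (maxn i j) => //; split => /=.
    by move: x Fx; exact/subsetPset/ndF/leq_maxl.
  by move: y Gy; exact/subsetPset/ndG/leq_maxr.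
have [mF Ff] := Foo i; have [mG Gf] := Goo i; split.
  by rewrite -[X in measurable X]setTI; apply: munc => //; exact: measurableX.
rewrite /lebesgue_step -comp_preimage (_ : unc \o tuple_cons = id);
  last exact/funext.
by rewrite preimage_id product_measure1E// lte_mul_pinfty// ge0_fin_numE.
Qed.

HB.instance Definition _ := Measure_isSigmaFinite.Build _ _ _ lebesgue_step
  step_sigma_finite.

End lebesgue_step.

(* Lebesgue measure on n.-tuple R, built as an iterated product; 0.-tuple R is
   a single point of mass 1. *)
Fixpoint lebesgue_tuple (R : realType) (n : nat) :
    {sigma_finite_measure set (n.-tuple (measurableTypeR R)) -> \bar R} :=
  if n is n'.+1 then
    [the {sigma_finite_measure set _ -> \bar R} of
       lebesgue_step (lebesgue_tuple R n')]
  else [the {sigma_finite_measure set _ -> \bar R} of dirac [tuple]].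

(* A space of functions, given by a set of representatives inside a vector space
   and a seminorm on it. Functions that agree almost everywhere are distinct
   representatives at distance 0. *)
Record fun_space (R : realType) := Space {
  carrier :> lmodType R;
  inS : set carrier;
  nrm : carrier -> R }.

Section spaces_and_forms.
Context (R : realType).
Implicit Types X Y : fun_space R.

Definition bilinear_on X Y (B : X -> Y -> R) :=
  (forall r x x' y, inS x -> inS x' -> inS y ->
     B (r *: x + x') y = r * B x y + B x' y) /\
  (forall r x y y', inS x -> inS y -> inS y' ->
     B x (r *: y + y') = r * B x y + B x y').

Definition symmetric_on X (B : X -> X -> R) :=
  forall x y, inS x -> inS y -> B x y = B y x.

Definition bounded_on X Y (B : X -> Y -> R) (C : R) :=
  forall x y, inS x -> inS y -> `|B x y| <= C * nrm x * nrm y.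

Definition elliptic_on X (B : X -> X -> R) (c : R) :=
  forall x, inS x -> c * nrm x ^+ 2 <= B x x.

Definition dual_space X : fun_space R := {|
  carrier := X -> R;
  inS := [set F : X -> R |
    (forall r x y, inS x -> inS y -> F (r *: x + y) = r * F x + F y) /\
    (exists C, forall x, inS x -> `|F x| <= C * nrm x)];
  nrm := fun F => sup [set `|F x| | x in [set x | inS x /\ nrm x <= 1]] |}.

Definition time_deriv X (T : R) (u u' : R -> X) := forall t, t \in `[0, T] ->
  nrm ((s - t)^-1 *: (u s - u t) - u' t) @[s --> within `[0, T] t^'] --> (0 : R).

Fixpoint class_C X (T : R) (k : nat) (u : R -> X) : Prop :=
  (forall t, t \in `[0, T] -> inS (u t)) /\
  if k is k'.+1 then exists u', time_deriv T u u' /\ class_C T k' u'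
  else forall t, t \in `[0, T] ->
    nrm (u s - u t) @[s --> within `[0, T] (nbhs t)] --> (0 : R).

End spaces_and_forms.

Section domain.
Context (R : realType) (m : nat).
Local Notation pt := 'rV[R]_m.
Implicit Types (Omega : set pt) (f g : pt -> R).

(* Near each boundary point, Omega is the part strictly above a Lipschitz graph,
   in the coordinates given by an orthogonal matrix. *)
Definition lipschitz_boundary Omega := forall x, (closure Omega `\` Omega) x ->
  exists (r : R) (Q : 'M[R]_m) (i : 'I_m) (h : 'rV[R]_m.-1 -> R),
    [/\ 0 < r, Q *m Q^T = 1%:M, lipschitz h &
      forall y, ball x r y ->
        (Omega y <-> h (col' i (y *m Q)) < (y *m Q) 0 i)].

Definition bounded_lipschitz_domain Omega :=
  [/\ Omega !=set0, open Omega, connected Omega, bounded_set Omega &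
      lipschitz_boundary Omega].

Definition pt_of_tuple (z : m.-tuple (measurableTypeR R)) : pt :=
  \row_i tnth z i.

Definition ip Omega f g : R :=
  \int[lebesgue_tuple R m]_(z in pt_of_tuple @^-1` Omega)
     (f (pt_of_tuple z) * g (pt_of_tuple z)).

Definition L2 Omega : fun_space R := {|
  carrier := pt -> R;
  inS := [set f : pt -> R |
    measurable_fun (pt_of_tuple @^-1` Omega) (f \o pt_of_tuple) /\
    (lebesgue_tuple R m).-integrable (pt_of_tuple @^-1` Omega)
       (fun z => (f (pt_of_tuple z) ^+ 2)%:E)];
  nrm := fun f => Num.sqrt (ip Omega f f) |}.

Definition partial (i : 'I_m) f : pt -> R := 'D_(delta_mx 0 i) f.

Fixpoint smooth (r : nat) f : Prop :=
  if r is r'.+1 then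
    forall i, (forall x, derivable f x (delta_mx 0 i)) /\ smooth r' (partial i f)
  else continuous f.

Definition test_function Omega f :=
  [/\ forall r, smooth r f, compact (closure [set x | f x != 0]) &
      closure [set x | f x != 0] `<=` Omega].

(* H_0^1 is the closure of the test functions in the H^1 norm; for an element f
   of it, the weak gradient is the L2 limit G of the gradients of any test
   functions approximating f in this norm. *)
Definition has_gradient Omega f (G : 'I_m -> pt -> R) :=
  (forall i, inS (G i : L2 Omega)) /\
  exists phi : nat -> pt -> R,
    [/\ forall j, test_function Omega (phi j),
        nrm (phi j - f : L2 Omega) @[j --> \oo] --> (0 : R) &
        forall i, nrm (partial i (phi j) - G i : L2 Omega) @[j --> \oo]
                    --> (0 : R)].

Definition gradient Omega f : 'I_m -> pt -> R :=
  get [set G | has_gradient Omega f G].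

Definition H01 Omega : fun_space R := {|
  carrier := pt -> R;
  inS := [set f : pt -> R |
    inS (f : L2 Omega) /\ exists G, has_gradient Omega f G];
  nrm := fun f => Num.sqrt (nrm (f : L2 Omega) ^+ 2 +
    \sum_i nrm (gradient Omega f i : L2 Omega) ^+ 2) |}.

Definition H01v Omega : fun_space R := {|
  carrier := pt -> pt;
  inS := [set v : pt -> pt |
    forall i, inS ((fun x => v x 0 i) : H01 Omega)];
  nrm := fun v =>
    Num.sqrt (\sum_i nrm ((fun x => v x 0 i) : H01 Omega) ^+ 2) |}.

End domain.

Section problem.
Context (R : realType) (m : nat) (Omega : set 'rV[R]_m).
Local Notation V := (H01v Omega).
Local Notation Q := (H01 Omega).
Local Notation HQ := (L2 Omega).
Context (a : V -> V -> R) (b : Q -> Q -> R) (c : HQ -> HQ -> R)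
        (d : V -> HQ -> R) (f : R -> dual_space V) (g : R -> dual_space Q).

Definition elliptic_equation (t : R) (u : V) (p : HQ) :=
  forall v : V, inS v -> a u v - d v p = f t v.

Definition is_solution (T : R) (u : R -> V) (p : R -> HQ) :=
  exists (du : R -> V) (dp : R -> HQ),
  [/\ forall t, t \in `[0, T] -> inS (du t) /\ inS (dp t),
      time_deriv T u du, time_deriv T p dp,
      elliptic_equation 0 (u 0) (p 0) &
      {ae @lebesgue_measure R, forall t, t \in `[0, T] ->
        [/\ inS (p t : Q), elliptic_equation t (u t) (p t) &
            forall q : Q, inS q ->
              d (du t) q + c (dp t) q + b (p t) q = g t q]}].

Definition bdf_coef (k l : nat) : R :=
  (\sum_(1 <= j < k.+1) j%:R^-1 *: (1 - 'X) ^+ j : {poly R})`_l.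

(* Xi_k(y^{n,i}); J n is the index of the last inner iterate at time step n. *)
Definition bdf_quot (k : nat) (tau : R) (X : fun_space R) (J : nat -> nat)
    (y : nat -> nat -> X) (n i : nat) : X :=
  tau^-1 *: (bdf_coef k 0 *: y n i +
             \sum_(1 <= l < k.+1) bdf_coef k l *: y (n - l)%N (J (n - l)%N)).

(* y n i is y^{n,i}; the initial guess y n 0 is arbitrary. *)
Definition inner_iteration (k : nat) (L tau : R) (J : nat -> nat)
    (u : nat -> nat -> V) (p : nat -> nat -> HQ) (n : nat) :=
  let Xi_u := bdf_quot k tau J u n in
  let Xi_p := bdf_quot k tau J p n in
  [/\ inS (u n 0%N), inS (p n 0%N) &
      forall i, (0 < i)%N ->
        [/\ inS (u n i), inS (p n i : Q),
            elliptic_equation (n%:R * tau) (u n i) (p n i) &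
            forall q : Q, inS q ->
              d (Xi_u i.-1) q + c (Xi_p i) q + b (p n i) q
                + L * ip Omega (Xi_p i - Xi_p i.-1) q = g (n%:R * tau) q]].

(* The Q-norm of an increment outside Q counts as infinite (the initial guess
   p n 0 is only in HQ). *)
Definition stop_test (k : nat) (L tau TOL ca cb cc : R)
    (u : nat -> nat -> V) (p : nat -> nat -> HQ) (n i : nat) :=
  let du := u n i - u n i.-1 in
  let dp := p n i - p n i.-1 in
  inS (dp : Q) /\
  ca / 2 * nrm du ^+ 2 + (cc + L / 2) * nrm dp ^+ 2
    + tau / bdf_coef k 0 * cb * nrm (dp : Q) ^+ 2 <= TOL ^+ 2.

Definition first_index (P : nat -> Prop) (j : nat) :=
  [/\ (0 < j)%N, P j & forall i, (0 < i < j)%N -> ~ P i].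

(* The scheme run from the initial data (u0 l, p0 l), l < k, up to step N. *)
Definition decoupled_bdf (k : nat) (L tau TOL ca cb cc : R)
    (u0 : nat -> V) (p0 : nat -> HQ) (J : nat -> nat)
    (u : nat -> nat -> V) (p : nat -> nat -> HQ) (N : nat) :=
  (forall l, (l < k)%N -> u l (J l) = u0 l /\ p l (J l) = p0 l) /\
  (forall n, (k <= n <= N)%N ->
     inner_iteration k L tau J u p n /\
     first_index (stop_test k L tau TOL ca cb cc u p n) (J n)).

End problem.

(* Main.v *)
Require Import Defs.
From HB Require Import structures.
From mathcomp Require Import all_boot all_order all_algebra.
From mathcomp Require Import all_classical all_reals all_analysis.
From mathcomp Require Import measurable_realfun ring lra.

Set Implicit Arguments.
Unset Strict Implicit.
Unset Printing Implicit Defensive.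

Import Order.TTheory GRing.Theory Num.Theory.
Import numFieldNormedType.Exports.

Local Open Scope classical_set_scope.
Local Open Scope ring_scope.

(** The stopping criterion makes the last iterate a solution of the implicit BDF-k
    scheme whose second equation has a residual of size [TOL / tau] in the dual
    of [H01]. Subtracting the exact solution, the elliptic equation has no
    residual, so that the BDF quotient of the error of [u] can be tested against
    the error of [u] in [a] through the error of [p]. The scheme is therefore a
    linear BDF scheme for the product form of [a] and [c], dissipative in [b].
    Testing with [e n - (19 / 20) *: e n.-1] and using G-stability (k <= 5)
    bounds the error by the squared dual norms of the residuals, summed with
    weight [tau]; a residual [TOL / tau] contributes [TOL ^+ 2 / tau ^+ 2], hence
    at most [T * TOL ^+ 2 / tau ^+ 3]. No Gronwall argument is needed: the bound
    holds without the exponential factor. In the first step the test function is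
    [e k] alone, because the initial data need not lie in [H01].

    The consistency error is the delicate part, as only k derivatives are
    available and the time derivatives of [p] are only continuous into [L2]. All
    equations are differentiated k - 1 times, with [b] replaced by its closure as
    an operator. An energy estimate for increments then shows that the functional
    represented by the derivative of order k - 1 of [p] has time increments whose
    squared dual norms are at most [(t - s) * (A t - A s)] for a fixed function
    [A]; this is what an H^1-in-time bound with values in the dual would give, and
    the resulting sum over the time steps telescopes to order [tau ^+ (2 * k)]. *)

(** The parabolic equation holds only for almost every time, so at a grid point the exact [p] is
    known only to lie in [L2], and neither the error nor its combination with the multiplier is an
    admissible test function. This obstacle shapes the proof: the dual norm of the functional that
    the closure of [b] attaches to an error replaces the b-norm of that error, and testing becomes a
    limit over admissible approximants. The multiplier is the same for all [k]. BDF-5 rules out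
    small values, its smallest Nevanlinna-Odeh multiplier being about 0.816, while any value below 1
    leaves a positive share of the dissipation after Young's inequality. The starting errors enter
    through [p] alone, because the elliptic equation bounds the error of [u] by that of [p]. Forms
    are taken semidefinite, since functions that agree almost everywhere are different elements at
    distance 0. *)

(** * Semidefinite forms, their seminorms and linear functionals *)

Record psd_form (R : realType) (X : lmodType R) (s : X -> X -> R) : Prop := {
  psd_linear : forall r x x' y, s (r *: x + x') y = r * s x y + s x' y;
  psdC : forall x y, s x y = s y x;
  psd_ge0 : forall x, 0 <= s x x }.

Definition fnorm (R : realType) (X : lmodType R) (s : X -> X -> R) x :=
  Num.sqrt (s x x).

Definition lin (R : realType) (X : lmodType R) (F : X -> R) :=
  forall r x y, F (r *: x + y) = r * F x + F y.

Section lin.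
Context {R : realType} {X : lmodType R} {F : X -> R} (hF : lin F).

Lemma linD x y : F (x + y) = F x + F y.
Proof. by rewrite -[x]scale1r hF mul1r scale1r. Qed.

Lemma lin0 : F 0 = 0.
Proof. by have := linD 0 0; rewrite addr0; lra. Qed.

Lemma linZ r x : F (r *: x) = r * F x.
Proof. by rewrite -[r *: x]addr0 hF lin0 addr0. Qed.

Lemma linN x : F (- x) = - F x.
Proof. by rewrite -scaleN1r linZ mulN1r. Qed.

Lemma linB x y : F (x - y) = F x - F y.
Proof. by rewrite linD linN. Qed.

Lemma lin_sum (I : Type) (r : seq I) (P : pred I) (x : I -> X) :
  F (\sum_(i <- r | P i) x i) = \sum_(i <- r | P i) F (x i).
Proof. by apply: (big_morph F linD lin0). Qed.

End lin.

Section psd.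
Context {R : realType} {X : lmodType R} {s : X -> X -> R} (hs : psd_form s).
Local Notation N := (fnorm s).

Lemma psd_linl y : lin (s ^~ y).
Proof. by move=> r x x'; exact: psd_linear hs _ _ _ _. Qed.

Lemma psd_linr x : lin (s x).
Proof. by move=> r y y'; rewrite !(psdC hs x) (psd_linear hs). Qed.

Definition psdDl x x' y : s (x + x') y = s x y + s x' y := linD (psd_linl y) x x'.
Definition psdZl r x y : s (r *: x) y = r * s x y := linZ (psd_linl y) r x.
Definition psdNl x y : s (- x) y = - s x y := linN (psd_linl y) x.
Definition psdDr x y y' : s x (y + y') = s x y + s x y' := linD (psd_linr x) y y'.
Definition psdZr r x y : s x (r *: y) = r * s x y := linZ (psd_linr x) r y.
Definition psdNr x y : s x (- y) = - s x y := linN (psd_linr x) y.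
Definition psdE := (psdDl, psdZl, psdNl, psdDr, psdZr, psdNr).

Lemma fnorm_ge0 x : 0 <= N x. Proof. exact: sqrtr_ge0. Qed.

Lemma fnorm_sqr x : N x ^+ 2 = s x x.
Proof. by rewrite sqr_sqrtr// psd_ge0. Qed.

Lemma psd_CS x y : `|s x y| <= N x * N y.
Proof.
have sx := psd_ge0 hs x; have sy := psd_ge0 hs y.
rewrite -[N x * N y]ger0_norm ?mulr_ge0 ?fnorm_ge0// -ler_sqr ?nnegrE// !real_normK ?num_real//.
rewrite exprMn !fnorm_sqr.
have [y0|y0] := eqVneq (s y y) 0.
  rewrite y0 mulr0.
  suff -> : s x y = 0 by rewrite expr0n.
  apply/eqP; apply: contraT => sxy.
  (* This [r] would give [x + r *: y] the square -1. *)
  pose r := - (s x x + 1) / (2 * s x y).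
  have := psd_ge0 hs (x + r *: y).
  rewrite !psdE y0 mulr0 mulr0 addr0 (psdC hs y x).
  have -> : r * s x y = - (s x x + 1) / 2 by rewrite /r; field.
  by lra.
(* The component of [x] orthogonal to [y], scaled by [s y y] to avoid a division. *)
have := psd_ge0 hs (s y y *: x - s x y *: y).
rewrite !psdE (psdC hs y x) => h.
have {}h : 0 <= s y y * (s x x * s y y - s x y ^+ 2) by nra.
by move: h; rewrite pmulr_rge0 ?subr_ge0// lt0r y0.
Qed.

Lemma psd_CS_le x y : s x y <= N x * N y.
Proof. exact: le_trans (ler_norm _) (psd_CS x y). Qed.

Lemma fnormZ r x : N (r *: x) = `|r| * N x.
Proof. by rewrite /fnorm !psdE mulrA -expr2 sqrtrM ?sqr_ge0// sqrtr_sqr. Qed.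

Lemma fnormN x : N (- x) = N x.
Proof. by rewrite -scaleN1r fnormZ normrN1 mul1r. Qed.

Lemma fnorm0 : N 0 = 0.
Proof. by rewrite -(scale0r (0 : X)) fnormZ normr0 mul0r. Qed.

Lemma fnormD x y : N (x + y) <= N x + N y.
Proof.
have Nx := fnorm_ge0 x; have Ny := fnorm_ge0 y.
rewrite -ler_sqr ?nnegrE ?addr_ge0 ?fnorm_ge0// sqrrD !fnorm_sqr !psdE (psdC hs y x).
by have := psd_CS_le x y; lra.
Qed.

Lemma fnormB x y : N (x - y) <= N x + N y.
Proof. by rewrite -(fnormN y) fnormD. Qed.

Lemma fnormBC x y : N (x - y) = N (y - x).
Proof. by rewrite -fnormN opprB. Qed.

End psd.

Arguments psdE {R X s}.
Arguments fnorm_ge0 {R X} s x.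

(** * G-stability of the BDF schemes *)

(** Explicit fractions turn the G-stability inequalities and the order conditions into rational
    arithmetic; [bdf_coefE] links them to the generating polynomial. *)
Definition bdf_table (R : realType) (k : nat) : seq R :=
  match k with
  | 1%N => [:: 1; - 1]
  | 2%N => [:: 3 / 2; - 2; 1 / 2]
  | 3%N => [:: 11 / 6; - 3; 3 / 2; - (1 / 3)]
  | 4%N => [:: 25 / 12; - 4; 3; - (4 / 3); 1 / 4]
  | 5%N => [:: 137 / 60; - 5; 5; - (10 / 3); 5 / 4; - (1 / 5)]
  | _ => [::]
  end.

(* Upper triangles of Dahlquist G-matrices for BDF-k with the Nevanlinna-Odeh
   multiplier [y n - (19 / 20) *: y n.-1], found numerically and rounded. *)
Definition bdf_gmatrix (R : realType) (k : nat) : seq (seq R) :=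
  match k with
  | 1%N => [:: [:: 1 / 40]]
  | 2%N => [:: [:: 4 / 5; - (61 / 40)];
      [:: 0; 3 / 4]]
  | 3%N => [:: [:: 37 / 30; - (359 / 120); 37 / 60];
      [:: 0; 71 / 30; - (9 / 5)];
      [:: 0; 0; 3 / 5]]
  | 4%N => [:: [:: 49 / 30; - (215 / 48); 439 / 240; - (41 / 80)];
      [:: 0; 919 / 240; - (35 / 8); 11 / 10];
      [:: 0; 0; 41 / 20; - (3 / 2)];
      [:: 0; 0; 0; 9 / 20]]
  | 5%N => [:: [:: 59 / 30; - (7283 / 1200); 23 / 6; - (319 / 150); 163 / 300];
      [:: 0; 82 / 15; - (9409 / 1200); 4889 / 1200; - (37 / 30)];
      [:: 0; 0; 4193 / 1200; - (121 / 30); 7 / 6];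
      [:: 0; 0; 0; 47 / 30; - (11 / 10)];
      [:: 0; 0; 0; 0; 19 / 60]]
  | _ => [::]
  end.

(** [y 0] is the newest value and [y i] lies [i] steps back. As only upper triangles are stored, an
    off-diagonal entry is twice that of the symmetric G-matrix. *)
Definition gform (R : realType) (X : lmodType R) (s : X -> X -> R) (k : nat)
    (y : nat -> X) : R :=
  \sum_(i < k) \sum_(j < k) (nth [::] (bdf_gmatrix R k) i)`_j * s (y i) (y j).

Section gstability.
Context (R : realType) (X : lmodType R) (s : X -> X -> R) (hs : psd_form s).
Variable y : nat -> X.
Local Arguments psdE {R X s} hs.

(* In the lemmas below, [lra] finds the nonnegative weights that write the
   difference of the two sides as a sum of these squares. *)
Let gram_ge0 e0 e1 e2 e3 e4 e5 :
  0 <= e0 * e0 * s (y 0) (y 0) + 2 * e0 * e1 * s (y 0) (y 1) + 2 * e0 * e2 * s (y 0) (y 2) + 2 * e0 * e3 * s (y 0) (y 3) + 2 * e0 * e4 * s (y 0) (y 4) + 2 * e0 * e5 * s (y 0) (y 5) + e1 * e1 * s (y 1) (y 1) + 2 * e1 * e2 * s (y 1) (y 2) + 2 * e1 * e3 * s (y 1) (y 3) + 2 * e1 * e4 * s (y 1) (y 4) + 2 * e1 * e5 * s (y 1) (y 5) + e2 * e2 * s (y 2) (y 2) + 2 * e2 * e3 * s (y 2) (y 3) + 2 * e2 * e4 * s (y 2) (y 4) + 2 * e2 * e5 * s (y 2) (y 5) + e3 * e3 * s (y 3) (y 3) + 2 * e3 * e4 * s (y 3) (y 4) + 2 * e3 *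 e5 * s (y 3) (y 5) + e4 * e4 * s (y 4) (y 4) + 2 * e4 * e5 * s (y 4) (y 5) + e5 * e5 * s (y 5) (y 5).
Proof.
have := psd_ge0 hs (e0 *: y 0 + e1 *: y 1 + e2 *: y 2 + e3 *: y 3 + e4 *: y 4 + e5 *: y 5).
rewrite !(psdE hs) ?(psdC hs (y 1) (y 0)) ?(psdC hs (y 2) (y 0)) ?(psdC hs (y 2) (y 1)) ?(psdC hs (y 3) (y 0)) ?(psdC hs (y 3) (y 1)) ?(psdC hs (y 3) (y 2)) ?(psdC hs (y 4) (y 0)) ?(psdC hs (y 4) (y 1)) ?(psdC hs (y 4) (y 2)) ?(psdC hs (y 4) (y 3)) ?(psdC hs (y 5) (y 0)) ?(psdC hs (y 5) (y 1)) ?(psdC hs (y 5) (y 2)) ?(psdC hs (y 5) (y 3)) ?(psdC hs (y 5) (y 4)).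
by congr (_ <= _); ring.
Qed.

Lemma gform_step1 :
  gform s 1 y - gform s 1 (fun i => y i.+1) <=
    s (\sum_(l < 1.+1) (bdf_table R 1)`_l *: y l) (y 0 - (19 / 20) *: y 1).
Proof.
rewrite !big_ord_recr big_ord0 /= add0r !(psdE hs) ?(psdC hs (y 1) (y 0)).
rewrite /gform !big_ord_recr !big_ord0 /= !add0r.
have h0 := gram_ge0 1 (- 1) 0 0 0 0.
lra.
Qed.

Lemma gform_lb1 :
  1 / 1000 * s (y 0) (y 0) <= gform s 1 y.
Proof.
rewrite /gform !big_ord_recr !big_ord0 /= !add0r.
have h0 := gram_ge0 1 0 0 0 0 0.
lra.
Qed.

Lemma gform_step2 :
  gform s 2 y - gform s 2 (fun i => y i.+1) <=
    s (\sum_(l < 2.+1) (bdf_table R 2)`_l *: y l) (y 0 - (19 / 20) *: y 1).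
Proof.
rewrite !big_ord_recr big_ord0 /= add0r !(psdE hs) ?(psdC hs (y 1) (y 0)) ?(psdC hs (y 2) (y 0)) ?(psdC hs (y 2) (y 1)).
rewrite /gform !big_ord_recr !big_ord0 /= !add0r.
have h0 := gram_ge0 5 (- 7) 2 0 0 0.
have h1 := gram_ge0 0 1 (- 1) 0 0 0.
have h2 := gram_ge0 1 (- 1) 0 0 0 0.
have h3 := gram_ge0 1 0 (- 1) 0 0 0.
lra.
Qed.

Lemma gform_lb2 :
  1 / 1000 * s (y 0) (y 0) <= gform s 2 y.
Proof.
rewrite /gform !big_ord_recr !big_ord0 /= !add0r.
have h0 := gram_ge0 1 (- 1) 0 0 0 0.
have h1 := gram_ge0 1 0 0 0 0 0.
have h2 := gram_ge0 2 (- 1) 0 0 0 0.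
lra.
Qed.

Lemma gform_step3 :
  gform s 3 y - gform s 3 (fun i => y i.+1) <=
    s (\sum_(l < 3.+1) (bdf_table R 3)`_l *: y l) (y 0 - (19 / 20) *: y 1).
Proof.
rewrite !big_ord_recr big_ord0 /= add0r !(psdE hs) ?(psdC hs (y 1) (y 0)) ?(psdC hs (y 2) (y 0)) ?(psdC hs (y 2) (y 1)) ?(psdC hs (y 3) (y 0)) ?(psdC hs (y 3) (y 1)).
rewrite /gform !big_ord_recr !big_ord0 /= !add0r.
have h0 := gram_ge0 10 (- 15) 8 (- 3) 0 0.
have h1 := gram_ge0 0 5 (- 8) 3 0 0.
have h2 := gram_ge0 0 0 1 (- 1) 0 0.
have h3 := gram_ge0 1 (- 1) 0 0 0 0.
have h4 := gram_ge0 0 1 (- 1) 0 0 0.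
have h5 := gram_ge0 1 0 (- 1) 0 0 0.
have h6 := gram_ge0 (- 1) 1 1 (- 1) 0 0.
have h7 := gram_ge0 0 1 0 (- 1) 0 0.
lra.
Qed.

Lemma gform_lb3 :
  1 / 1000 * s (y 0) (y 0) <= gform s 3 y.
Proof.
rewrite /gform !big_ord_recr !big_ord0 /= !add0r.
have h0 := gram_ge0 31 (- 38) 8 0 0 0.
have h1 := gram_ge0 0 1 (- 1) 0 0 0.
have h2 := gram_ge0 1 0 0 0 0 0.
have h3 := gram_ge0 1 (- 1) 0 0 0 0.
have h4 := gram_ge0 1 0 (- 1) 0 0 0.
have h5 := gram_ge0 0 1 0 0 0 0.
have h6 := gram_ge0 1 1 (- 1) 0 0 0.
lra.
Qed.

Lemma gform_step4 :
  gform s 4 y - gform s 4 (fun i => y i.+1) <=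
    s (\sum_(l < 4.+1) (bdf_table R 4)`_l *: y l) (y 0 - (19 / 20) *: y 1).
Proof.
rewrite !big_ord_recr big_ord0 /= add0r !(psdE hs) ?(psdC hs (y 1) (y 0)) ?(psdC hs (y 2) (y 0)) ?(psdC hs (y 2) (y 1)) ?(psdC hs (y 3) (y 0)) ?(psdC hs (y 3) (y 1)) ?(psdC hs (y 4) (y 0)) ?(psdC hs (y 4) (y 1)).
rewrite /gform !big_ord_recr !big_ord0 /= !add0r.
have h0 := gram_ge0 10 (- 17) 14 (- 10) 3 0.
have h1 := gram_ge0 0 10 (- 14) 9 (- 5) 0.
have h2 := gram_ge0 0 0 5 (- 8) 3 0.
have h3 := gram_ge0 0 0 0 1 (- 1) 0.
have h4 := gram_ge0 1 (- 1) 0 0 0 0.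
have h5 := gram_ge0 0 1 (- 1) 0 0 0.
have h6 := gram_ge0 (- 1) 2 (- 1) 0 0 0.
have h7 := gram_ge0 0 0 1 (- 1) 0 0.
have h8 := gram_ge0 (- 1) 1 1 (- 1) 0 0.
have h9 := gram_ge0 0 (- 1) 2 (- 1) 0 0.
have h10 := gram_ge0 (- 1) 1 0 1 (- 1) 0.
have h11 := gram_ge0 0 1 (- 1) 1 (- 1) 0.
have h12 := gram_ge0 0 0 (- 1) 2 (- 1) 0.
lra.
Qed.

Lemma gform_lb4 :
  1 / 1000 * s (y 0) (y 0) <= gform s 4 y.
Proof.
rewrite /gform !big_ord_recr !big_ord0 /= !add0r.
have h0 := gram_ge0 51 (- 71) 29 (- 8) 0 0.
have h1 := gram_ge0 (- 1) 50 (- 64) 14 0 0.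
have h2 := gram_ge0 0 0 1 (- 1) 0 0.
have h3 := gram_ge0 1 0 0 0 0 0.
have h4 := gram_ge0 1 (- 1) 0 0 0 0.
have h5 := gram_ge0 0 1 (- 1) 0 0 0.
have h6 := gram_ge0 1 0 (- 1) 0 0 0.
have h7 := gram_ge0 1 (- 1) 1 (- 1) 0 0.
have h8 := gram_ge0 0 (- 1) 2 (- 1) 0 0.
have h9 := gram_ge0 0 1 0 0 0 0.
have h10 := gram_ge0 1 1 (- 1) 0 0 0.
have h11 := gram_ge0 1 0 (- 1) 1 0 0.
lra.
Qed.

Lemma gform_step5 :
  gform s 5 y - gform s 5 (fun i => y i.+1) <=
    s (\sum_(l < 5.+1) (bdf_table R 5)`_l *: y l) (y 0 - (19 / 20) *: y 1).
Proof.
rewrite !big_ord_recr big_ord0 /= add0r !(psdE hs) ?(psdC hs (y 1) (y 0)) ?(psdC hs (y 2) (y 0)) ?(psdC hs (y 2) (y 1)) ?(psdC hs (y 3) (y 0)) ?(psdC hs (y 3) (y 1)) ?(psdC hs (y 4) (y 0)) ?(psdC hs (y 4) (y 1)) ?(psdC hs (y 5) (y 0)) ?(psdC hs (y 5) (y 1)).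
rewrite /gform !big_ord_recr !big_ord0 /= !add0r.
have h0 := gram_ge0 40 (- 70) 75 (- 78) 46 (- 13).
have h1 := gram_ge0 0 40 (- 65) 57 (- 59) 27.
have h2 := gram_ge0 0 0 40 (- 36) 37 (- 41).
have h3 := gram_ge0 0 0 0 20 (- 23) 3.
have h4 := gram_ge0 0 0 0 0 1 (- 1).
have h5 := gram_ge0 1 (- 1) 0 0 0 0.
have h6 := gram_ge0 0 1 (- 1) 0 0 0.
have h7 := gram_ge0 (- 1) 2 (- 1) 0 0 0.
have h8 := gram_ge0 0 0 1 (- 1) 0 0.
have h9 := gram_ge0 1 (- 1) 1 (- 1) 0 0.
have h10 := gram_ge0 0 (- 1) 2 (- 1) 0 0.
have h11 := gram_ge0 0 0 0 1 (- 1) 0.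
have h12 := gram_ge0 1 (- 1) 0 1 (- 1) 0.
have h13 := gram_ge0 0 1 (- 1) 1 (- 1) 0.
have h14 := gram_ge0 0 0 (- 1) 2 (- 1) 0.
have h15 := gram_ge0 (- 1) 1 0 0 1 (- 1).
have h16 := gram_ge0 0 (- 1) 1 0 1 (- 1).
have h17 := gram_ge0 0 0 1 (- 1) 1 (- 1).
have h18 := gram_ge0 0 0 0 (- 1) 2 (- 1).
lra.
Qed.

Lemma gform_lb5 :
  1 / 1000 * s (y 0) (y 0) <= gform s 5 y.
Proof.
rewrite /gform !big_ord_recr !big_ord0 /= !add0r.
have h0 := gram_ge0 51 (- 80) 51 (- 28) 7 0.
have h1 := gram_ge0 (- 1) 50 (- 63) 26 (- 13) 0.
have h2 := gram_ge0 0 0 5 (- 6) 1 0.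
have h3 := gram_ge0 1 0 0 50 (- 50) 0.
have h4 := gram_ge0 1 0 0 0 0 0.
have h5 := gram_ge0 1 (- 1) 0 0 0 0.
have h6 := gram_ge0 0 1 (- 1) 0 0 0.
have h7 := gram_ge0 1 0 (- 1) 0 0 0.
have h8 := gram_ge0 0 0 1 (- 1) 0 0.
have h9 := gram_ge0 (- 1) 1 1 (- 1) 0 0.
have h10 := gram_ge0 0 1 0 (- 1) 0 0.
have h11 := gram_ge0 0 0 0 1 (- 1) 0.
have h12 := gram_ge0 (- 1) 1 0 1 (- 1) 0.
have h13 := gram_ge0 0 1 (- 1) 1 (- 1) 0.
have h14 := gram_ge0 0 0 (- 1) 2 (- 1) 0.
have h15 := gram_ge0 0 1 0 0 0 0.
have h16 := gram_ge0 1 1 (- 1) 0 0 0.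
have h17 := gram_ge0 1 0 1 (- 1) 0 0.
have h18 := gram_ge0 1 0 0 1 (- 1) 0.
lra.
Qed.

End gstability.

(** Dahlquist's G-stability: the BDF sum tested with the multiplier dominates the increment of a
    quadratic energy, so that summation over the time steps telescopes. *)
Lemma gform_step (R : realType) (X : lmodType R) (s : X -> X -> R)
    (hs : psd_form s) (k : nat) (y : nat -> X) : (1 <= k <= 5)%N ->
  gform s k y - gform s k (fun i => y i.+1) <=
    s (\sum_(l < k.+1) (bdf_table R k)`_l *: y l) (y 0 - (19 / 20) *: y 1).
Proof.
case: k => [|[|[|[|[|[|k]]]]]] // _.
- exact: gform_step1.
- exact: gform_step2.
- exact: gform_step3.
- exact: gform_step4.
- exact: gform_step5.
Qed.

(** Definiteness of the energy is used in the direction of the newest value; 1/1000 is a crude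
    constant common to all [k]. *)
Lemma gform_lb (R : realType) (X : lmodType R) (s : X -> X -> R)
    (hs : psd_form s) (k : nat) (y : nat -> X) : (1 <= k <= 5)%N ->
  1 / 1000 * s (y 0) (y 0) <= gform s k y.
Proof.
case: k => [|[|[|[|[|[|k]]]]]] // _.
- exact: gform_lb1.
- exact: gform_lb2.
- exact: gform_lb3.
- exact: gform_lb4.
- exact: gform_lb5.
Qed.

(** The constant is chosen before the space and the form, so that the stability bound is uniform in
    them. It serves to bound the energy at step [k]. *)
Lemma gform_ub (R : realType) (k : nat) : exists g : R, 0 <= g /\
  forall (X : lmodType R) (s : X -> X -> R) (y : nat -> X), psd_form s ->
    gform s k y <= g * \sum_(i < k) s (y i) (y i).
Proof.
pose M i j : R := `|(nth [::] (bdf_gmatrix R k) i)`_j|.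
exists (\sum_(i < k) \sum_(j < k) M i j); split.
  by apply: sumr_ge0 => i _; apply: sumr_ge0 => j _; exact: normr_ge0.
move=> X s y hs; rewrite mulr_suml ler_sum// => i _.
rewrite mulr_suml ler_sum// => j _.
rewrite (le_trans (ler_norm _))// normrM ler_wpM2l//.
set S := \sum_(_ < _) _.
have le_S (l : 'I_k) : s (y l) (y l) <= S.
  by rewrite /S (bigD1 l)//= lerDl sumr_ge0// => l' _; exact: psd_ge0.
have := psd_CS hs (y i) (y j).
have := fnorm_sqr hs (y i); have := fnorm_sqr hs (y j).
have := le_S i; have := le_S j.
by move: (fnorm s _) (fnorm s _) => u v; nra.
Qed.

Lemma bdf_coef_bin (R : realType) k l :
  bdf_coef R k l = \sum_(1 <= j < k.+1) j%:R^-1 * ((-1) ^+ l *+ 'C(j, l)).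
Proof.
rewrite /bdf_coef coef_sum; apply: eq_bigr => j _.
rewrite coefZ; congr (_ * _); rewrite exprBn coef_sum.
have coefE i : ((-1) ^+ i * 1 ^+ (j - i) * 'X^i *+ 'C(j, i) : {poly R})`_l
    = (-1) ^+ i * (l == i)%:R *+ 'C(j, i).
  have -> : (-1) ^+ i = ((-1) ^+ i)%:P :> {poly R}.
    by rewrite polyC_exp polyCN polyC1.
  by rewrite coefMn expr1n mulr1 coefCM coefXn.
under eq_bigr do rewrite coefE.
have [jl|lj] := ltnP j l.
  rewrite bin_small// mulr0n big1// => i _.
  by rewrite gtn_eqF ?mulr0 ?mul0rn// (leq_ltn_trans _ jl)// -ltnS.
rewrite (bigD1 (Ordinal (n := j.+1) (m := l) lj)) //= eqxx mulr1.
rewrite big1 ?addr0// => i il; case: eqP => [li|]; last by rewrite mulr0 mul0rn.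
by move: il; rewrite -val_eqE /= li eqxx.
Qed.

Lemma bdf_coefE (R : realType) k l : (1 <= k <= 5)%N -> (l <= k)%N ->
  bdf_coef R k l = (bdf_table R k)`_l.
Proof.
rewrite bdf_coef_bin.
case: k => [|[|[|[|[|[|k]]]]]] // _; case: l => [|[|[|[|[|[|l]]]]]] // _;
rewrite /index_iota /= !big_cons big_nil /binomial /= ?exprS ?expr0; abstract lra.
Qed.

Lemma bdf_coef0_gt0 (R : realType) k : (1 <= k <= 5)%N -> 0 < bdf_coef R k 0.
Proof.
move=> hk; rewrite bdf_coefE//.
by case: k hk => [|[|[|[|[|[|k]]]]]] // _ /=; lra.
Qed.

(* The order conditions of BDF-k. *)
Lemma bdf_order (R : realType) k j : (1 <= k <= 5)%N -> (j <= k)%N ->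
  \sum_(l < k.+1) bdf_coef R k l * (- l%:R) ^+ j = (j == 1)%:R.
Proof.
move=> hk jk.
rewrite (eq_bigr (fun l : 'I_k.+1 => (bdf_table R k)`_l * (- l%:R) ^+ j)); last first.
  by move=> l _; rewrite bdf_coefE// -ltnS.
rewrite -(big_mkord xpredT (fun l => (bdf_table R k)`_l * (- l%:R) ^+ j)).
rewrite /index_iota; move: hk jk.
case: k => [|[|[|[|[|[|k]]]]]] // _; case: j => [|[|[|[|[|[|j]]]]]] // _.
all: rewrite /= !big_cons big_nil /= ?exprS ?expr0; abstract lra.
Qed.

(** * Taylor expansion and consistency *)

Section scalar_calculus.
Context {R : realType}.
Implicit Types (m : R -> R) (lo hi : R).

Definition cont_on lo hi m := forall t, lo <= t <= hi -> forall e, 0 < e ->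
  exists2 del, 0 < del & forall s, lo <= s <= hi -> `|s - t| < del ->
    `|m s - m t| <= e.

Definition deriv_on lo hi m m' := forall t, lo <= t <= hi -> forall e, 0 < e ->
  exists2 del, 0 < del & forall s, lo <= s <= hi -> `|s - t| < del ->
    `|m s - m t - (s - t) * m' t| <= e * `|s - t|.

Lemma deriv_cont lo hi m m' : deriv_on lo hi m m' -> cont_on lo hi m.
Proof.
move=> dm t ht e e0; have [del del0 h] := dm t ht 1 ltr01.
have M0 : 0 < 1 + `|m' t| by rewrite ltr_wpDr.
exists (Num.min del (e / (1 + `|m' t|))); first by rewrite lt_min del0 divr_gt0.
move=> s hs; rewrite lt_min => /andP[sd se].
have := h _ hs sd; rewrite mul1r => {}h.
rewrite ltr_pdivlMr// in se.
have := ler_normD (m s - m t - (s - t) * m' t) ((s - t) * m' t).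
rewrite subrK normrM => h2; nra.
Qed.

Lemma cont_within lo hi m : cont_on lo hi m -> {within `[lo, hi], continuous m}.
Proof.
move=> cm; apply/subspace_continuousP => t /=; rewrite in_itv/= => ht.
apply/cvgrPdist_le => e e0; have [del del0 h] := cm t ht e e0.
rewrite near_withinE; exists del => //= s sd; rewrite in_itv/= => hs.
by rewrite distrC h// distrC.
Qed.

Lemma deriv_interior lo hi m m' t : deriv_on lo hi m m' -> lo < t < hi ->
  is_derive t 1 m (m' t).
Proof.
move=> dm /andP[lt th].
suff cv : h^-1 *: (m (h *: 1%R + t) - m t) @[h --> 0^'] --> m' t.
  have dmt : derivable m t 1 by apply/cvg_ex; exists (m' t).
  by apply: (DeriveDef dmt); exact/cvg_lim.
apply/cvgrPdist_le => e e0.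
have ht : lo <= t <= hi by rewrite !ltW.
have [del del0 hd] := dm t ht e e0.
exists (Num.min del (Num.min (t - lo) (hi - t))) => /=.
  by rewrite !lt_min del0 !subr_gt0 lt th.
move=> h /=; rewrite sub0r normrN !lt_min => /and3P[hdel hlo hhi] h0.
have ht' : lo <= h + t <= hi by move: hlo hhi; rewrite !ltr_norml; lra.
have := hd (h + t) ht'; rewrite addrK => /(_ hdel) {}hd.
have hn : 0 < `|h| by rewrite normr_gt0.
rewrite distrC /GRing.scale/= mulr1 -(ler_pM2r hn) -normrM.
by rewrite mulrBl mulrAC mulVf// mul1r [m' t * h]mulrC.
Qed.

Lemma deriv_mvt lo hi m m' : lo < hi -> deriv_on lo hi m m' ->
  exists2 r, lo < r < hi & m hi - m lo = m' r * (hi - lo).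
Proof.
move=> lohi dm.
have [r rlh ->] := MVT lohi
  (fun t (ht : t \in `]lo, hi[) => deriv_interior dm ht)
  (cont_within (deriv_cont dm)).
by exists r.
Qed.

Lemma deriv_sub lo hi lo' hi' m m' : lo <= lo' -> hi' <= hi ->
  deriv_on lo hi m m' -> deriv_on lo' hi' m m'.
Proof.
move=> l h dm t /andP[t1 t2] e e0.
have [|del del0 hd] := dm t _ e e0; first by rewrite (le_trans l)// (le_trans _ h).
exists del => // s /andP[s1 s2]; apply: hd.
by rewrite (le_trans l)// (le_trans _ h).
Qed.

Lemma deriv_shift lo hi x m m' : deriv_on (lo + x) (hi + x) m m' ->
  deriv_on lo hi (fun t => m (t + x)) (fun t => m' (t + x)).
Proof.
move=> dm t ht e e0; have [|del del0 hd] := dm (t + x) _ e e0.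
  by rewrite !lerD2r.
exists del => // s hs st; have := hd (s + x).
have -> : s + x - (t + x) = s - t by ring.
by rewrite !lerD2r; exact.
Qed.

Lemma deriv_onD lo hi m1 m1' m2 m2' : deriv_on lo hi m1 m1' ->
  deriv_on lo hi m2 m2' ->
  deriv_on lo hi (fun t => m1 t + m2 t) (fun t => m1' t + m2' t).
Proof.
move=> d1 d2 t ht e e0; have e2 : 0 < e / 2 by rewrite divr_gt0.
have [x x0 h1] := d1 t ht _ e2; have [y y0 h2] := d2 t ht _ e2.
exists (Num.min x y) => [|s hs]; first by rewrite lt_min x0 y0.
rewrite lt_min => /andP[sx sy].
have := h1 s hs sx; have := h2 s hs sy; rewrite !ler_norml; lra.
Qed.

Lemma deriv_onZ lo hi r m m' : deriv_on lo hi m m' ->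
  deriv_on lo hi (fun t => r * m t) (fun t => r * m' t).
Proof.
move=> dm t ht e e0; have r0 : 0 < `|r| + 1 by rewrite ltr_wpDl.
have [x x0 h] := dm t ht _ (divr_gt0 e0 r0).
exists x => // s hs sx; have := h s hs sx.
have -> : r * m s - r * m t - (s - t) * (r * m' t) = r * (m s - m t - (s - t) * m' t) by ring.
rewrite normrM => {}h.
rewrite (le_trans (ler_wpM2l (normr_ge0 r) h))// mulrA ler_wpM2r//.
by rewrite mulrCA ger_pMr// ler_pdivrMr// mul1r lerDl.
Qed.

Lemma deriv_onB lo hi m1 m1' m2 m2' : deriv_on lo hi m1 m1' ->
  deriv_on lo hi m2 m2' ->
  deriv_on lo hi (fun t => m1 t - m2 t) (fun t => m1' t - m2' t).
Proof.
move=> d1 d2; have := deriv_onD d1 (deriv_onZ (-1) d2).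
by move=> h t ht e /(h t ht)[x x0 hx]; exists x => // s hs /(hx s hs); rewrite !mulN1r.
Qed.

Lemma deriv_sum lo hi n (m m' : nat -> R -> R) :
  (forall j, (j < n)%N -> deriv_on lo hi (m j) (m' j)) ->
  deriv_on lo hi (fun t => \sum_(j < n) m j t) (fun t => \sum_(j < n) m' j t).
Proof.
elim: n => [_ t _ e e0|n ih dm].
  by exists 1 => // s _ _; rewrite !big_ord0 !subr0 mulr0 subrr normr0 mulr_ge0// ltW.
have := deriv_onD (ih (fun j jn => dm j (leqW jn))) (dm n (ltnSn n)).
move=> h t ht e /(h t ht)[x x0 hx]; exists x => // s hs /(hx s hs).
by rewrite !big_ord_recr.
Qed.

Lemma deriv_le lo hi m m' K : deriv_on lo hi m m' ->
  (forall r, lo <= r <= hi -> `|m' r| <= K) ->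
  forall t, lo <= t <= hi -> `|m t - m hi| <= K * (hi - t).
Proof.
move=> dm mK t /andP[lt]; rewrite le_eqVlt => /predU1P[->|th].
  by rewrite !subrr normr0 mulr0.
have [r /andP[r1 r2] e] := deriv_mvt th (deriv_sub lt (lexx hi) dm).
have ht : 0 <= hi - t by rewrite subr_ge0 ltW.
rewrite distrC e normrM (ger0_norm ht) ler_wpM2r//.
by apply: mK; rewrite (ltW r2) (le_trans lt)// ltW.
Qed.

Lemma deriv_mulX lo hi x m m' : deriv_on lo hi m m' ->
  deriv_on lo hi (fun t => (t - x) * m t) (fun t => m t + (t - x) * m' t).
Proof.
move=> dm t ht e e0; have K0 : 0 < `|t - x| + 1 by rewrite ltr_wpDl.
have e2 : 0 < e / 2 by rewrite divr_gt0.
have [y y0 h1] := dm t ht _ (divr_gt0 e2 K0).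
have [z z0 h2] := deriv_cont dm ht e2.
exists (Num.min y z) => [|s hs]; first by rewrite lt_min y0 z0.
rewrite lt_min => /andP[sy sz]; have {}h1 := h1 _ hs sy; have {}h2 := h2 _ hs sz.
have -> : (s - x) * m s - (t - x) * m t - (s - t) * (m t + (t - x) * m' t)
  = (t - x) * (m s - m t - (s - t) * m' t) + (s - t) * (m s - m t) by ring.
have -> : e * `|s - t| = e / 2 * `|s - t| + e / 2 * `|s - t| by field.
rewrite (le_trans (ler_normD _ _))// !normrM lerD//; last first.
  by rewrite mulrC ler_wpM2r.
rewrite (le_trans (ler_wpM2l (normr_ge0 _) h1))// mulrA ler_wpM2r//.
by rewrite mulrCA ger_pMr// ler_pdivrMr// mul1r lerDl.
Qed.

Lemma deriv_onX lo hi x n :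
  deriv_on lo hi (fun t => (t - x) ^+ n) (fun t => n%:R * (t - x) ^+ n.-1).
Proof.
elim: n => [|n ih].
  by move=> t _ e e0; exists 1 => // s _ _; rewrite !expr0 mul0r mulr0 subrr subr0 normr0 mulr_ge0// ltW.
have := deriv_mulX x ih.
move=> h t ht e /(h t ht)[y y0 hy]; exists y => // s hs /(hy s hs).
rewrite !exprS; congr (`|_ - _ * _| <= _) => /=.
case: n {ih h hy} => [|n]; first by rewrite expr0 !mul0r mulr0 addr0 mul1r.
by rewrite /= -natr1 exprS; ring.
Qed.

(** [P t C] reads: [C] bounds some quantity at [t]. Compactness of [[lo, hi]] makes local bounds
    uniform, both for vectors and for functionals. *)
Lemma locally_bounded lo hi (P : R -> R -> Prop) :
  (forall t C C', C <= C' -> P t C -> P t C') ->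
  (forall t, lo <= t <= hi -> exists C, exists2 del, 0 < del &
     forall s, lo <= s <= hi -> `|s - t| < del -> P s C) ->
  exists2 C, 0 < C & forall t, lo <= t <= hi -> P t C.
Proof.
move=> Pmono Ploc.
have /compact_near_coveringP cov := @segment_compact R lo hi.
have : \forall C \near +oo, `[lo, hi] `<=` (fun t => lo <= t <= hi -> P t C).
  apply: cov => t; rewrite /= in_itv/= => /Ploc[C [del del0 hC]].
  exists ([set s | `|t - s| < del], [set C' | C < C']) => /=.
    by split; [exists del | exists C; rewrite num_real].
  move=> [s C'] /= [st CC'] hs.
  by apply: Pmono (ltW CC') _; apply: hC => //; rewrite distrC.
move=> [M [_ hM]]; exists (Num.max M 0 + 1) => [|t ht].
  by rewrite ltr_wpDl// le_max lexx orbT.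
by apply: hM; rewrite ?ltr_pwDr ?le_max ?lexx//= in_itv.
Qed.

End scalar_calculus.

(** With only [k] derivatives, the remainder is measured by the oscillation [K] of the last one. The
    remainder vanishes at [hi] and its derivative is the remainder of [m 1] of one order less, so
    induction and [deriv_le] give the bound. *)
Lemma taylor_bound (R : realType) (lo hi K : R) k (m : nat -> R -> R) :
  (forall j, (j < k)%N -> deriv_on lo hi (m j) (m j.+1)) ->
  (forall s, lo <= s <= hi -> `|m k s - m k hi| <= K) ->
  forall t, lo <= t <= hi ->
  `|m 0 t - \sum_(i < k.+1) m i hi / i`!%:R * (t - hi) ^+ i|
    <= K * (hi - t) ^+ k.
Proof.
elim: k lo m => [|k ih] lo m dm mK t /andP[lt th].
  by rewrite big_ord_recr big_ord0 /= expr0 !mulr1 divr1 add0r mK ?lt.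
pose P n (m : nat -> R -> R) s := \sum_(i < n.+1) m i hi / i`!%:R * (s - hi) ^+ i.
(* Differentiation drops the constant term and lowers each factorial, which leaves the Taylor
   polynomial of [m 1]. *)
have dP : deriv_on t hi (P k.+1 m) (P k (fun i => m i.+1)).
  have := deriv_sum (lo := t) (hi := hi) (n := k.+2)
    (fun j _ => deriv_onZ (m j hi / j`!%:R) (deriv_onX (lo:=t) (hi:=hi) hi j)).
  move=> h s hs e /(h s hs)[y y0 hy]; exists y => // s' hs' /(hy s' hs').
  rewrite /P; congr (`|_ - _ * _| <= _).
  rewrite big_ord_recl mul0r mulr0 add0r; apply: eq_bigr => i _.
  rewrite lift0 factS natrM /=.
  have : i`!%:R != 0 :> R by rewrite pnatr_eq0 -lt0n fact_gt0.
  have : i.+1%:R != 0 :> R by rewrite pnatr_eq0.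
  move: (i.+1%:R : R) (i`!%:R : R) => u v u0 v0; field.
  by rewrite u0 v0.
have dr := deriv_onB (deriv_sub lt (lexx hi) (dm 0 isT)) dP.
have rK s : t <= s <= hi -> `|m 1 s - P k (fun i => m i.+1) s| <= K * (hi - t) ^+ k.
  move=> /andP[ts sh].
  have hs : lo <= s <= hi by rewrite (le_trans lt).
  have K0 : 0 <= K by exact: le_trans (normr_ge0 _) (mK _ hs).
  apply: (le_trans (ih lo (fun i => m i.+1) _ _ s hs)) => //.
    by move=> j jk; exact: dm.
  by rewrite ler_wpM2l// lerXn2r ?nnegrE ?subr_ge0 ?lerB// (le_trans ts).
have := deriv_le dr rK (t := t); rewrite lexx th => /(_ isT).
have -> : P k.+1 m hi = m 0 hi.
  rewrite /P big_ord_recl expr0 divr1 mulr1 big1 ?addr0// => i _.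
  by rewrite subrr expr0n /= mulr0.
by rewrite subrr subr0 exprSr mulrA.
Qed.

(** BDF-k differentiates polynomials of degree at most [k] exactly at [t], so only the Taylor
    remainders at the earlier grid points survive. *)
Lemma bdf_consistency (R : realType) k : (1 <= k <= 5)%N ->
  exists2 C : R, 0 <= C & forall (tau t K : R) (m : nat -> R -> R), 0 < tau ->
  (forall j, (j < k)%N -> deriv_on (t - k%:R * tau) t (m j) (m j.+1)) ->
  (forall s, t - k%:R * tau <= s <= t -> `|m k s - m k t| <= K) ->
  `|\sum_(l < k.+1) bdf_coef R k l * m 0 (t - l%:R * tau) - tau * m 1 t|
    <= C * tau ^+ k * K.
Proof.
move=> hk; exists (\sum_(l < k.+1) `|bdf_coef R k l| * l%:R ^+ k).
  by apply: sumr_ge0 => l _; rewrite mulr_ge0 ?exprn_ge0.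
move=> tau t K m tau0 dm mK.
pose P s := \sum_(i < k.+1) m i t / i`!%:R * (s - t) ^+ i.
(* The order conditions pick out the linear coefficient of [P]. *)
have -> : tau * m 1 t = \sum_(l < k.+1) bdf_coef R k l * P (t - l%:R * tau).
  under eq_bigr => l _ do rewrite mulr_sumr.
  rewrite exchange_big /=.
  rewrite (eq_bigr (fun i : 'I_k.+1 => m i t / i`!%:R * tau ^+ i * (i == 1 :> nat)%:R)).
    have k1 : (1 < k.+1)%N by case/andP: hk.
    rewrite (bigD1 (Ordinal k1))//= big1 ?addr0 => [|i ine1].
      by rewrite divr1 mulr1 expr1 mulrC.
    by rewrite -val_eqE /= in ine1; rewrite (negPf ine1) mulr0.
  move=> i _; have ik : (i <= k)%N by rewrite -ltnS.
  rewrite -(bdf_order R hk ik) mulr_sumr.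
  apply: eq_bigr => l _.
  have -> : t - l%:R * tau - t = tau * - l%:R by ring.
  by rewrite exprMn; ring.
rewrite -sumrB !mulr_suml (le_trans (ler_norm_sum _ _ _))// ler_sum// => l _.
rewrite -mulrBr normrM -!mulrA ler_wpM2l//.
have lk : l%:R * tau <= k%:R * tau by rewrite ler_wpM2r ?(ltW tau0)// ler_nat -ltnS.
have lt0 : 0 <= l%:R * tau by rewrite mulr_ge0// ltW.
have := taylor_bound dm mK (t := t - l%:R * tau).
rewrite lerB//= gerBl lt0 => /(_ isT) h.
rewrite (le_trans h)// mulrA -exprMn mulrC.
by have -> : t - (t - l%:R * tau) = l%:R * tau by ring.
Qed.

Section vector_calculus.
Context {R : realType} {X : lmodType R} {s : X -> X -> R} (hs : psd_form s).
Local Notation N := (fnorm s).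
Implicit Types (x : R -> X) (f : R -> X -> R) (lo hi : R).

(** Bounds the dual norm without forming a supremum, whose finiteness would have to be known. Thus
    [fcont] and [fderiv] are continuity and differentiability in the dual norm. *)
Definition fbounded (F : X -> R) (C : R) := forall v, `|F v| <= C * N v.

Definition vcont lo hi x := forall t, lo <= t <= hi -> forall e, 0 < e ->
  exists2 del, 0 < del & forall r, lo <= r <= hi -> `|r - t| < del ->
    N (x r - x t) <= e.

Definition vderiv lo hi x x' := forall t, lo <= t <= hi -> forall e, 0 < e ->
  exists2 del, 0 < del & forall r, lo <= r <= hi -> `|r - t| < del ->
    N (x r - x t - (r - t) *: x' t) <= e * `|r - t|.

Definition fcont lo hi f := forall t, lo <= t <= hi -> forall e, 0 < e ->
  exists2 del, 0 < del & forall r, lo <= r <= hi -> `|r - t| < del ->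
    fbounded (fun v => f r v - f t v) e.

Definition fderiv lo hi f f' := forall t, lo <= t <= hi -> forall e, 0 < e ->
  exists2 del, 0 < del & forall r, lo <= r <= hi -> `|r - t| < del ->
    fbounded (fun v => f r v - f t v - (r - t) * f' t v) (e * `|r - t|).

Lemma fboundedW F C C' : fbounded F C -> C <= C' -> fbounded F C'.
Proof. by move=> h CC v; rewrite (le_trans (h v))// ler_wpM2r// fnorm_ge0. Qed.

Lemma vderiv_cont lo hi x x' : vderiv lo hi x x' -> vcont lo hi x.
Proof.
move=> dx t ht e e0; have [del del0 h] := dx t ht 1 ltr01.
have M0 : 0 < 1 + N (x' t) by rewrite ltr_wpDr// fnorm_ge0.
exists (Num.min del (e / (1 + N (x' t)))); first by rewrite lt_min del0 divr_gt0.
move=> r hr; rewrite lt_min => /andP[rd re].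
have := h _ hr rd; rewrite mul1r => {}h.
rewrite ltr_pdivlMr// in re.
have := fnormD hs (x r - x t - (r - t) *: x' t) ((r - t) *: x' t).
rewrite subrK fnormZ// => h2; nra.
Qed.

Lemma vcont_bounded lo hi x : vcont lo hi x ->
  exists2 C, 0 < C & forall t, lo <= t <= hi -> N (x t) <= C.
Proof.
move=> cx; apply: (locally_bounded (P := fun t C => N (x t) <= C)).
  by move=> t C C' CC /le_trans; apply.
move=> t ht; have [del del0 h] := cx t ht 1 ltr01.
exists (N (x t) + 1), del => // r hr rd.
by have := fnormD hs (x r - x t) (x t); have := h r hr rd; rewrite subrK; lra.
Qed.

Lemma fcont_bounded lo hi f : fcont lo hi f ->
  (forall t, lo <= t <= hi -> exists C, fbounded (f t) C) ->
  exists2 C, 0 < C & forall t, lo <= t <= hi -> fbounded (f t) C.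
Proof.
move=> cf bf; apply: (locally_bounded (P := fun t C => fbounded (f t) C)).
  by move=> t C C' CC h; exact: fboundedW h CC.
move=> t ht; have [del del0 h] := cf t ht 1 ltr01.
have [C hC] := bf t ht.
exists (C + 1), del => // r hr rd v.
have := h r hr rd v; have := hC v; have := fnorm_ge0 s v.
have := ler_normD (f r v - f t v) (f t v); rewrite subrK; nra.
Qed.

Lemma vderiv_lin lo hi x x' F C : vderiv lo hi x x' -> lin F -> fbounded F C ->
  deriv_on lo hi (F \o x) (F \o x').
Proof.
move=> dx lF bF t ht e e0.
have C0 : 0 < `|C| + 1 by rewrite ltr_wpDl.
have [del del0 h] := dx t ht _ (divr_gt0 e0 C0).
exists del => // r hr rt; have := h r hr rt.
rewrite /= -(linZ lF) -!(linB lF) => {}h.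
rewrite (le_trans (bF _))// (le_trans (y := (`|C| + 1) * N (x r - x t - (r - t) *: x' t)))//.
  by rewrite ler_wpM2r ?fnorm_ge0// (le_trans (ler_norm _))// lerDl.
rewrite (le_trans (ler_wpM2l (ltW C0) h))// mulrA ler_wpM2r//.
by rewrite mulrCA divff ?mulr1// gt_eqF.
Qed.

Lemma fderiv_eval lo hi f f' v : fderiv lo hi f f' ->
  deriv_on lo hi (f ^~ v) (f' ^~ v).
Proof.
move=> df t ht e e0.
have C0 : 0 < N v + 1 by rewrite ltr_wpDl// fnorm_ge0.
have [del del0 h] := df t ht _ (divr_gt0 e0 C0).
exists del => // r hr rt; have := h r hr rt v => {}h.
rewrite (le_trans h)// mulrAC ler_wpM2r// mulrAC -mulrA ger_pMr//.
by rewrite ler_pdivrMr// mul1r lerDl.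
Qed.

(** The mean value theorem needs a scalar function: it is applied to the product with the total
    increment [z], and [s z z] is the square of the seminorm of [z]. *)
Lemma vderiv_lip lo hi x x' C : vderiv lo hi x x' ->
  (forall t, lo <= t <= hi -> N (x' t) <= C) ->
  forall r t, lo <= r -> r <= t -> t <= hi -> N (x t - x r) <= C * (t - r).
Proof.
move=> dx bx r t lr; rewrite le_eqVlt => /predU1P[<-|rt] th.
  by rewrite !subrr fnorm0// mulr0.
pose z := x t - x r.
have bz : fbounded (s z) (N z) by move=> v; exact: psd_CS.
have [q /andP[q1 q2]] := deriv_mvt rt (deriv_sub lr th (vderiv_lin dx (psd_linr hs z) bz)).
rewrite /= -(linB (psd_linr hs z)) -/z -(fnorm_sqr hs) => e.
have qq : lo <= q <= hi by rewrite (le_trans lr (ltW q1)) (le_trans (ltW q2) th).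
have xC := bx q qq; have x0 := fnorm_ge0 s (x' q); have z0 := fnorm_ge0 s z.
have tr : 0 < t - r by rewrite subr_gt0.
have [->|zn0] := eqVneq (N z) 0; first by rewrite (mulr_ge0 (le_trans x0 xC) (ltW tr)).
have zp : 0 < N z by rewrite lt0r zn0.
rewrite -(ler_pM2l zp) -expr2 e mulrA (ler_wpM2r (ltW tr))//.
by rewrite (le_trans (ler_norm _))// (le_trans (bz _))// ler_wpM2l.
Qed.

Lemma fderiv_lip lo hi f f' C : fderiv lo hi f f' ->
  (forall t, lo <= t <= hi -> fbounded (f' t) C) ->
  forall r t, lo <= r -> r <= t -> t <= hi ->
  fbounded (fun v => f t v - f r v) (C * (t - r)).
Proof.
move=> df bf r t lr; rewrite le_eqVlt => /predU1P[<-|rt] th v.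
  by rewrite !subrr normr0 mulr0 mul0r.
have [q /andP[q1 q2] ->] := deriv_mvt rt (deriv_sub lr th (fderiv_eval v df)).
have qq : lo <= q <= hi by rewrite (le_trans lr (ltW q1)) (le_trans (ltW q2) th).
have tr : 0 <= t - r by rewrite subr_ge0 ltW.
by rewrite normrM (ger0_norm tr) mulrAC ler_wpM2r// bf.
Qed.

Lemma fderiv_cont lo hi f f' : fderiv lo hi f f' ->
  (forall t, lo <= t <= hi -> exists C, fbounded (f' t) C) -> fcont lo hi f.
Proof.
move=> df bf t ht e e0; have [del del0 h] := df t ht 1 ltr01.
have [C hC] := bf t ht.
have M0 : 0 < 1 + `|C| by rewrite ltr_wpDr.
exists (Num.min del (e / (1 + `|C|))); first by rewrite lt_min del0 divr_gt0.
move=> r hr; rewrite lt_min => /andP[rd re] v.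
have := h _ hr rd v; rewrite mul1r => {}h.
rewrite ltr_pdivlMr// in re.
have := hC v => {}hC.
have := ler_normD (f r v - f t v - (r - t) * f' t v) ((r - t) * f' t v).
rewrite subrK normrM => h2.
have CC : C <= `|C| := ler_norm C.
have v0 := fnorm_ge0 s v.
apply: (le_trans h2); apply: (le_trans (lerD h (ler_wpM2l (normr_ge0 _) hC))).
apply: (le_trans (y := `|r - t| * (1 + `|C|) * N v)).
  rewrite mulrA -mulrDl ler_wpM2r//; have := normr_ge0 (r - t); nra.
by rewrite ler_wpM2r// ltW.
Qed.

Lemma pairing_deriv lo hi f f' x x' : fderiv lo hi f f' -> vderiv lo hi x x' ->
  (forall t, lo <= t <= hi -> lin (f t) /\ exists C, fbounded (f t) C) ->
  (forall t, lo <= t <= hi -> lin (f' t) /\ exists C, fbounded (f' t) C) ->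
  deriv_on lo hi (fun t => f t (x t)) (fun t => f' t (x t) + f t (x' t)).
Proof.
move=> df dx hf hf' t ht e e0.
have [lf [A bA]] := hf t ht; have [lf' [B bB]] := hf' t ht.
have [M M0 bM] := vcont_bounded (vderiv_cont dx).
have e1 : 0 < e / (3 * M) by rewrite divr_gt0// mulr_gt0.
have A0 : 0 < `|A| + 1 by rewrite ltr_wpDl.
have {}bA : fbounded (f t) (`|A| + 1).
  by apply: fboundedW bA _; rewrite (le_trans (ler_norm _))// lerDl.
have e2 : 0 < e / (3 * (`|A| + 1)) by rewrite divr_gt0// mulr_gt0.
have B0 : 0 < `|B| + 1 by rewrite ltr_wpDl.
have {}bB : fbounded (f' t) (`|B| + 1).
  by apply: fboundedW bB _; rewrite (le_trans (ler_norm _))// lerDl.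
have e3 : 0 < e / (3 * (`|B| + 1)) by rewrite divr_gt0// mulr_gt0.
have [d1 d10 h1] := df t ht _ e1.
have [d2 d20 h2] := dx t ht _ e2.
have [d3 d30 h3] := vderiv_cont dx ht e3.
exists (Num.min d1 (Num.min d2 d3)) => [|r hr]; first by rewrite !lt_min d10 d20.
rewrite !lt_min => /and3P[r1 r2 r3].
have {}h1 := h1 r hr r1 (x r); have {}h2 := h2 r hr r2; have {}h3 := h3 r hr r3.
(* Product rule with three errors: that of [f] at [x r], that of [x] under [f t], and the shift from
   [x t] to [x r] under [f' t]. Each receives [e / 3]. *)
have -> : f r (x r) - f t (x t) - (r - t) * (f' t (x t) + f t (x' t)) =
    (f r (x r) - f t (x r) - (r - t) * f' t (x r)) +
    f t (x r - x t - (r - t) *: x' t) + (r - t) * f' t (x r - x t).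
  by rewrite !(linB lf) (linB lf') (linZ lf); ring.
have {}h1 : `|f r (x r) - f t (x r) - (r - t) * f' t (x r)| <= e / 3 * `|r - t|.
  rewrite (le_trans h1)//.
  have -> : e / 3 * `|r - t| = e / (3 * M) * `|r - t| * M by field; rewrite gt_eqF.
  by rewrite ler_wpM2l ?bM// mulr_ge0// ltW.
have {}h2 : `|f t (x r - x t - (r - t) *: x' t)| <= e / 3 * `|r - t|.
  rewrite (le_trans (bA _))//.
  have -> : e / 3 * `|r - t| = (`|A| + 1) * (e / (3 * (`|A| + 1)) * `|r - t|).
    by field; rewrite gt_eqF.
  by rewrite ler_wpM2l// ltW.
have {}h3 : `|(r - t) * f' t (x r - x t)| <= e / 3 * `|r - t|.
  rewrite normrM mulrC ler_wpM2r// (le_trans (bB _))//.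
  have -> : e / 3 = (`|B| + 1) * (e / (3 * (`|B| + 1))) by field; rewrite gt_eqF.
  by rewrite ler_wpM2l// ltW.
have := ler_normD (f r (x r) - f t (x r) - (r - t) * f' t (x r) + f t (x r - x t - (r - t) *: x' t)) ((r - t) * f' t (x r - x t)).
have := ler_normD (f r (x r) - f t (x r) - (r - t) * f' t (x r)) (f t (x r - x t - (r - t) *: x' t)).
by lra.
Qed.
End vector_calculus.
Arguments fbounded {R X} s F C.
Arguments vcont {R X} s lo hi x.
Arguments vderiv {R X} s lo hi x x'.
Arguments fcont {R X} s lo hi f.
Arguments fderiv {R X} s lo hi f f'.

(** * The closure of the elliptic operator *)

(** Restricting to [e <= 1] lets terms of order [e ^+ 2] be absorbed into [e * E]. *)
Lemma le_of_eps (R : realType) (A B E : R) :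
  (forall e, 0 < e -> e <= 1 -> A <= B + e * E) -> A <= B.
Proof.
move=> h; rewrite leNgt; apply/negP => BA.
have E1 : 0 < `|E| + 1 by rewrite ltr_wpDl.
pose e := Num.min 1 ((A - B) / 2 / (`|E| + 1)).
have e0 : 0 < e by rewrite lt_min ltr01 !divr_gt0// subr_gt0.
have e1 : e <= 1 by rewrite ge_min lexx.
have := h e e0 e1.
have : e * (`|E| + 1) <= (A - B) / 2 by rewrite -ler_pdivlMr// ge_min lexx orbT.
have := ler_norm E; nra.
Qed.

Section dual_norm.
Context {R : realType} {X : lmodType R} {s : X -> X -> R} (hs : psd_form s).
Local Notation N := (fnorm s).
Implicit Types F : X -> R.

Definition dualnorm F : R := sup [set `|F x| | x in [set x | N x <= 1]].

Let dset F C : 0 <= C -> fbounded s F C ->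
  has_sup [set `|F x| | x in [set x | N x <= 1]].
Proof.
move=> C0 FC; split; first by exists `|F 0|, 0 => //=; rewrite fnorm0// ler01.
exists C => _ [x /= x1 <-]; rewrite (le_trans (FC x))//.
by rewrite -[leRHS]mulr1 ler_wpM2l.
Qed.

Lemma dualnorm_le F C : 0 <= C -> fbounded s F C -> dualnorm F <= C.
Proof.
move=> C0 FC; apply: ge_sup; first by exists `|F 0|, 0 => //=; rewrite fnorm0// ler01.
move=> _ [x /= x1 <-]; rewrite (le_trans (FC x))//.
by rewrite -[leRHS]mulr1 ler_wpM2l.
Qed.

Lemma dualnormP F C : lin F -> fbounded s F C -> fbounded s F (dualnorm F).
Proof.
move=> lF FC x.
have {}FC : fbounded s F `|C|.
  exact: (fboundedW FC (ler_norm C)).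
(* [N] is a seminorm; on its kernel, boundedness forces [F x = 0]. *)
have [x0|x0] := eqVneq (N x) 0.
  by have := FC x; rewrite x0 !mulr0.
have xp : 0 < N x by rewrite lt0r x0 fnorm_ge0.
have : `|F ((N x)^-1 *: x)| <= dualnorm F.
  apply: ub_le_sup; first exact: (dset (normr_ge0 C) FC).2.
  by exists ((N x)^-1 *: x) => //=; rewrite fnormZ// ger0_norm ?invr_ge0 ?(ltW xp)// mulVf.
by rewrite (linZ lF) normrM ger0_norm ?invr_ge0 ?(ltW xp)// ler_pdivrMl// mulrC.
Qed.

Lemma dualnorm_ge0 F : 0 <= dualnorm F.
Proof.
rewrite /dualnorm; have [[_ h]|h] := pselect (has_sup [set `|F x| | x in [set x | N x <= 1]]).
  apply: (le_trans (normr_ge0 (F 0))); apply: ub_le_sup => //.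
  by exists 0 => //=; rewrite fnorm0// ler01.
(* [sup] is 0 for a set that has no supremum. *)
by rewrite sup_out.
Qed.

End dual_norm.

Arguments dualnorm {R X} s F.

Section closed_graph.
Context {R : realType} {H Q : lmodType R} {c : H -> H -> R} {b : Q -> Q -> R}
  (hc : psd_form c) (hb : psd_form b) {io : Q -> H}
  (lio : forall r x y, io (r *: x + y) = r *: io x + io y).
Local Notation Nc := (fnorm c).
Local Notation Nb := (fnorm b).
Local Notation D := (dualnorm b).

(* [x] lies in the domain of the closure of the operator [y |-> b y _], which
   maps it to [gam]; so [x] need not be in the image of [io]. *)
Definition closed_graph (x : H) (gam : Q -> R) := forall e, 0 < e ->
  exists2 y, Nc (io y - x) <= e & fbounded b (fun q => b y q - gam q) e.

Let ioB x y : io (x - y) = io x - io y.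
Proof. by rewrite addrC -scaleN1r lio scaleN1r addrC. Qed.

Let ioZ r x : io (r *: x) = r *: io x.
Proof.
have io0 : io 0 = 0 by rewrite -[0]subr0 ioB subrr.
by rewrite -[r *: x]addr0 lio io0 addr0.
Qed.

Lemma closed_graph_elem y : closed_graph (io y) (b y).
Proof.
move=> e e0; exists y; first by rewrite subrr fnorm0// ltW.
by move=> q; rewrite subrr normr0 mulr_ge0 ?fnorm_ge0// ltW.
Qed.

Lemma closed_graph_lin r x gam x' gam' :
  closed_graph x gam -> closed_graph x' gam' ->
  closed_graph (r *: x + x') (fun q => r * gam q + gam' q).
Proof.
move=> gx gx' e e0; have r0 : 0 < `|r| + 1 by rewrite ltr_wpDl.
have e2 : 0 < e / (`|r| + 1) / 2 by rewrite !divr_gt0.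
have e3 : `|r| * (e / (`|r| + 1) / 2) <= e / 2.
  rewrite mulrA ler_pM2r ?invr_gt0// mulrCA ger_pMr//.
  by rewrite ler_pdivrMr// mul1r lerDl.
have [y y1 y2] := gx _ e2; have [y' y1' y2'] := gx' _ (divr_gt0 e0 (ltr0n R 2)).
exists (r *: y + y').
  rewrite lio opprD addrACA -scalerBr (le_trans (fnormD hc _ _))// fnormZ//.
  rewrite [leRHS]splitr lerD//.
  exact: le_trans (ler_wpM2l (normr_ge0 r) y1) e3.
move=> q; rewrite (psd_linear hb).
have -> : r * b y q + b y' q - (r * gam q + gam' q) = r * (b y q - gam q) + (b y' q - gam' q) by ring.
rewrite (le_trans (ler_normD _ _))// normrM [X in X * Nb q]splitr mulrDl lerD//.
rewrite (le_trans (ler_wpM2l (normr_ge0 r) (y2 q)))// mulrA ler_wpM2r//.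
exact: fnorm_ge0.
Qed.

Lemma closed_graphB x gam x' gam' :
  closed_graph x gam -> closed_graph x' gam' ->
  closed_graph (x - x') (fun q => gam q - gam' q).
Proof.
move=> gx gx' e e0; have [y y1 y2] := closed_graph_lin (-1) gx' gx e0.
exists y; first by move: y1; rewrite scaleN1r (addrC _ x).
by move=> q; have := y2 q; rewrite mulN1r (addrC _ (gam q)).
Qed.

Lemma closed_graphZ r x gam : closed_graph x gam ->
  closed_graph (r *: x) (fun q => r * gam q).
Proof.
move=> gx e e0; have [y y1 y2] := closed_graph_lin (r - 1) gx gx e0.
exists y; first by move: y1; rewrite scalerBl scale1r subrK.
by move=> q; have := y2 q; congr (`|_ - _| <= _); ring.
Qed.

Lemma closed_graph_closed x gam :
  (forall e, 0 < e -> exists x' gam', [/\ closed_graph x' gam', Nc (x' - x) <= e &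
     fbounded b (fun q => gam' q - gam q) e]) -> closed_graph x gam.
Proof.
move=> h e e0; have e2 : 0 < e / 2 by rewrite divr_gt0.
have [x' [gam' [/(_ _ e2)[y y1 y2] h1 h2]]] := h _ e2.
exists y.
  have := fnormD hc (io y - x') (x' - x); rewrite addrA subrK; lra.
move=> q; have := y2 q; have := h2 q.
have := ler_normD (b y q - gam' q) (gam' q - gam q); rewrite addrA subrK; lra.
Qed.

Lemma closed_graph_bounded x gam : closed_graph x gam ->
  exists C, fbounded b gam C.
Proof.
move=> /(_ 1 ltr01)[y _ h]; exists (1 + Nb y) => q.
have := h q; have := psd_CS hb y q.
have := ler_normB (b y q) (b y q - gam q).
have -> : b y q - (b y q - gam q) = gam q by ring.
by lra.
Qed.

(** The b-norm of [y] is the dual norm of [b y], which is within [e] of [gam]. So [D gam] is the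
    limit of the b-norms of the approximants, and it replaces the b-norm of a vector outside the
    image of [io]. *)
Let closed_graph_approx y gam e : fbounded b gam (D gam) -> 0 <= D gam ->
  0 <= e -> fbounded b (fun q => b y q - gam q) e ->
  [/\ Nb y <= D gam + e, D gam <= Nb y + e & Nb y ^+ 2 <= gam y + e * Nb y].
Proof.
move=> n D0 e0 cy; have y0 := fnorm_ge0 b y.
have h : Nb y ^+ 2 <= gam y + e * Nb y.
  by rewrite (fnorm_sqr hb); have := le_trans (ler_norm _) (cy y); lra.
split=> //.
  have [->|yn0] := eqVneq (Nb y) 0; first by rewrite addr_ge0.
  have yp : 0 < Nb y by rewrite lt0r yn0.
  rewrite -(ler_pM2r yp) -expr2; have := le_trans (ler_norm _) (n y); lra.
apply: dualnorm_le => [||q]; rewrite ?addr_ge0//.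
have := ler_normB (b y q) (b y q - gam q).
have -> : b y q - (b y q - gam q) = gam q by ring.
by have := cy q; have := psd_CS hb y q; lra.
Qed.

(** This is testing with [x1 - eta *: x2], although it need not lie in the image of [io]. The
    inequality is used at [y1 - eta *: y2] for approximants [y1] and [y2]; there [gam1 y1] tends to
    [D gam1 ^+ 2], while [gam1 y2] is at most [D gam1] times the b-norm of [y2]. Then [e] tends to
    0. *)
Lemma closed_graph_test x1 gam1 x2 gam2 Lam M eta rho :
  closed_graph x1 gam1 -> closed_graph x2 gam2 -> lin gam1 -> lin gam2 ->
  lin Lam -> fbounded c Lam M -> 0 <= eta -> eta <= 1 -> 0 <= rho ->
  (forall q, Lam (io q) + gam1 q <= rho * Nb q) ->
  Lam (x1 - eta *: x2) + D gam1 ^+ 2 - eta * D gam1 * D gam2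
    <= rho * (D gam1 + eta * D gam2).
Proof.
move=> g1 g2 l1 l2 lL bL eta0 eta1 rho0 hq.
have [C1 b1] := closed_graph_bounded g1; have [C2 b2] := closed_graph_bounded g2.
have n1 := dualnormP hb l1 b1; have n2 := dualnormP hb l2 b2.
have D1 := dualnorm_ge0 hb gam1; have D2 := dualnorm_ge0 hb gam2.
have {}bL : fbounded c Lam `|M| by apply: fboundedW bL (ler_norm _).
have M0 : 0 <= `|M| by [].
(* The last argument collects the coefficients of [e], estimated with [eta <= 1] and [e <= 1]. *)
apply: (@le_of_eps _ _ _ (4 * D gam1 + 1 + 2 * rho + 2 * `|M|)) => e e0 e1.
have [y1 a1 c1] := g1 e e0; have [y2 a2 c2] := g2 e e0.
have [u1 u2 u3] := closed_graph_approx n1 D1 (ltW e0) c1.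
have [v1 _ _] := closed_graph_approx n2 D2 (ltW e0) c2.
have h1 : Lam (x1 - eta *: x2) <= Lam (io (y1 - eta *: y2)) + `|M| * (2 * e).
  have k1 := le_trans (bL (io y1 - x1)) (ler_wpM2l M0 a1).
  have k2 := le_trans (ler_norm _) (le_trans (bL (io y2 - x2)) (ler_wpM2l M0 a2)).
  have k3 := ler_wpM2l eta0 k2.
  have k4 : eta * (`|M| * e) <= `|M| * e by rewrite ler_piMl// mulr_ge0// ltW.
  rewrite ioB ioZ !(linB lL) !(linZ lL).
  by move: k1 k3; rewrite !(linB lL) ler_norml; lra.
have h2 := hq (y1 - eta *: y2).
have h3 : Nb (y1 - eta *: y2) <= Nb y1 + eta * Nb y2.
  by rewrite (le_trans (fnormB hb _ _))// fnormZ// ger0_norm.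
have h4 := le_trans (ler_norm _) (n1 y2).
have h5 := ler_wpM2l rho0 h3.
have h6 := ler_wpM2l eta0 h4.
have h7 := ler_wpM2l eta0 v1.
have h8 := ler_wpM2l rho0 u1; have h9 := ler_wpM2l rho0 h7.
rewrite (linB l1) (linZ l1) in h2.
move: h1 h2 h5 h6 h7 h8 h9 u1 u2 u3 v1 => h1 h2 h5 h6 h7 h8 h9 u1 u2 u3 v1.
have u0 := fnorm_ge0 b y1.
have k1 : D gam1 ^+ 2 - Nb y1 ^+ 2 <= 2 * e * D gam1.
  have [uD|Du] := lerP (D gam1) (Nb y1).
    have : D gam1 ^+ 2 <= Nb y1 ^+ 2 by rewrite lerXn2r ?nnegrE.
    have : 0 <= 2 * e * D gam1 by rewrite mulr_ge0// mulr_ge0// ltW.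
    by lra.
  by nra.
have k2 : e * Nb y1 <= e * D gam1 + e * 1.
  by rewrite -mulrDr ler_wpM2l ?(ltW e0)//; lra.
have k3 : D gam1 * (eta * Nb y2) <= D gam1 * (eta * D gam2) + e * D gam1.
  have := ler_wpM2l D1 h7; have : eta * e <= e by rewrite ler_piMl// ltW.
  by move=> /(ler_wpM2l D1); lra.
have k4 : rho * (eta * e) <= rho * e by rewrite ler_wpM2l// ler_piMl// ltW.
by nra.
Qed.

End closed_graph.
Arguments closed_graph {R H Q} c b io x gam.

(** * Error of the perturbed BDF scheme *)

(** [nu n] stands for the dissipation norm of [x n] and [rho n] for the dual norm of the residual.
    The two inequalities assumed are the tested scheme at step [k] and at later steps. The constant
    precedes the space and the form, hence depends on [k] alone. *)
Lemma bdf_stability (R : realType) k : (1 <= k <= 5)%N ->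
  exists2 C : R, 0 < C & forall (X : lmodType R) (s : X -> X -> R)
    (x : nat -> X) (nu rho : nat -> R) (tau : R) N,
  psd_form s -> 0 < tau -> (k <= N)%N ->
  s (\sum_(l < k.+1) bdf_coef R k l *: x (k - l)%N) (x k) + tau * nu k ^+ 2
    <= tau * (rho k * nu k) ->
  (forall n, (k < n <= N)%N ->
     s (\sum_(l < k.+1) bdf_coef R k l *: x (n - l)%N)
       (x n - (19 / 20) *: x n.-1)
     + tau * (nu n ^+ 2 - 19 / 20 * nu n * nu n.-1)
     <= tau * (rho n * (nu n + 19 / 20 * nu n.-1))) ->
  s (x N) (x N) <= C * (\sum_(l < k) s (x l) (x l)
    + tau * \sum_(k <= n < N.+1) rho n ^+ 2).
Proof.
move=> hk; have xi0 := bdf_coef0_gt0 R hk.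
have [g [g0 hg]] := gform_ub R k.
have [Xi XiE] : {Xi | \sum_(l < k) `|bdf_coef R k l.+1| = Xi} by eexists.
have Xi0 : 0 <= Xi by rewrite -XiE; apply: sumr_ge0.
have [xi xiE] : {xi | bdf_coef R k 0 = xi} by exists (bdf_coef R k 0).
rewrite xiE in xi0.
(* From Young's inequality [2 * Xi * r * u <= xi * u ^+ 2 + Xi ^+ 2 / xi * r ^+ 2] in the first
   step, where [r ^+ 2] is the sum over the starting values. *)
pose C1 := (1 + Xi ^+ 2 / xi) / xi; pose C2 := 1 + Xi ^+ 2 / xi.
have C20 : 1 <= C2 by rewrite lerDl (divr_ge0 (sqr_ge0 _) (ltW xi0)).
have C10 : 0 <= C1 by exact: divr_ge0 (le_trans ler01 C20) (ltW xi0).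
exists (1000 * (g * (k%:R * (C1 + 1)) + 41 / 80 * C2 + 40)).
  have h1 : 0 <= g * (k%:R * (C1 + 1)) by rewrite mulr_ge0// mulr_ge0// addr_ge0.
  by lra.
move=> X s x nu rho tau N hs tau0 kN hk0 hn.
set S := \sum_(l < k) s (x l) (x l).
have S0 : 0 <= S by apply: sumr_ge0 => l _; exact: psd_ge0.
have le_S l : (l < k)%N -> s (x l) (x l) <= S.
  move=> lk; rewrite /S (bigD1 (Ordinal lk))//= lerDl.
  by apply: sumr_ge0 => i _; exact: psd_ge0.
(* The first step cannot use the multiplier: [nu k.-1] is not controlled. *)
have [first1 first2] : s (x k) (x k) <= C1 * (S + tau * rho k ^+ 2) /\
    tau * nu k ^+ 2 <= C2 * (S + tau * rho k ^+ 2).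
  pose r := Num.sqrt S; have r0 : 0 <= r by exact: sqrtr_ge0.
  have lb : xi * s (x k) (x k) - Xi * (r * fnorm s (x k)) <=
      s (\sum_(l < k.+1) bdf_coef R k l *: x (k - l)%N) (x k).
    rewrite (lin_sum (psd_linl hs _)) big_ord_recl subn0 (psdZl hs) xiE lerD//.
    rewrite -XiE mulr_suml -sumrN; apply: ler_sum => l _.
    rewrite (psdZl hs) lift0 lerNl -mulrN.
    rewrite (le_trans (ler_norm _))// normrM normrN ler_wpM2l//.
    rewrite (le_trans (psd_CS hs _ _))// ler_wpM2r ?fnorm_ge0//.
    rewrite /r /fnorm ler_wsqrtr// le_S// -subSn//.
    by rewrite subSS leq_subr.
  have rr : r ^+ 2 = S by rewrite sqr_sqrtr.
  have e := fnorm_sqr hs (x k); have u0 := fnorm_ge0 s (x k).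
  move: hk0 lb; rewrite -e; set u := fnorm s (x k) in u0 *.
  set Z := s _ _ => hk0 lb.
  have am : 2 * (Xi * (r * u)) <= xi * u ^+ 2 + Xi ^+ 2 / xi * S.
    have -> : xi * u ^+ 2 + Xi ^+ 2 / xi * S =
        2 * (Xi * (r * u)) + (xi * u - Xi * r) ^+ 2 / xi.
      by rewrite -rr; field; rewrite gt_eqF.
    by rewrite lerDl divr_ge0 ?sqr_ge0// ltW.
  have am2 := mulr_ge0 (ltW tau0) (sqr_ge0 (rho k - nu k)).
  have main : xi * u ^+ 2 + tau * nu k ^+ 2 <= tau * rho k ^+ 2 + Xi ^+ 2 / xi * S.
    by move: am2; rewrite sqrrB; move: hk0 lb am; clear; move=> *; lra.
  have C2b : tau * rho k ^+ 2 + Xi ^+ 2 / xi * S <= C2 * (S + tau * rho k ^+ 2).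
    have c0 : 0 <= Xi ^+ 2 / xi by rewrite divr_ge0 ?sqr_ge0// ltW.
    have t0 : 0 <= tau * rho k ^+ 2 by rewrite mulr_ge0 ?sqr_ge0// ltW.
    by have := mulr_ge0 c0 t0; rewrite /C2; move: S0; clear; move=> *; lra.
  have t0 : 0 <= tau * nu k ^+ 2 by rewrite mulr_ge0 ?sqr_ge0// ltW.
  have x0 : 0 <= xi * u ^+ 2 by rewrite mulr_ge0 ?sqr_ge0// ltW.
  split; last by move: main C2b x0; clear; move=> *; lra.
  rewrite /C1 mulrAC ler_pdivlMr// mulrC.
  by move: main C2b t0; rewrite /C2; clear; move=> *; lra.
pose G n := gform s k (fun i => x (n - i)%N).
(* Young's inequality turns [19 / 20 * nu n * nu n.-1] into 38/80 of each square, and the residual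
   costs another 1/80 of each. So 41/80 of the new square is left against 39/80 of the old one, and
   [Phi] grows only by the residuals. *)
pose Phi n := G n + tau * (41 / 80 * nu n ^+ 2).
have stepG n : (k < n <= N)%N -> Phi n <= Phi n.-1 + 40 * (tau * rho n ^+ 2).
  move=> hkn; have := hn n hkn; have := gform_step hs (fun i => x (n - i)%N) hk.
  rewrite (eq_bigr (fun l : 'I_k.+1 => bdf_coef R k l *: x (n - l)%N)); last first.
    by move=> l _; rewrite bdf_coefE// -ltnS.
  rewrite subn0 subn1.
  have -> : (fun i => x (n - i.+1)%N) = (fun i => x (n.-1 - i)%N).
    by apply/funext => i; rewrite -subn1 -subnDA add1n.
  rewrite -/(G n) -/(G n.-1) /Phi.
  set Z := s _ _; move=> h1 h2.
  have h3 : 41 / 80 * nu n ^+ 2 - 39 / 80 * nu n.-1 ^+ 2 - 40 * rho n ^+ 2 <=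
     nu n ^+ 2 - 19 / 20 * nu n * nu n.-1 - rho n * (nu n + 19 / 20 * nu n.-1).
    have := sqr_ge0 (nu n - nu n.-1); have := sqr_ge0 (nu n - 40 * rho n).
    have := sqr_ge0 (nu n.-1 - 40 * rho n); have := sqr_ge0 (rho n).
    have := sqr_ge0 (nu n.-1); rewrite !sqrrB !exprMn.
    by move: (nu n) (nu n.-1) (rho n); clear; move=> *; lra.
  have h4 := ler_wpM2l (ltW tau0) h3.
  have : 0 <= tau * nu n.-1 ^+ 2 by rewrite mulr_ge0 ?sqr_ge0// ltW.
  by move: h1 h2 h4; clear; move=> *; lra.
have PhiN n : (k <= n <= N)%N ->
    Phi n <= Phi k + 40 * (tau * \sum_(k.+1 <= j < n.+1) rho j ^+ 2).
  elim: n => [|n ih] /andP[kn nN].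
    by move: kn hk; rewrite leqn0 => /eqP ->.
  move: kn; rewrite leq_eqVlt => /predU1P[<-|kn].
    by rewrite big_geq// !mulr0 addr0.
  have := stepG n.+1; rewrite kn nN => /(_ isT) h.
  rewrite (le_trans h)// big_nat_recr//= !mulrDr addrA lerD2r.
  by apply: ih; rewrite -ltnS kn ltnW.
have nuN := sqr_ge0 (nu N).
have lbG := gform_lb hs (fun i => x (N - i)%N) hk.
rewrite subn0 -/(G N) in lbG.
have ubG : G k <= g * (k%:R * (C1 + 1) * (S + tau * rho k ^+ 2)).
  rewrite (le_trans (hg _ _ _ hs))// ler_wpM2l// -mulrA mulr_natl.
  rewrite -[k in _ *+ k]card_ord -sumr_const; apply: ler_sum => i _.
  have t0 : 0 <= tau * rho k ^+ 2 by rewrite mulr_ge0 ?sqr_ge0// ltW.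
  have St : 0 <= S + tau * rho k ^+ 2 by rewrite addr_ge0.
  have [->|i0] := eqVneq (i : nat) 0%N.
    by rewrite subn0 mulrDl mul1r (le_trans first1)// lerDl.
  have ik : (k - i < k)%N by rewrite ltn_subrL lt0n i0; case/andP: hk.
  rewrite (le_trans (le_S _ ik))// mulrDl mul1r.
  by have := mulr_ge0 C10 St; move: t0; clear; move=> *; lra.
have := PhiN N; rewrite kN leqnn => /(_ isT) hN.
have sumE : \sum_(k <= n < N.+1) rho n ^+ 2 =
   rho k ^+ 2 + \sum_(k.+1 <= j < N.+1) rho j ^+ 2 by rewrite big_ltn.
rewrite sumE; set Y := \sum_(k.+1 <= j < N.+1) _ in hN *.
have Y0 : 0 <= tau * Y.
  by rewrite mulr_ge0 ?(ltW tau0)//; apply: sumr_ge0 => j _; exact: sqr_ge0.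
have t0 : 0 <= tau * rho k ^+ 2 by rewrite mulr_ge0 ?sqr_ge0// ltW.
have tN : 0 <= tau * nu N ^+ 2 by rewrite mulr_ge0// ltW.
set K := g * (k%:R * (C1 + 1)) + 41 / 80 * C2.
have K0 : 0 <= K.
  rewrite addr_ge0//; first by rewrite !mulr_ge0// addr_ge0.
  by rewrite mulr_ge0// (le_trans ler01).
have hK : Phi k <= K * (S + tau * rho k ^+ 2).
  rewrite /Phi /K; move: ubG first2; clear; move=> *; lra.
have KY := mulr_ge0 K0 Y0.
by move: hN hK lbG tN KY S0 t0 Y0; rewrite /Phi; clear; move=> *; lra.
Qed.

(** * Curves of functionals induced by bounded forms, and preparations for the energy estimates *)

Section functional_calculus.
Context {R : realType} {X Y : lmodType R} {s : X -> X -> R} {r : Y -> Y -> R}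
  (hs : psd_form s) (hr : psd_form r).
Variables (B : X -> Y -> R) (C : R).
Hypotheses (lB : forall y, lin (B ^~ y)) (C0 : 0 <= C)
  (bB : forall x y, `|B x y| <= C * fnorm s x * fnorm r y).
Implicit Types (lo hi : R).

Lemma fcont_bil lo hi x : vcont s lo hi x -> fcont r lo hi (B \o x).
Proof.
move=> cx t ht e e0; have C1 : 0 < C + 1 by rewrite ltr_wpDl.
have [del del0 h] := cx t ht _ (divr_gt0 e0 C1).
exists del => // q hq qt v; rewrite /= -(linB (lB v)) (le_trans (bB _ _))//.
rewrite ler_wpM2r ?fnorm_ge0// (le_trans (ler_wpM2l C0 (h q hq qt)))//.
by rewrite mulrCA ger_pMr// ler_pdivrMr// mul1r lerDl.
Qed.

Lemma fderiv_bil lo hi x x' : vderiv s lo hi x x' ->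
  fderiv r lo hi (B \o x) (B \o x').
Proof.
move=> dx t ht e e0; have C1 : 0 < C + 1 by rewrite ltr_wpDl.
have [del del0 h] := dx t ht _ (divr_gt0 e0 C1).
exists del => // q hq qt v; rewrite /= -(linZ (lB v)) -!(linB (lB v)).
rewrite (le_trans (bB _ _))// ler_wpM2r ?fnorm_ge0//.
rewrite (le_trans (ler_wpM2l C0 (h q hq qt)))// mulrA ler_wpM2r//.
by rewrite mulrCA ger_pMr// ler_pdivrMr// mul1r lerDl.
Qed.

Lemma fcontB lo hi f f' : fcont r lo hi f -> fcont r lo hi f' ->
  fcont r lo hi (fun t v => f t v - f' t v).
Proof.
move=> cf cf' t ht e e0; have e2 : 0 < e / 2 by rewrite divr_gt0.
have [d1 d10 h1] := cf t ht _ e2; have [d2 d20 h2] := cf' t ht _ e2.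
exists (Num.min d1 d2) => [|q hq]; first by rewrite lt_min d10.
rewrite lt_min => /andP[q1 q2] v; have := h1 q hq q1 v; have := h2 q hq q2 v.
by rewrite !ler_norml; lra.
Qed.

Lemma fderivB lo hi f f' g g' : fderiv r lo hi f f' ->
  fderiv r lo hi g g' ->
  fderiv r lo hi (fun t v => f t v - g t v) (fun t v => f' t v - g' t v).
Proof.
move=> cf cf' t ht e e0; have e2 : 0 < e / 2 by rewrite divr_gt0.
have [d1 d10 h1] := cf t ht _ e2; have [d2 d20 h2] := cf' t ht _ e2.
exists (Num.min d1 d2) => [|q hq]; first by rewrite lt_min d10.
rewrite lt_min => /andP[q1 q2] v; have := h1 q hq q1 v; have := h2 q hq q2 v.
by rewrite !ler_norml; lra.
Qed.

End functional_calculus.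

(** The step goes to the right in the left half of the interval and to the left in the other half,
    which covers the end points. *)
Lemma near_point (R : realType) (T t del : R) : 0 < T -> 0 <= t <= T -> 0 < del ->
  exists2 s, 0 <= s <= T & s != t /\ `|s - t| < del.
Proof.
move=> T0 /andP[t0 tT] del0.
pose h := Num.min (T / 2) (del / 2).
have h0 : 0 < h by rewrite lt_min !divr_gt0.
have hT : h <= T / 2 by rewrite ge_min lexx.
have hd : h < del by rewrite gt_min [X in _ || X]ltr_pdivrMr// ltr_pMr ?ltr1n ?orbT.
have [tT2|tT2] := lerP t (T / 2).
  exists (t + h); first by lra.
  by rewrite -subr_eq0 addrC addKr gt_eqF// gtr0_norm.
exists (t - h); first by lra.
by rewrite -subr_eq0 addrC addKr oppr_eq0 gt_eqF// normrN gtr0_norm.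
Qed.

Lemma dense_zero (R : realType) (T : R) m : cont_on 0 T m ->
  (forall t, 0 <= t <= T -> forall del, 0 < del ->
     exists2 s, 0 <= s <= T & `|s - t| < del /\ m s = 0) ->
  forall t, 0 <= t <= T -> m t = 0.
Proof.
move=> cm dm t ht; apply/eqP; rewrite -normr_eq0 -(normr_le0 (`|m t|)) normr_id.
apply: (@le_of_eps _ _ _ 1) => e e0 _; rewrite add0r mulr1.
have [del del0 h] := cm t ht e e0; have [s hs [st ms]] := dm t ht del del0.
by have := h s hs st; rewrite ms sub0r normrN.
Qed.

Lemma deriv_zero (R : realType) (T : R) m m' : 0 < T -> deriv_on 0 T m m' ->
  (forall t, 0 <= t <= T -> m t = 0) -> forall t, 0 <= t <= T -> m' t = 0.
Proof.
move=> T0 dm m0 t ht; apply/eqP; rewrite -normr_eq0 -(normr_le0 (`|m' t|)) normr_id.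
apply: (@le_of_eps _ _ _ 1) => e e0 _; rewrite add0r mulr1.
have [del del0 h] := dm t ht e e0; have [s hs [snt st]] := near_point T0 ht del0.
have := h s hs st; rewrite !m0// subrr sub0r normrN normrM mulrC ler_pM2r//.
by rewrite normr_gt0 subr_eq0.
Qed.

Lemma subrACAB (G : zmodType) (x y z w : G) : (x - y) - (z - w) = (x - z) - (y - w).
Proof. by rewrite opprD addrACA -opprD. Qed.

(** Both sides are double sums, compared pair by pair through
    [2 * x i * x j <= x i ^+ 2 + x j ^+ 2]. *)
Lemma sqr_sum_le (R : realType) n (x : 'I_n -> R) :
  (\sum_i x i) ^+ 2 <= n%:R * \sum_i x i ^+ 2.
Proof.
set S := \sum_i x i ^+ 2.
have e i : \sum_j (x i ^+ 2 + x j ^+ 2) / 2 = (n%:R * x i ^+ 2 + S) / 2.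
  by rewrite -mulr_suml big_split/= sumr_const card_ord mulr_natl.
have -> : n%:R * S = \sum_i \sum_j (x i ^+ 2 + x j ^+ 2) / 2.
  rewrite (eq_bigr _ (fun i _ => e i)) -mulr_suml big_split/= -mulr_sumr.
  by rewrite sumr_const card_ord -[S *+ n]mulr_natl -/S; field.
rewrite expr2 mulr_suml; apply: ler_sum => i _.
rewrite mulr_sumr; apply: ler_sum => j _.
by rewrite ler_pdivlMr//; have := sqr_ge0 (x i - x j); nra.
Qed.

Section increments.
Context {R : realType} {X : lmodType R} {s : X -> X -> R} (hs : psd_form s).

Lemma vderiv_incr (T h : R) x x' : 0 <= h -> vderiv s 0 T x x' ->
  vderiv s 0 (T - h) (fun t => x (t + h) - x t) (fun t => x' (t + h) - x' t).
Proof.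
move=> h0 dx t /andP[t0 tT] e e0; have e2 : 0 < e / 2 by rewrite divr_gt0.
have [|d1 d10 h1] := dx t _ _ e2; first by lra.
have [|d2 d20 h2] := dx (t + h) _ _ e2; first by lra.
exists (Num.min d1 d2) => [|r /andP[r0 rT]]; first by rewrite lt_min d10.
rewrite lt_min => /andP[r1 r2].
have rh : r + h - (t + h) = r - t by ring.
have hr : 0 <= r <= T by lra.
have hrh : 0 <= r + h <= T by lra.
have {}h1 := h1 r hr r1.
have := h2 (r + h) hrh; rewrite rh => /(_ r2) {}h2.
have -> : x (r + h) - x r - (x (t + h) - x t) - (r - t) *: (x' (t + h) - x' t)
  = (x (r + h) - x (t + h) - (r - t) *: x' (t + h)) - (x r - x t - (r - t) *: x' t).
  by rewrite scalerBr (subrACAB (x (r + h))) [LHS]subrACAB.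
rewrite (le_trans (fnormB hs _ _))//; lra.
Qed.

Lemma fderiv_incr (T h : R) (f f' : R -> X -> R) : 0 <= h -> fderiv s 0 T f f' ->
  fderiv s 0 (T - h) (fun t v => f (t + h) v - f t v)
    (fun t v => f' (t + h) v - f' t v).
Proof.
move=> h0 dx t /andP[t0 tT] e e0; have e2 : 0 < e / 2 by rewrite divr_gt0.
have [|d1 d10 h1] := dx t _ _ e2; first by lra.
have [|d2 d20 h2] := dx (t + h) _ _ e2; first by lra.
exists (Num.min d1 d2) => [|r /andP[r0 rT]]; first by rewrite lt_min d10.
rewrite lt_min => /andP[r1 r2] v.
have rh : r + h - (t + h) = r - t by ring.
have hr : 0 <= r <= T by lra.
have hrh : 0 <= r + h <= T by lra.
have {}h1 := h1 r hr r1 v.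
have := h2 (r + h) hrh; rewrite rh => /(_ r2 v) {}h2.
have -> : e * `|r - t| * fnorm s v =
    e / 2 * `|r - t| * fnorm s v + e / 2 * `|r - t| * fnorm s v by field.
move: h1 h2; rewrite !ler_norml; lra.
Qed.

End increments.

Definition prod_form (R : realType) (X Y : lmodType R) (s : X -> X -> R)
    (r : Y -> Y -> R) (x y : X * Y) : R := s x.1 y.1 + r x.2 y.2.

Lemma prod_form_psd (R : realType) (X Y : lmodType R) (s : X -> X -> R)
    (r : Y -> Y -> R) : psd_form s -> psd_form r -> psd_form (prod_form s r).
Proof.
move=> hs hr; split=> [t x x' y|x y|x]; rewrite /prod_form /=.
- by rewrite (psd_linear hs) (psd_linear hr); ring.
- by rewrite (psdC hs) (psdC hr).
- by rewrite addr_ge0// psd_ge0.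
Qed.

(** Each window is cut into [k] unit increments. For a fixed offset [i] they telescope over [n], and
    monotonicity bounds the outcome by the total increment, so that the overlap costs only the
    factor [k]. *)
Lemma window_sum (R : realType) (B : nat -> R) k N : (k <= N)%N ->
  (forall m n, (m <= n)%N -> (n <= N)%N -> B m <= B n) ->
  \sum_(k <= n < N.+1) (B n - B (n - k)%N) <= k%:R * (B N - B 0%N).
Proof.
move=> kN Bm.
have tel n : (k <= n)%N -> B n - B (n - k)%N = \sum_(i < k) (B (n - i)%N - B (n - i.+1)%N).
  move=> _; rewrite -(big_mkord xpredT (fun i => B (n - i)%N - B (n - i.+1)%N)).
  have := telescope_sumr (fun i => - B (n - i)%N) (leq0n k).
  rewrite subn0 opprK addrC => <-; apply: eq_bigr => i _.
  by rewrite opprK addrC.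
rewrite big_nat (eq_bigr (fun n => \sum_(i < k) (B (n - i)%N - B (n - i.+1)%N))); last first.
  by move=> n /andP[kn _]; exact: tel.
rewrite -big_nat exchange_big /= -[k in k%:R]card_ord mulr_natl -sumr_const.
apply: ler_sum => i _.
have ik := ltn_ord i.
have -> : \sum_(k <= n < N.+1) (B (n - i)%N - B (n - i.+1)%N)
   = \sum_(k <= n < N.+1) (B (n.+1 - i.+1)%N - B (n - i.+1)%N).
  by apply: eq_bigr => n _; rewrite subSS.
rewrite (telescope_sumr (fun n => B (n - i.+1)%N)) ?subSS; last exact: leqW.
by rewrite lerB// Bm// ?leq_subr// (leq_trans (leq_subr _ _)).
Qed.

(** * Time regularity of the exact solution *)

Section regularity.
Context {R : realType} {V H Q : lmodType R}
  {a : V -> V -> R} {c : H -> H -> R} {b : Q -> Q -> R} {d : V -> H -> R}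
  {io : Q -> H} (ha : psd_form a) (hc : psd_form c) (hb : psd_form b)
  (lio : forall r x y, io (r *: x + y) = r *: io x + io y)
  (K : R) (K0 : 0 <= K) (bio : forall q, fnorm c (io q) <= K * fnorm b q)
  (ld1 : forall y, lin (d ^~ y)) (ld2 : forall x, lin (d x))
  (Cd : R) (Cd0 : 0 <= Cd)
  (bd : forall x y, `|d x y| <= Cd * fnorm a x * fnorm c y).
Local Notation Na := (fnorm a).
Local Notation Nc := (fnorm c).
Local Notation Nb := (fnorm b).
Context (T : R) (T0 : 0 < T) (k : nat) (k0 : (0 < k)%N) (us : nat -> R -> V) (ps : nat -> R -> H)
  (fs : nat -> R -> V -> R) (gs : nat -> R -> Q -> R)
  (dus : forall j, (j < k)%N -> vderiv a 0 T (us j) (us j.+1))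
  (cus : vcont a 0 T (us k))
  (dps : forall j, (j < k)%N -> vderiv c 0 T (ps j) (ps j.+1))
  (cps : vcont c 0 T (ps k))
  (dfs : forall j, (j <= k)%N -> fderiv a 0 T (fs j) (fs j.+1))
  (cfs : fcont a 0 T (fs k.+1))
  (lfs : forall j (t : R), (j <= k.+1)%N -> 0 <= t <= T ->
     lin (fs j t) /\ exists C, fbounded a (fs j t) C)
  (dgs : forall j, (j <= k)%N -> fderiv b 0 T (gs j) (gs j.+1))
  (cgs : fcont b 0 T (gs k.+1))
  (lgs : forall j (t : R), (j <= k.+1)%N -> 0 <= t <= T ->
     lin (gs j t) /\ exists C, fbounded b (gs j t) C)
  (sol : forall t : R, 0 <= t <= T -> forall del : R, 0 < del ->
     exists2 s, 0 <= s <= T & [/\ `|s - t| < del,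
       forall v, a (us 0 s) v - d v (ps 0 s) = fs 0 s v &
       exists2 y, io y = ps 0 s & forall q,
         d (us 1 s) (io q) + c (ps 1 s) (io q) + b y q = gs 0 s q]).

(** Continuity extends the equation from a dense set of times to all times; a function that vanishes
    on the whole interval has derivative zero, which climbs up in [j]. *)
Lemma elliptic_derivs j t v : (j <= k)%N -> 0 <= t <= T ->
  a (us j t) v - d v (ps j t) = fs j t v.
Proof.
move=> jk ht; apply/eqP; rewrite -subr_eq0; apply/eqP; move: t ht.
pose m j t := a (us j t) v - d v (ps j t) - fs j t v.
have dm i : (i < k)%N -> deriv_on 0 T (m i) (m i.+1).
  move=> ik; apply: deriv_onB; last exact: fderiv_eval (dfs (ltnW ik)).
  apply: deriv_onB.
    apply: (vderiv_lin (F := a ^~ v) (C := Na v) (dus ik)); first exact: psd_linl.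
    by move=> x; rewrite (psdC ha) (psd_CS ha).
  by apply: (vderiv_lin (F := d v) (C := Cd * Na v) (dps ik)).
rewrite -/(m j); elim: j jk => [_|j ih jk t ht]; last first.
  exact: deriv_zero T0 (dm j jk) (ih (ltnW jk)) t ht.
apply: (dense_zero (deriv_cont (dm 0 k0))) => t ht del del0; have [s hs [st h _]] := sol ht del0.
by exists s => //; split => //; rewrite /m h subrr.
Qed.

(** The equation of order [j] solved for its elliptic term. It is the image of [ps j t] under the
    closed operator, where [b (ps j t) _] itself need not make sense. *)
Definition parabolic_op j t (q : Q) : R :=
  gs j t q - d (us j.+1 t) (io q) - c (ps j.+1 t) (io q).
Local Notation beta := parabolic_op.
Local Notation graph := (closed_graph c b io).

Let bdio x q : `|d x (io q)| <= Cd * K * Na x * Nb q.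
Proof.
rewrite (le_trans (bd _ _))//.
have -> : Cd * K * Na x * Nb q = Cd * Na x * (K * Nb q) by ring.
by rewrite ler_wpM2l// mulr_ge0// fnorm_ge0.
Qed.

Let bcio x q : `|c x (io q)| <= K * Nc x * Nb q.
Proof.
rewrite (le_trans (psd_CS hc _ _))//.
have -> : K * Nc x * Nb q = Nc x * (K * Nb q) by ring.
by rewrite ler_wpM2l// fnorm_ge0.
Qed.

Let ldio x : lin (fun q => d x (io q)).
Proof. by move=> r y z; rewrite lio ld2. Qed.

Let lcio x : lin (fun q => c x (io q)).
Proof. by move=> r y z; rewrite lio (psd_linr hc). Qed.

Lemma parabolic_op_lin j t : (j < k)%N -> 0 <= t <= T -> lin (beta j t).
Proof.
move=> jk ht r x y; have [lg _] := lgs (leqW (ltnW jk)) ht.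
by rewrite /parabolic_op lg ldio lcio; ring.
Qed.

Let CdK0 : 0 <= Cd * K. Proof. exact: mulr_ge0. Qed.
Let ld1io q : lin (fun x => d x (io q)). Proof. exact: ld1. Qed.
Let lc1io q : lin (fun x => c x (io q)). Proof. exact: (psd_linl hc). Qed.

Lemma vcont_derivs j : (j <= k)%N -> vcont a 0 T (us j) /\ vcont c 0 T (ps j).
Proof.
rewrite leq_eqVlt => /predU1P[->|jk]; first by [].
by split; [exact: vderiv_cont (dus jk) | exact: vderiv_cont (dps jk)].
Qed.

Lemma fcont_derivs j : (j <= k)%N -> fcont a 0 T (fs j) /\ fcont b 0 T (gs j).
Proof.
move=> jk; split.
  by apply: (fderiv_cont (dfs jk)) => t ht; have [] := lfs (jk : (j.+1 <= k.+1)%N) ht.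
by apply: (fderiv_cont (dgs jk)) => t ht; have [] := lgs (jk : (j.+1 <= k.+1)%N) ht.
Qed.

Lemma parabolic_op_cont j : (j < k)%N -> fcont b 0 T (beta j).
Proof.
move=> jk; have [cu cp] := vcont_derivs jk; have [_ cg] := fcont_derivs (ltnW jk).
apply: fcontB; last exact: (fcont_bil lc1io K0 bcio cp).
by apply: fcontB => //; exact: (fcont_bil ld1io CdK0 bdio cu).
Qed.

Lemma parabolic_op_deriv j : (j.+1 < k)%N ->
  fderiv b 0 T (beta j) (beta j.+1).
Proof.
move=> jk; apply: fderivB; last exact: (fderiv_bil lc1io K0 bcio (dps jk)).
apply: fderivB; first exact: dgs (ltnW (ltnW jk)).
exact: (fderiv_bil ld1io CdK0 bdio (dus jk)).
Qed.

(** For [j = 0], closedness of the graph carries the relation from a dense set of times to all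
    times. For [j.+1], the difference quotients of [ps j] lie in the graph by linearity and
    converge, together with their images, to the derivatives. *)
Lemma parabolic_graph j t : (j < k)%N -> 0 <= t <= T -> graph (ps j t) (beta j t).
Proof.
elim: j t => [|j ih] t jk ht; apply: (closed_graph_closed hc) => e e0.
  have [d1 d10 h1] := parabolic_op_cont jk ht e0.
  have [d2 d20 h2] := (vcont_derivs (leq0n k)).2 t ht e e0.
  have [|s hs [st _ [y ys sy]]] := sol ht (del := Num.min d1 d2).
    by rewrite lt_min d10.
  move: st; rewrite lt_min => /andP[s1 s2].
  exists (ps 0 s), (beta 0 s); split; [|exact: h2|exact: h1].
  have -> : beta 0 s = b y by apply/funext => q; rewrite /parabolic_op -sy; ring.
  by rewrite -ys; exact: closed_graph_elem.
have [d1 d10 h1] := parabolic_op_deriv jk ht e0.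
have [d2 d20 h2] := dps (ltnW jk) ht e0.
have del0 : 0 < Num.min d1 d2 by rewrite lt_min d10.
have [s hs [sn]] := near_point T0 ht del0.
have snt : s - t != 0 by rewrite subr_eq0.
have st0 : 0 < `|s - t| by rewrite normr_gt0.
rewrite lt_min => /andP[s1 s2].
exists ((s - t)^-1 *: (ps j s - ps j t)), (fun q => (s - t)^-1 * (beta j s q - beta j t q)).
split.
- apply: (closed_graphZ hc hb lio); apply: (closed_graphB hc hb lio); exact: ih (ltnW jk) _.
- have := h2 s hs s2; rewrite -(ler_pM2l (x := `|s - t|^-1)) ?invr_gt0// [X in _ <= X]mulrCA mulVf ?gt_eqF// mulr1.
  by rewrite -normfV -(fnormZ hc) scalerBr scalerA mulVf// scale1r.
move=> q; have := h1 s hs s1 q; rewrite -(ler_pM2l (x := `|s - t|^-1)) ?invr_gt0//.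
rewrite -normfV -normrM mulrBr mulrA mulVf// mul1r normfV mulrA mulrCA mulVf ?gt_eqF// mulr1.
by [].
Qed.

Let kP : k.-1.+1 = k. Proof. exact: prednK. Qed.
Local Notation u0 := (us k.-1).
Local Notation p0 := (ps k.-1).
Local Notation f0 := (fs k.-1).

(** The pairing of the increments of [f0] and [u0] is subtracted because the derivative of the
    quadratic part contains the increment of [f0] paired with that of [us k], and the latter has no
    rate in [h]: [us k] is only continuous. The subtraction moves this derivative onto [f0], after
    which both factors are of order [h]. *)
Let incr_energy h r := 2^-1 * (a (u0 (r + h) - u0 r) (u0 (r + h) - u0 r)
  + c (p0 (r + h) - p0 r) (p0 (r + h) - p0 r))
  - (f0 (r + h) (u0 (r + h) - u0 r) - f0 r (u0 (r + h) - u0 r)).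

(** By the elliptic equation, the derivative of [incr_energy] is the functional [Lam] at the
    increment of [p0], up to a term of order [h ^+ 2]. Composed with [io] and added to the increment
    of [beta k.-1], [Lam] gives the increment of [gs k.-1], which is of order [h]. *)
Let incr_energy_deriv : exists2 C, 0 < C & forall h, 0 < h -> h <= T ->
  exists2 F', deriv_on 0 (T - h) (incr_energy h) F' &
  forall r, 0 <= r <= T - h ->
  F' r + 2^-1 * dualnorm b (fun q => beta k.-1 (r + h) q - beta k.-1 r q) ^+ 2
    <= C * h ^+ 2.
Proof.
have k1 : (k.-1 < k)%N by rewrite kP.
have [Cf Cf0 hCf] := fcont_bounded cfs (fun t ht => (lfs (leqnn _) ht).2).
have [Cg Cg0 hCg] := fcont_bounded (fcont_derivs (leqnn k)).2
  (fun t ht => (lgs (leqnSn _) ht).2).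
have [Cu Cu0 hCu] := vcont_bounded ha cus.
exists (2^-1 * Cg ^+ 2 + Cf * Cu) => [|h h0 hT]; first by have := mulr_gt0 Cf0 Cu0; have := sqr_ge0 Cg; lra.
have h0' := ltW h0.
have du := dus k1; have dp := dps k1; have df := dfs (ltnW k1).
rewrite !kP in du dp df.
have idu := vderiv_incr ha h0' du.
have idp := vderiv_incr hc h0' dp.
have idf := fderiv_incr h0' df.
pose w t := us k (t + h) - us k t; pose z t := ps k (t + h) - ps k t.
pose F' r := 2^-1 * (a (w r) (u0 (r + h) - u0 r) + a (u0 (r + h) - u0 r) (w r)
   + (c (z r) (p0 (r + h) - p0 r) + c (p0 (r + h) - p0 r) (z r)))
  - ((fs k (r + h) (u0 (r + h) - u0 r) - fs k r (u0 (r + h) - u0 r))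
    + (f0 (r + h) (w r) - f0 r (w r))).
have bnd (X : lmodType R) (s : X -> X -> R) (hs : psd_form s) x y :
    `|s x y| <= 1 * fnorm s x * fnorm s y by rewrite mul1r psd_CS.
have sb (X : lmodType R) (s : X -> X -> R) (hs : psd_form s) x :
    lin (s x) /\ exists C, fbounded s (s x) C.
  split; first exact: psd_linr.
  by exists (fnorm s x) => y; exact: psd_CS.
have inT t : 0 <= t <= T - h -> 0 <= t <= T /\ 0 <= t + h <= T.
  by move=> ht; split; lra.
have fb j t : (j <= k.+1)%N -> 0 <= t <= T - h ->
    lin (fun v => fs j (t + h) v - fs j t v) /\
    exists C, fbounded a (fun v => fs j (t + h) v - fs j t v) C.
  move=> jk /inT[t1 t2]; have [l1 [C1 b1]] := lfs jk t1; have [l2 [C2 b2]] := lfs jk t2.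
  split; first by move=> q x y; rewrite l1 l2; ring.
  exists (C1 + C2) => v; rewrite (le_trans (ler_normB _ _))//.
  by rewrite mulrDl [leRHS]addrC lerD.
exists F'.
  apply: deriv_onB.
    apply: deriv_onZ; apply: deriv_onD.
      apply: (pairing_deriv ha (fderiv_bil (psd_linl ha) ler01 (bnd _ _ ha) idu) idu) => t _; exact: sb.
    apply: (pairing_deriv hc (fderiv_bil (psd_linl hc) ler01 (bnd _ _ hc) idp) idp) => t _; exact: sb.
  apply: (pairing_deriv ha idf idu) => t ht; apply: fb => //.
  exact: leqW (leq_pred k).
move=> r hr; have [hr1 hr2] := inT r hr.
have dg := dgs (ltnW k1); rewrite kP in dg.
have [r0 _] := andP hr1; have [_ rT] := andP hr2.
have rh : r <= r + h by rewrite lerDl.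
have lb t : 0 <= t <= T -> lin (beta k.-1 t) by exact: parabolic_op_lin.
have gr : graph (p0 (r + h) - p0 r) (fun q => beta k.-1 (r + h) q - beta k.-1 r q).
  by apply: (closed_graphB hc hb lio); exact: parabolic_graph.
have lr : lin (fun q => beta k.-1 (r + h) q - beta k.-1 r q).
  by move=> t x y; rewrite !lb//; ring.
pose Lam y := d (w r) y + c (z r) y.
have lL : lin Lam by move=> t x y; rewrite /Lam ld2 (psd_linr hc); ring.
have bL : fbounded c Lam (Cd * Na (w r) + Nc (z r)).
  by move=> y; rewrite (le_trans (ler_normD _ _))// mulrDl lerD// psd_CS.
(* With [eta = 0] the test function is the increment of [p0]. *)
have := closed_graph_test hb lio gr gr lr lr lL bL (lexx 0) ler01
  (_ : 0 <= Cg * h) _.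
rewrite scale0r subr0 !mul0r subr0 addr0.
set D := dualnorm b _; move=> test.
have {}test : Lam (p0 (r + h) - p0 r) + D ^+ 2 <= Cg * h * D.
  apply: test; first by rewrite mulr_ge0// ltW.
  move=> q; have := le_trans (ler_norm _) (fderiv_lip dg hCg r0 rh rT q).
  rewrite [r + h - r]addrAC subrr add0r; apply: le_trans.
  by rewrite /Lam /w /z /parabolic_op kP (linB (ld1 _)) (psdDl hc) (psdNl hc); lra.
have ell t v : 0 <= t <= T -> a (u0 t) v = d v (p0 t) + f0 t v.
  by move=> ht; rewrite -(elliptic_derivs v (leq_pred k) ht); ring.
have e1 : a (u0 (r + h) - u0 r) (w r) =
    d (w r) (p0 (r + h) - p0 r) + (f0 (r + h) (w r) - f0 r (w r)).
  by rewrite (psdDl ha) (psdNl ha) !ell// (linB (ld2 _)); ring.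
have hdf : - (fs k (r + h) (u0 (r + h) - u0 r) - fs k r (u0 (r + h) - u0 r))
    <= Cf * Cu * h ^+ 2.
  have hf := fderiv_lip (dfs (leqnn k)) hCf r0 rh rT (u0 (r + h) - u0 r).
  have hu := vderiv_lip ha du hCu r0 rh rT.
  rewrite [r + h - r]addrAC subrr add0r in hf hu.
  rewrite (le_trans (ler_norm _))// normrN (le_trans hf)//.
  have -> : Cf * Cu * h ^+ 2 = Cf * h * (Cu * h) by ring.
  by rewrite ler_wpM2l// mulr_ge0// ltW.
rewrite /F' (psdC ha (w r)) (psdC hc _ (z r)) e1.
move: test hdf; rewrite /Lam.
(* Young's inequality for [Cg * h * D] spends half of [D ^+ 2] and produces [2^-1 * Cg ^+ 2] in the
   constant. *)
have := sqr_ge0 (D - Cg * h); rewrite sqrrB exprMn.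
by lra.
Qed.

Let inc t r := dualnorm b (fun q => beta k.-1 t q - beta k.-1 r q).

Let incP t r : 0 <= t <= T -> 0 <= r <= T ->
  fbounded b (fun q => beta k.-1 t q - beta k.-1 r q) (inc t r).
Proof.
move=> ht hr; have k1 : (k.-1 < k)%N by rewrite kP.
have lr : lin (fun q => beta k.-1 t q - beta k.-1 r q).
  by move=> z x y; rewrite !parabolic_op_lin//; ring.
have [C bC] := closed_graph_bounded hb
  (closed_graphB hc hb lio (parabolic_graph k1 ht) (parabolic_graph k1 hr)).
exact: (dualnormP hb lr bC).
Qed.

(* The mean value theorem, applied to the sum over the grid of mesh [h] of the
   shifted functions [incr_energy h], replaces the time integral of the energy
   estimate; the sum telescopes. *)
Let fine_grid C s t n (h := (t - s) / n.+1%:R) : 0 < C ->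
  (forall h, 0 < h -> h <= T ->
    exists2 F', deriv_on 0 (T - h) (incr_energy h) F' &
    forall r, 0 <= r <= T - h ->
    F' r + 2^-1 * dualnorm b (fun q => beta k.-1 (r + h) q - beta k.-1 r q) ^+ 2
      <= C * h ^+ 2) -> 0 <= s -> s < t -> t <= T ->
  exists2 th, 0 < th < h & inc (th + (s + n%:R * h)) (th + s) ^+ 2 <=
    (t - s) * (2 * C * (t - s)
      + 2 * (incr_energy h s - incr_energy h (t - h)) / h ^+ 2).
Proof.
move=> C0 hC s0 st tT.
have n0 : 0 < n.+1%:R :> R by rewrite ltr0n.
have h0 : 0 < h by rewrite divr_gt0// subr_gt0.
(* The grid is one mesh shorter than [[s, t]], which leaves room for the offset [th]. *)
have nh : n%:R * h = t - s - h.
  by rewrite /h -[n.+1]addn1 natrD; field; rewrite natr1 gt_eqF.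
have n0' : 0 <= n%:R * h by rewrite mulr_ge0// ltW.
have hT : h <= T by lra.
have jh j : (j < n.+1)%N -> 0 <= j%:R * h <= n%:R * h.
  by move=> jn; rewrite mulr_ge0 ?(ltW h0)//= ler_wpM2r ?(ltW h0)// ler_nat.
have jh1 j : (j < n)%N -> j%:R * h + h <= n%:R * h.
  by move=> jn; have /andP[_] := jh j.+1 jn; rewrite -natr1 mulrDl mul1r.
have [F' dF hF] := hC h h0 hT.
have dH := deriv_sum (lo := 0) (hi := h) (n := n)
  (m := fun j th => incr_energy h (th + (s + j%:R * h)))
  (m' := fun j th => F' (th + (s + j%:R * h))).
have {}dH := dH _.
have [|th /andP[th0 thh] e] := deriv_mvt h0 (dH _).
  move=> j jn; apply: deriv_shift; apply: deriv_sub dF.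
    by have := jh j (leqW jn); lra.
  by have := jh1 j jn; lra.
exists th; first by rewrite th0.
set S := \sum_(j < n) F' _ in e.
have tel : S * h = incr_energy h (t - h) - incr_energy h s.
  rewrite -[h in S * h]subr0 -e -sumrB.
  pose G j := incr_energy h (s + j%:R * h).
  rewrite (eq_bigr (fun j : 'I_n => G j.+1 - G j)) => [|j _].
    rewrite -(big_mkord xpredT (fun j => G j.+1 - G j)) telescope_sumr// /G.
    by rewrite mul0r addr0 nh; congr (incr_energy _ _ - _); ring.
  by rewrite /G add0r -natr1; congr (incr_energy _ _ - _); ring.
pose N (j : nat) := inc (th + (s + j.+1%:R * h)) (th + (s + j%:R * h)).
have inT j : (j < n.+1)%N -> 0 <= th + (s + j%:R * h) <= T.
  by move=> jn; have := jh j jn; lra.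
(* Triangle inequality along the grid. Squaring it by Cauchy-Schwarz costs the factor [n], at most
   [(t - s) / h], whose denominator cancels the mesh in the summed energy estimate. *)
have le1 : inc (th + (s + n%:R * h)) (th + s) <= \sum_(j < n) N j.
  apply: (dualnorm_le hb) => [|q].
    by apply: sumr_ge0 => j _; exact: (dualnorm_ge0 hb).
  pose G j := beta k.-1 (th + (s + j%:R * h)) q.
  have -> : beta k.-1 (th + (s + n%:R * h)) q - beta k.-1 (th + s) q
      = \sum_(j < n) (G j.+1 - G j).
    rewrite -(big_mkord xpredT (fun j => G j.+1 - G j)) telescope_sumr// /G.
    by rewrite mul0r addr0.
  rewrite mulr_suml (le_trans (ler_norm_sum _ _ _))// ler_sum// => j _.
  by apply: incP; apply: inT => //; rewrite ltnS// ltnW.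
have le2 : \sum_(j < n) N j ^+ 2 <= 2 * (n%:R * (C * h ^+ 2) - S).
  have -> : 2 * (n%:R * (C * h ^+ 2) - S) = \sum_(j < n)
      2 * (C * h ^+ 2 - F' (th + (s + j%:R * h))).
    by rewrite -mulr_sumr big_split/= sumrN sumr_const card_ord -(mulr_natl (C * h ^+ 2) n) /S.
  apply: ler_sum => j _; have := hF (th + (s + j%:R * h)).
  have hj : 0 <= th + (s + j%:R * h) <= T - h.
    by have := inT j (leqW (ltn_ord j)); have := jh1 j (ltn_ord j); lra.
  have -> : th + (s + j%:R * h) + h = th + (s + j.+1%:R * h).
    by rewrite -natr1; ring.
  by move=> /(_ hj); rewrite -/(inc _ _) -/(N j); lra.
have le3 := sqr_sum_le (fun j : 'I_n => N j).
have N0 : 0 <= \sum_(j < n) N j ^+ 2 by apply: sumr_ge0 => j _; exact: sqr_ge0.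
have i0 : 0 <= inc (th + (s + n%:R * h)) (th + s) by exact: (dualnorm_ge0 hb).
rewrite (le_trans (y := (\sum_(j < n) N j) ^+ 2))//.
  by rewrite lerXn2r// nnegrE (le_trans i0).
rewrite (le_trans le3)//.
set X := \sum_(j < n) N j ^+ 2 in le2 N0 *.
have -> : (t - s) * (2 * C * (t - s) + 2 * (incr_energy h s - incr_energy h (t - h)) / h ^+ 2)
   = ((t - s) / h) * (2 * C * (t - s) * h - 2 * S).
  have -> : S = (incr_energy h (t - h) - incr_energy h s) / h.
    by rewrite -tel mulfK// gt_eqF.
  by field; rewrite gt_eqF.
have nt : n%:R <= (t - s) / h by rewrite ler_pdivlMr//; lra.
have le4 : X <= 2 * C * (t - s) * h - 2 * S.
  rewrite (le_trans le2)// mulrBr lerD2r.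
  have -> : 2 * (n%:R * (C * h ^+ 2)) = (2 * C * h) * (n%:R * h) by ring.
  have -> : 2 * C * (t - s) * h = (2 * C * h) * (t - s) by ring.
  by rewrite ler_wpM2l; lra || (rewrite mulr_ge0 ?(ltW h0)//; lra).
by rewrite ler_pM// ler0n.
Qed.

(** The limit of [2 * incr_energy h t / h ^+ 2] as the mesh [h] tends to 0. *)
Let W t := a (us k t) (us k t) + c (ps k t) (ps k t) - 2 * fs k t (us k t).

Let fnorm_close (X : lmodType R) (s : X -> X -> R) (hs : psd_form s) x y e :
  e <= 1 -> fnorm s (x - y) <= e ->
  `|s x x - s y y| <= e * (2 * fnorm s y + 1) /\ fnorm s x <= fnorm s y + 1.
Proof.
move=> e1 xy; have := fnormD hs (x - y) y; have := fnormD hs (y - x) x.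
rewrite !subrK (fnormBC hs y) -!(fnorm_sqr hs).
have := fnorm_ge0 s x; have := fnorm_ge0 s y; have := fnorm_ge0 s (x - y).
move: (fnorm s x) (fnorm s y) (fnorm s (x - y)) xy => u v w wE w0 v0 u0 h1 h2.
split; last by lra.
rewrite subr_sqr normrM ler_pM//; first by rewrite ler_norml; lra.
by rewrite ger0_norm; lra.
Qed.

Let energy_close t : 0 <= t <= T -> exists2 E, 0 < E & forall e x y phi,
  0 < e -> e <= 1 -> Na (x - us k t) <= e -> Nc (y - ps k t) <= e ->
  fbounded a (fun v => phi v - fs k t v) e ->
  `|a x x + c y y - 2 * phi x - W t| <= e * E.
Proof.
move=> ht; have [lf [C bC]] := lfs (leqnSn k) ht.
have {}bC : fbounded a (fs k t) `|C| by apply: fboundedW bC (ler_norm _).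
exists (4 * Na (us k t) + 2 * Nc (ps k t) + 4 + 2 * `|C|).
  have := fnorm_ge0 a (us k t); have := fnorm_ge0 c (ps k t); have := normr_ge0 C; lra.
move=> e x y phi e0 e1 hx hy hphi.
have [x1 x2] := fnorm_close ha e1 hx; have [y1 _] := fnorm_close hc e1 hy.
have h1 := hphi x; have h2 := bC (x - us k t).
rewrite (linB lf) in h2.
have h3 := ler_wpM2l (normr_ge0 C) hx.
have h4 := ler_wpM2l (ltW e0) x2.
move: x1 y1 h1 h2; rewrite /W !ler_norml; lra.
Qed.

Let scaled_le (X : lmodType R) (s : X -> X -> R) (hs : psd_form s) z w h e :
  0 < h -> fnorm s (z - h *: w) <= e * h -> fnorm s (h^-1 *: z - w) <= e.
Proof.
move=> h0; have -> : h^-1 *: z - w = h^-1 *: (z - h *: w).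
  by rewrite scalerBr scalerA mulVf ?scale1r// gt_eqF.
by rewrite fnormZ// gtr0_norm ?invr_gt0// ler_pdivrMl// mulrC.
Qed.

(** Difference quotients converge both forwards and backwards in time. Both cases occur: the
    telescoped sum of [fine_grid] leaves an increment that starts at [s] and one that ends at
    [t]. *)
Let incr_energy_lim t e : 0 <= t <= T -> 0 < e -> exists2 del, 0 < del &
  forall h, 0 < h -> h < del ->
  (t + h <= T -> `|2 * incr_energy h t / h ^+ 2 - W t| <= e) /\
  (0 <= t - h -> `|2 * incr_energy h (t - h) / h ^+ 2 - W t| <= e).
Proof.
move=> ht e0; have [E E0 hE] := energy_close ht.
have k1 : (k.-1 < k)%N by rewrite kP.
have du := dus k1; have dp := dps k1; have df := dfs (ltnW k1).
rewrite !kP in du dp df.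
pose e' := Num.min 1 (e / E).
have e'0 : 0 < e' by rewrite lt_min ltr01 divr_gt0.
have e'1 : e' <= 1 by rewrite ge_min lexx.
have e'E : e' * E <= e by rewrite -ler_pdivlMr// ge_min lexx orbT.
have [d1 d10 h1] := du t ht e' e'0; have [d2 d20 h2] := dp t ht e' e'0.
have [d3 d30 h3] := df t ht e' e'0.
have [t0 tT] := andP ht.
exists (Num.min d1 (Num.min d2 d3)); first by rewrite !lt_min d10 d20.
move=> h h0; rewrite !lt_min => /and3P[hd1 hd2 hd3].
have hn : h != 0 by rewrite gt_eqF.
have key r : 0 <= r <= T -> 0 <= r + h <= T -> 2 * incr_energy h r / h ^+ 2 =
    a (h^-1 *: (u0 (r + h) - u0 r)) (h^-1 *: (u0 (r + h) - u0 r))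
    + c (h^-1 *: (p0 (r + h) - p0 r)) (h^-1 *: (p0 (r + h) - p0 r))
    - 2 * (h^-1 * (f0 (r + h) (h^-1 *: (u0 (r + h) - u0 r))
       - f0 r (h^-1 *: (u0 (r + h) - u0 r)))).
  move=> hr hrh; have [l1 _] := lfs (leqW (leq_pred k)) hr.
  have [l2 _] := lfs (leqW (leq_pred k)) hrh.
  rewrite /incr_energy (psdZl ha) (psdZr ha) (psdZl hc) (psdZr hc) (linZ l1) (linZ l2).
  by field.
have close r : 0 <= r <= T -> 0 <= r + h <= T ->
    Na (u0 (r + h) - u0 r - h *: us k t) <= e' * h ->
    Nc (p0 (r + h) - p0 r - h *: ps k t) <= e' * h ->
    fbounded a (fun v => f0 (r + h) v - f0 r v - h * fs k t v) (e' * h) ->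
    `|2 * incr_energy h r / h ^+ 2 - W t| <= e.
  move=> hr hrh b1 b2 b3; rewrite key//; apply: le_trans e'E.
  apply: (hE _ _ _ (fun v => h^-1 * (f0 (r + h) v - f0 r v))) => //.
  - exact: (scaled_le ha).
  - exact: (scaled_le hc).
  move=> v; have := b3 v; rewrite -(ler_pM2l (x := h^-1)) ?invr_gt0//.
  have -> : h^-1 * (e' * h * Na v) = e' * Na v by field.
  rewrite -[h^-1 in X in X <= _]gtr0_norm ?invr_gt0// -normrM.
  by congr (`|_| <= _); field.
split=> hh.
  have hr : 0 <= t + h <= T by lra.
  have th : t + h - t = h by ring.
  have := h1 _ hr; have := h2 _ hr; have := h3 _ hr.
  by rewrite th (gtr0_norm h0) => /(_ hd3) {}h3 /(_ hd2) {}h2 /(_ hd1) {}h1; exact: close.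
have hr : 0 <= t - h <= T by lra.
have th : t - h - t = - h by ring.
have := h1 _ hr; have := h2 _ hr; have := h3 _ hr.
rewrite th normrN (gtr0_norm h0) => /(_ hd3) {}h3 /(_ hd2) {}h2 /(_ hd1) {}h1.
apply: close; rewrite ?subrK//.
- by move: h1; rewrite -(fnormN ha) scaleNr opprK opprD opprB.
- by move: h2; rewrite -(fnormN hc) scaleNr opprK opprD opprB.
move=> v; have := h3 v; rewrite -normrN; congr (`|_| <= _); ring.
Qed.

(* [A t - A s] dominates the integral over [s, t] of the squared [b]-norm of
   [ps k], which itself need not take values in the image of [io]. *)
Lemma parabolic_energy : exists A : R -> R, forall s t,
  0 <= s -> s <= t -> t <= T ->
  dualnorm b (fun q => beta k.-1 t q - beta k.-1 s q) ^+ 2 <= (t - s) * (A t - A s).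
Proof.
have [C C0 hC] := incr_energy_deriv.
(* Read off from the bound of [fine_grid] in the limit of vanishing mesh. *)
exists (fun t => 2 * C * t - W t) => s t s0; rewrite le_eqVlt => /predU1P[->|st] tT.
  rewrite !subrr mul0r; set D := dualnorm _ _.
  have D0 : 0 <= D by exact: (dualnorm_ge0 hb).
  have : D <= 0.
    by apply: (dualnorm_le hb) => // q; rewrite subrr normr0 mul0r.
  by nra.
have hs : 0 <= s <= T by lra.
have ht : 0 <= t <= T by lra.
rewrite -/(inc t s); have D0 : 0 <= inc t s by exact: (dualnorm_ge0 hb).
apply: (@le_of_eps _ _ _ (2 * (t - s) + 4 * inc t s)) => e e0 e1.
have k1 : (k.-1 < k)%N by rewrite kP.
have [d1 d10 h1] := incr_energy_lim hs e0.
have [d2 d20 h2] := incr_energy_lim ht e0.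
have [d3 d30 h3] := parabolic_op_cont k1 hs e0.
have [d4 d40 h4] := parabolic_op_cont k1 ht e0.
pose del := Num.min (Num.min d1 d2) (Num.min d3 d4).
have del0 : 0 < del by rewrite !lt_min d10 d20 d30.
have ts0 : 0 < t - s by rewrite subr_gt0.
(* Then [n.+1] exceeds [(t - s) / del], so the mesh is below [del]. *)
pose n := Num.truncn ((t - s) / del).
pose h := (t - s) / n.+1%:R.
have h0 : 0 < h by rewrite divr_gt0.
have hdel : h < del.
  rewrite /h ltr_pdivrMr// mulrC -ltr_pdivrMr//; exact: truncnS_gt.
move: (hdel); rewrite !lt_min -!andbA => /and4P[hd1 hd2 hd3 hd4].
have [th /andP[th0 thh] hN] := fine_grid n C0 hC s0 st tT.
rewrite -/h in thh hN.
have nh : n%:R * h = t - s - h.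
  by rewrite /h -[n.+1]addn1 natrD; field; rewrite natr1 gt_eqF.
have nh0 : 0 <= n%:R * h by rewrite mulr_ge0// ltW.
set N := inc _ _ in hN.
have N0 : 0 <= N by exact: (dualnorm_ge0 hb).
have ths : 0 <= th + s <= T by lra.
have tht : 0 <= th + (s + n%:R * h) <= T by lra.
(* The ends of the shifted grid are within [h] of [s] and [t]; continuity of [beta k.-1] pays [e] at
   each of them. *)
have le1 : inc t s <= N + 2 * e.
  apply: (dualnorm_le hb) => [|q]; first by lra.
  have a1 := h3 _ ths _ q; have {}a1 := a1 _.
  have b1 : `|th + s - s| < d3 by rewrite addrK gtr0_norm//; lra.
  have b2 : `|th + (s + n%:R * h) - t| < d4 by rewrite nh ltr_norml; lra.
  have {a1}a1 := h3 _ ths b1 q; have a2 := h4 _ tht b2 q.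
  have a3 := incP tht ths q; rewrite -/N in a3.
  by move: a1 a2 a3; rewrite !ler_norml; lra.
have sh : s + h <= T by lra.
have th' : 0 <= t - h by lra.
have [/(_ sh) b1 _] := h1 h h0 hd1; have [_ /(_ th') b2] := h2 h h0 hd2.
have le2 : N ^+ 2 <= (t - s) * (2 * C * t - W t - (2 * C * s - W s) + 2 * e).
  rewrite (le_trans hN)// ler_wpM2l ?(ltW ts0)//.
  have -> : 2 * (incr_energy h s - incr_energy h (t - h)) / h ^+ 2 =
    2 * incr_energy h s / h ^+ 2 - 2 * incr_energy h (t - h) / h ^+ 2.
    by field; rewrite gt_eqF.
  by move: b1 b2; rewrite !ler_norml; lra.
have [DN|ND] := lerP (inc t s) N.
  have : inc t s ^+ 2 <= N ^+ 2 by rewrite lerXn2r.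
  have : 0 <= e * inc t s by rewrite mulr_ge0// ltW.
  have : 0 <= e * (t - s) by rewrite mulr_ge0// ltW.
  by move: le2; lra.
have : (inc t s - N) * (inc t s + N) <= (2 * e) * (2 * inc t s).
  rewrite ler_pM ?subr_ge0 ?addr_ge0 ?(ltW ND) ?lerBlDl//.
  by rewrite mulr_natl mulr2n lerD2l ltW.
by move: le2; rewrite -subr_sqr; lra.
Qed.

(** The truncation error of BDF-k in the parabolic equation, as a functional of the test
    function. *)
Definition bdf_defect tau t (q : Q) : R :=
  tau^-1 * (\sum_(l < k.+1) bdf_coef R k l *
    (d (us 0 (t - l%:R * tau)) (io q) + c (ps 0 (t - l%:R * tau)) (io q)))
  - (d (us 1 t) (io q) + c (ps 1 t) (io q)).

(** By the parabolic equation, the derivative of order [k] of the quantity that BDF-k differentiates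
    is [gs k.-1 - beta k.-1]. Its oscillation over a window is controlled by the Lipschitz bound of
    [gs k.-1] and by the square root of the window length times the increment of [A], which is what
    [bdf_consistency] asks for. *)
Lemma bdf_defect_bound : (1 <= k <= 5)%N -> exists (C : R) (A : R -> R), 0 < C /\
  (forall s t, 0 <= s -> s <= t -> t <= T -> A s <= A t) /\
  forall tau t, 0 < tau -> k%:R * tau <= t -> t <= T ->
  exists rho, [/\ 0 <= rho, fbounded b (bdf_defect tau t) rho &
    tau * rho ^+ 2 <= C * tau ^+ (2 * k) * (tau + (A t - A (t - k%:R * tau)))].
Proof.
move=> hk; have [A hA] := parabolic_energy.
(* [hA] bounds a square by [(t - s) * (A t - A s)], which is therefore nonnegative. *)
have Amono s t : 0 <= s -> s <= t -> t <= T -> A s <= A t.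
  move=> s0; rewrite le_eqVlt => /predU1P[->//|st] tT.
  have := le_trans (sqr_ge0 _) (hA s t s0 (ltW st) tT).
  have ts : 0 < t - s by rewrite subr_gt0.
  by rewrite (pmulr_rge0 _ ts) subr_ge0.
have k1 : (k.-1 < k)%N by rewrite kP.
have [Cg Cg0 hCg] := fcont_bounded (fcont_derivs (leqnn k)).2
  (fun t ht => (lgs (leqnSn _) ht).2).
have [C C0 hC] := bdf_consistency R hk.
have dg := dgs (ltnW k1); rewrite kP in dg.
exists (2 * C ^+ 2 * ((Cg * k%:R) ^+ 2 + k%:R) + 1), A.
split; [|split=> // tau t tau0 kt tT].
  apply: ltr_wpDl => //; apply: mulr_ge0; last by rewrite addr_ge0 ?sqr_ge0.
  by rewrite mulr_ge0 ?sqr_ge0.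
set s := t - k%:R * tau.
have kn0 : 0 < k%:R :> R by rewrite ltr0n.
have ktau0 : 0 < k%:R * tau by rewrite mulr_gt0.
have s0 : 0 <= s by rewrite subr_ge0.
have st : s <= t by rewrite gerBl ltW.
have A0 : 0 <= A t - A s by rewrite subr_ge0 Amono.
pose sq := Num.sqrt (k%:R * tau * (A t - A s)).
(* Division by [tau] lowers the power to [k.-1]. The square of the bracket is of order
   [tau * (tau + (A t - A s))], and the weight [tau] completes [tau ^+ (2 * k)]. *)
pose rho := C * tau ^+ k.-1 * (Cg * (k%:R * tau) + sq).
have sq0 : 0 <= sq by exact: sqrtr_ge0.
have in0 : 0 <= Cg * (k%:R * tau) + sq by rewrite addr_ge0// mulr_ge0// ltW.
have rho0 : 0 <= rho by rewrite !mulr_ge0// exprn_ge0// ltW.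
have tk : tau ^+ k = tau * tau ^+ k.-1 by rewrite -exprS kP.
exists rho; split => //.
  move=> q; pose m j r := d (us j r) (io q) + c (ps j r) (io q).
  have dm j : (j < k)%N -> deriv_on 0 T (m j) (m j.+1).
    move=> jk; apply: deriv_onD.
      apply: (vderiv_lin (F := d ^~ (io q)) (C := Cd * Nc (io q)) (dus jk)) => // x.
      by rewrite mulrAC.
    apply: (vderiv_lin (F := c ^~ (io q)) (C := Nc (io q)) (dps jk)); first exact: psd_linl.
    by move=> x; rewrite (psdC hc) (psd_CS hc).
  have mE r : m k r = gs k.-1 r q - beta k.-1 r q.
    by rewrite /m /parabolic_op kP; ring.
  have h : `|\sum_(l < k.+1) bdf_coef R k l * m 0 (t - l%:R * tau) - tau * m 1 t|
      <= C * tau ^+ k * ((Cg * (k%:R * tau) + sq) * Nb q).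
    apply: hC => // [j jk|]; first by apply: deriv_sub (dm j jk).
    rewrite -/s.
    move=> r /andP[sr rt]; rewrite !mE.
    have r0 := le_trans s0 sr.
    have h1 := fderiv_lip dg hCg r0 rt tT q.
    have lr : 0 <= r <= T by rewrite r0 (le_trans rt).
    have lt : 0 <= t <= T by rewrite (le_trans s0 st).
    have h2 := incP lt lr q.
    have h3 : inc t r <= sq.
      have D0 : 0 <= inc t r by exact: (dualnorm_ge0 hb).
      rewrite -(ler_pXn2r (n := 2)) ?nnegrE// sqr_sqrtr ?(mulr_ge0 (ltW ktau0) A0)//.
      rewrite (le_trans (hA r t r0 rt tT))// ler_pM ?subr_ge0//.
      - exact: Amono.
      - by rewrite lerBlDl -lerBlDr.
      - by rewrite lerB// Amono// (le_trans rt).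
    rewrite -normrN.
    have -> : - (gs k.-1 r q - beta k.-1 r q - (gs k.-1 t q - beta k.-1 t q)) =
      (gs k.-1 t q - gs k.-1 r q) - (beta k.-1 t q - beta k.-1 r q) by ring.
    rewrite (le_trans (ler_normB _ _))// mulrDl lerD//.
      rewrite (le_trans h1)// ler_wpM2r ?fnorm_ge0// ler_wpM2l ?(ltW Cg0)//.
      by rewrite lerBlDl -lerBlDr.
    by rewrite (le_trans h2)// ler_wpM2r ?fnorm_ge0.
  rewrite -(ler_pM2l tau0) -{1}(gtr0_norm tau0) -normrM /bdf_defect mulrBr.
  rewrite mulrA divff ?gt_eqF// mul1r (le_trans h)//.
  rewrite le_eqVlt; apply/orP; left; apply/eqP.
  by rewrite /rho tk; ring.
have -> : tau * rho ^+ 2 = C ^+ 2 * (tau * (tau ^+ k.-1) ^+ 2) *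
  (Cg * (k%:R * tau) + sq) ^+ 2 by rewrite /rho; ring.
have -> : tau ^+ (2 * k) = tau ^+ 2 * (tau ^+ k.-1) ^+ 2.
  by rewrite mulnC exprM tk exprMn.
have sqE : sq ^+ 2 = k%:R * tau * (A t - A s).
  by rewrite sqr_sqrtr// mulr_ge0// ltW.
set P := (tau ^+ k.-1) ^+ 2; have P0 : 0 <= P by exact: sqr_ge0.
have le1 : (Cg * (k%:R * tau) + sq) ^+ 2 <=
    2 * ((Cg * k%:R) ^+ 2 + k%:R) * (tau * (tau + (A t - A s))).
  have := sqr_ge0 (Cg * (k%:R * tau) - sq).
  have e1 : 0 <= (Cg * k%:R) ^+ 2 * (tau * (A t - A s)).
    by rewrite mulr_ge0 ?sqr_ge0// mulr_ge0// ltW.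
  have e2 : 0 <= k%:R * (tau * tau) by rewrite mulr_ge0 ?(ltW kn0)// -expr2 sqr_ge0.
  have -> : (Cg * (k%:R * tau) + sq) ^+ 2 = 2 * ((Cg * k%:R) ^+ 2 * tau ^+ 2) + 2 * sq ^+ 2
    - (Cg * (k%:R * tau) - sq) ^+ 2 by ring.
  rewrite sqE; move: e1 e2; rewrite expr2 => *; nra.
have f1 : 0 <= C ^+ 2 * (tau * P) by rewrite mulr_ge0 ?sqr_ge0// mulr_ge0// ltW.
rewrite (le_trans (ler_wpM2l f1 le1))//.
have -> : C ^+ 2 * (tau * P) * (2 * ((Cg * k%:R) ^+ 2 + k%:R) * (tau * (tau + (A t - A s))))
  = 2 * C ^+ 2 * ((Cg * k%:R) ^+ 2 + k%:R) * (tau ^+ 2 * P) * (tau + (A t - A s)) by ring.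
rewrite !ler_wpM2r ?lerDl//; last by rewrite mulr_ge0 ?sqr_ge0.
by rewrite addr_ge0// ltW.
Qed.

(* The abstract error bound for residuals of dual norm at most [M] *)
Local Opaque bdf_coef.

(** [M ^+ 2] carries no power of [tau], as the squared residuals are summed with weight [tau] over a
    time of at most [T]. The elliptic equation is required of the starting values too, because the
    BDF sums reach back to them. *)
Lemma scheme_error : (1 <= k <= 5)%N -> exists2 C : R, 0 < C &
  forall (tau M : R) (N : nat) (U : nat -> V) (P : nat -> H) (Y : nat -> Q)
    (r : nat -> Q -> R),
  0 < tau -> 0 <= M -> (k <= N)%N -> N%:R * tau <= T ->
  (forall n v, (n <= N)%N -> a (U n) v - d v (P n) = fs 0 (n%:R * tau) v) ->
  (forall n, (k <= n <= N)%N -> io (Y n) = P n /\ fbounded b (r n) M /\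
    forall q,
      d (tau^-1 *: \sum_(l < k.+1) bdf_coef R k l *: U (n - l)%N) (io q)
      + c (tau^-1 *: \sum_(l < k.+1) bdf_coef R k l *: P (n - l)%N) (io q)
      + b (Y n) q = gs 0 (n%:R * tau) q + r n q) ->
  a (U N - us 0 (N%:R * tau)) (U N - us 0 (N%:R * tau))
    + c (P N - ps 0 (N%:R * tau)) (P N - ps 0 (N%:R * tau))
  <= C * (M ^+ 2 + tau ^+ (2 * k)
    + \sum_(l < k) c (P l - ps 0 (l%:R * tau)) (P l - ps 0 (l%:R * tau))).
Proof.
move=> hk; have [C1 C10 stab] := bdf_stability R hk.
have [C2 [A [C20 [Amono hdef]]]] := bdf_defect_bound hk.
have AT : 0 <= A T - A 0 by rewrite subr_ge0 Amono// ltW.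
exists (C1 * (2 * T + 2 * C2 * (T + k%:R * (A T - A 0)) + (Cd ^+ 2 + 1))).
  rewrite mulr_gt0//.
  have h1 : 0 <= C2 * (T + k%:R * (A T - A 0)).
    by rewrite mulr_ge0 ?(ltW C20)// addr_ge0 ?(ltW T0)// mulr_ge0.
  have h2 := sqr_ge0 Cd; rewrite -mulrA ltr_wpDl//; last by rewrite ltr_wpDl.
  by apply: addr_ge0; apply: mulr_ge0 => //; exact: ltW.
move=> tau M N U P Y r tau0 M0 kN NT hell hpar.
pose t n := n%:R * tau.
pose Eu n := U n - us 0 (t n); pose Ep n := P n - ps 0 (t n).
have tT n : (n <= N)%N -> 0 <= t n <= T.
  move=> nN; rewrite mulr_ge0 ?(ltW tau0)//= (le_trans _ NT)//.
  by rewrite ler_wpM2r ?(ltW tau0)// ler_nat.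
have ell n v : (n <= N)%N -> a (Eu n) v = d v (Ep n).
  move=> nN; have := hell n v nN; have := elliptic_derivs v (leq0n k) (tT n nN).
  rewrite /Eu /Ep (psdDl ha) (psdNl ha) (linB (ld2 _)) -/(t n).
  by move=> <- h; lra.
(* Takes the place of [b (Ep n) _], as [Ep n] lies only in the closed graph. *)
pose gam n q := b (Y n) q - beta 0 (t n) q.
have graph_gam n : (k <= n <= N)%N -> graph (Ep n) (gam n).
  move=> hn; have [yP _] := hpar n hn; rewrite /Ep -yP.
  apply: (closed_graphB hc hb lio); first exact: closed_graph_elem.
  by apply: parabolic_graph => //; apply: tT; case/andP: hn.
have lin_gam n : (k <= n <= N)%N -> lin (gam n).
  move=> hn x y z; rewrite /gam (psd_linr hb).
  by rewrite parabolic_op_lin//; [ring|apply: tT; case/andP: hn].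
have /choice[rho hrho] : forall n, exists rho, (k <= n <= N)%N ->
    [/\ 0 <= rho, fbounded b (bdf_defect tau (t n)) rho &
    tau * rho ^+ 2 <= C2 * tau ^+ (2 * k) * (tau + (A (t n) - A (t (n - k)%N)))].
  move=> n; have [hn|hn] := boolP (k <= n <= N)%N; last by exists 0.
  have [kn nN] := andP hn.
  have -> : t (n - k)%N = t n - k%:R * tau by rewrite /t natrB// mulrBl.
  have [||rho h] := hdef tau (t n) tau0.
  - by rewrite ler_wpM2r ?(ltW tau0)// ler_nat.
  - by case/andP: (tT n nN).
  by exists rho.
pose x n : V * H := (Eu n, Ep n).
pose Xi (X : lmodType R) (E : nat -> X) n := \sum_(l < k.+1) bdf_coef R k l *: E (n - l)%N.
pose Lam n y := tau^-1 * (d (Xi V Eu n) y + c (Xi H Ep n) y).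
have lin_Lam n : lin (Lam n).
  by move=> z y y'; rewrite /Lam ld2 (psd_linr hc); ring.
have bd_Lam n : exists B, fbounded c (Lam n) B.
  exists (tau^-1 * (Cd * Na (Xi V Eu n) + Nc (Xi H Ep n))) => y.
  rewrite /Lam normrM (gtr0_norm (x := tau^-1)) ?invr_gt0// -mulrA ler_wpM2l ?invr_ge0 ?(ltW tau0)//.
  rewrite (le_trans (ler_normD _ _))// mulrDl lerD//; exact: psd_CS.
(* The error equation: subtracting the exact equation leaves the residual minus the truncation
   error. *)
have test n q : (k <= n <= N)%N -> Lam n (io q) + gam n q <= (M + rho n) * Nb q.
  move=> hn; have [yP [rM hY]] := hpar n hn; have [_ hdn _] := hrho n hn.
  have [kn nN] := andP hn.
  have -> : Lam n (io q) + gam n q = r n q - bdf_defect tau (t n) q.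
    have := hY q; rewrite /Lam /gam /parabolic_op /bdf_defect /Xi.
    have xiE (X : lmodType R) (F : X -> R) (E : nat -> X) : lin F ->
        F (\sum_(l < k.+1) bdf_coef R k l *: E (n - l)%N) =
        \sum_(l < k.+1) bdf_coef R k l * F (E (n - l)%N).
      by move=> lF; rewrite (lin_sum lF); apply: eq_bigr => l _; rewrite (linZ lF).
    rewrite (linZ (ld1 _)) (psdZl hc) !(xiE _ (d ^~ (io q))) ?(xiE _ (c ^~ (io q)))//;
      try exact: psd_linl.
    have tl (l : 'I_k.+1) : t (n - l)%N = t n - l%:R * tau.
      by rewrite /t natrB ?mulrBl// (leq_trans _ kn)// -ltnS.
    have splitE (X : lmodType R) (F : X -> R) (E : nat -> X) (E' : R -> X) : lin F ->
        \sum_(l < k.+1) bdf_coef R k l * F (E (n - l)%N - E' (t (n - l)%N)) =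
        \sum_(l < k.+1) bdf_coef R k l * F (E (n - l)%N) -
        \sum_(l < k.+1) bdf_coef R k l * F (E' (t n - l%:R * tau)).
      move=> lF; rewrite -sumrB; apply: eq_bigr => l _.
      by rewrite (linB lF) mulrBr tl.
    rewrite (splitE _ (d ^~ (io q)))// (splitE _ (c ^~ (io q))); last exact: psd_linl.
    have -> : \sum_(l < k.+1) bdf_coef R k l * (d (us 0 (t n - l%:R * tau)) (io q)
          + c (ps 0 (t n - l%:R * tau)) (io q)) =
        \sum_(l < k.+1) bdf_coef R k l * d (us 0 (t n - l%:R * tau)) (io q) +
        \sum_(l < k.+1) bdf_coef R k l * c (ps 0 (t n - l%:R * tau)) (io q).
      by rewrite -big_split; apply: eq_bigr => l _; rewrite mulrDr.
    by rewrite -/(t n) => h; lra.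
  rewrite (le_trans (ler_norm _))// (le_trans (ler_normB _ _))// mulrDl lerD//.
pose nu n := dualnorm b (gam n).
(* By [ell] and the symmetry of [a], pairing the BDF sum of [Eu] with [Eu n - eta *: Eu n'] in [a]
   equals pairing it with [Ep n - eta *: Ep n'] in [d]. This merges both equations into one form. *)
have prodE n n' eta : (n <= N)%N -> (n' <= N)%N ->
    prod_form a c (\sum_(l < k.+1) bdf_coef R k l *: x (n - l)%N) (x n - eta *: x n')
    = tau * Lam n (Ep n - eta *: Ep n').
  move=> nN n'N; rewrite /prod_form /=.
  have -> : (\sum_(l < k.+1) bdf_coef R k l *: x (n - l)%N).1 = Xi V Eu n.
    by apply: (big_morph fst) => //.
  have -> : (\sum_(l < k.+1) bdf_coef R k l *: x (n - l)%N).2 = Xi H Ep n.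
    by apply: (big_morph snd) => //.
  rewrite /Lam mulrA divff ?gt_eqF// mul1r; congr (_ + _).
  rewrite (psdDr ha) (psdNr ha) (psdZr ha) !(psdC ha (Xi V Eu n)) !ell//.
  by rewrite [RHS](linB (ld2 _)) [in RHS](linZ (ld2 _)).
have nu0 n : 0 <= nu n by exact: (dualnorm_ge0 hb).
have Mrho n : (k <= n <= N)%N -> 0 <= M + rho n.
  by move=> hn; rewrite addr_ge0//; have [] := hrho n hn.
have inN n : (k <= n <= N)%N -> (n <= N)%N by case/andP.
have main := stab _ (prod_form a c) x nu (fun n => M + rho n) tau N
  (prod_form_psd ha hc) tau0 kN _ _.
have {}main : prod_form a c (x N) (x N) <= C1 * (\sum_(l < k) prod_form a c (x l) (x l)
    + tau * \sum_(k <= n < N.+1) (M + rho n) ^+ 2).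
  apply: main.
    have hk0 : (k <= k <= N)%N by rewrite leqnn.
    have [B bB] := bd_Lam k.
    have := closed_graph_test hb lio (graph_gam k hk0) (graph_gam k hk0)
      (lin_gam k hk0) (lin_gam k hk0) (lin_Lam k) bB (lexx 0) ler01 (Mrho k hk0)
      (fun q => test k q hk0).
    have := prodE k k 0 kN kN; rewrite scale0r subr0 => ->.
    rewrite !mul0r subr0 addr0 -/(nu k) => /(ler_wpM2l (ltW tau0)).
    by rewrite mulrDr.
  move=> n /andP[kn nN].
  have hn : (k <= n <= N)%N by rewrite (ltnW kn).
  have hn1 : (k <= n.-1 <= N)%N.
    by rewrite (leq_trans (leq_pred _) nN) andbT -ltnS (ltn_predK kn).
  have [B bB] := bd_Lam n.
  have eta0 : 0 <= 19 / 20 :> R by lra.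
  have eta1 : 19 / 20 <= 1 :> R by lra.
  have := closed_graph_test hb lio (graph_gam n hn) (graph_gam n.-1 hn1)
    (lin_gam n hn) (lin_gam n.-1 hn1) (lin_Lam n) bB eta0 eta1 (Mrho n hn)
    (fun q => test n q hn).
  rewrite -/(nu n) -/(nu n.-1) => /(ler_wpM2l (ltW tau0)).
  rewrite -addrA mulrDr (prodE n n.-1 _ (inN n hn) (inN n.-1 hn1)).
  exact: id.
rewrite -[leLHS]/(prod_form a c (x N) (x N)) (le_trans main)//.
(* Testing [ell] with [Eu l] itself bounds the starting error of [u] by that of [p]. *)
have init l : (l < k)%N -> prod_form a c (x l) (x l) <= (Cd ^+ 2 + 1) * c (Ep l) (Ep l).
  move=> lk; rewrite /prod_form /= mulrDl mul1r lerD2r.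
  have h1 := fnorm_sqr ha (Eu l); have h2 := fnorm_sqr hc (Ep l).
  have h3 := le_trans (ler_norm _) (bd (Eu l) (Ep l)).
  rewrite -ell -?h1 -?h2 in h3 *; last by rewrite (leq_trans (ltnW lk)).
  have u0 := fnorm_ge0 a (Eu l); have v0 := fnorm_ge0 c (Ep l).
  rewrite -exprMn lerXn2r ?nnegrE ?mulr_ge0//.
  have [->|un0] := eqVneq (Na (Eu l)) 0; first by rewrite mulr_ge0.
  have up : 0 < Na (Eu l) by rewrite lt0r un0.
  by rewrite -(ler_pM2r up) -expr2 (le_trans h3)// mulrAC.
have sum_init : \sum_(l < k) prod_form a c (x l) (x l) <=
    (Cd ^+ 2 + 1) * \sum_(l < k) c (Ep l) (Ep l).
  by rewrite mulr_sumr; apply: ler_sum => l _; exact: init.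
have sum_rho : tau * \sum_(k <= n < N.+1) (M + rho n) ^+ 2 <=
    2 * T * M ^+ 2 + 2 * C2 * (T + k%:R * (A T - A 0)) * tau ^+ (2 * k).
  have cardN : \sum_(k <= n < N.+1) tau <= T.
    rewrite sumr_const_nat -[leLHS]mulr_natl (le_trans _ NT)//.
    rewrite ler_wpM2r ?(ltW tau0)// ler_nat leq_subLR -add1n.
    by apply: leq_add => //; case/andP: hk.
  pose B n := A (t n).
  have win := window_sum (B := B) kN.
  have {}win : \sum_(k <= n < N.+1) (B n - B (n - k)%N) <= k%:R * (A T - A 0).
    apply: (le_trans (win _)).
      move=> m n mn nN; apply: Amono.
      - by have /andP[] := tT m (leq_trans mn nN).
      - by rewrite ler_wpM2r ?(ltW tau0)// ler_nat.
      - by have /andP[] := tT n nN.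
    rewrite ler_wpM2l// lerB//.
      by apply: Amono => //; have /andP[] := tT N (leqnn _).
    by rewrite /B /t mul0r.
  have tk0 : 0 <= C2 * tau ^+ (2 * k).
    by rewrite mulr_ge0 ?(ltW C20)// exprn_ge0// ltW.
  apply: (@le_trans _ _ (\sum_(k <= n < N.+1)
     (2 * M ^+ 2 * tau + 2 * (C2 * tau ^+ (2 * k)) * (tau + (B n - B (n - k)%N))))).
    rewrite mulr_sumr big_nat [leRHS]big_nat; apply: ler_sum => n hn.
    have [_ _ h] := hrho n hn.
    have := mulr_ge0 (ltW tau0) (sqr_ge0 (M - rho n)).
    by move: h; rewrite -/(B n) -/(B (n - k)%N) sqrrB sqrrD; lra.
  rewrite big_split/= -!mulr_sumr big_split/=.
  have M20 := sqr_ge0 M.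
  have h1 := ler_wpM2l M20 cardN; have h2 := ler_wpM2l tk0 cardN.
  have h3 := ler_wpM2l tk0 win.
  by lra.
rewrite -mulrA ler_wpM2l ?(ltW C10)//.
have S0 : 0 <= \sum_(l < k) c (Ep l) (Ep l).
  by apply: sumr_ge0 => l _; exact: psd_ge0.
have c0 : 0 <= 2 * C2 * (T + k%:R * (A T - A 0)).
  by rewrite !mulr_ge0 ?(ltW C20)// addr_ge0 ?(ltW T0)// mulr_ge0.
rewrite -/(t _) -/(Ep _).
have t0 : 0 <= tau ^+ (2 * k) by rewrite exprn_ge0// ltW.
have M20 := sqr_ge0 M; have Cd2 := sqr_ge0 Cd.
have p1 := mulr_ge0 (ltW T0) t0; have p2 := mulr_ge0 (ltW T0) S0.
have p3 := mulr_ge0 c0 M20; have p4 := mulr_ge0 c0 S0.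
have p5 := mulr_ge0 Cd2 M20; have p6 := mulr_ge0 Cd2 t0.
rewrite (le_trans (lerD sum_init sum_rho))//.
set S := \sum_(l < k) c (Ep l) (Ep l) in S0 p2 p4 *.
set K2 := 2 * C2 * _ in c0 p3 p4 *.
set Q2 := Cd ^+ 2 in Cd2 p5 p6 *.
by set M2 := M ^+ 2 in M20 p3 p5 *; lra.
Qed.

End regularity.

(** * The function spaces *)

Section euclidean.
Context (R : realType) (m : nat).
Local Notation Rm := (m.-tuple (measurableTypeR R)).

(** Measurability on tuples is accessible through coordinates, so an open set is written as the
    countable union of the cubes with rational centre and radius that it contains. *)
Lemma measurable_open_preimage (O : set 'rV[R]_m) : open O ->
  measurable (@pt_of_tuple R m @^-1` O).
Proof.
move=> oO.
pose qball (i : m.-tuple rat * rat) : set 'rV[R]_m :=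
  [set y | forall j, `|ratr (tnth i.1 j) - y 0 j| < ratr i.2].
pose F i := if `[< qball i `<=` O >] then @pt_of_tuple R m @^-1` (qball i) else set0.
suff -> : @pt_of_tuple R m @^-1` O = \bigcup_i F i.
  apply: countable_bigcupT_measurable; first exact: countableP.
  move=> i; rewrite /F; case: ifP => // _.
  have -> : @pt_of_tuple R m @^-1` qball i =
      \bigcap_(j in [set: 'I_m]) ((fun z : Rm => tnth z j) @^-1`
        [set t | `|ratr (tnth i.1 j) - t| < ratr i.2]).
    apply/seteqP; split => z /= h j; first by have := h j; rewrite mxE.
    by rewrite mxE; exact: h.
  apply: fin_bigcap_measurable => // j _.
  rewrite -[X in measurable X]setTI; apply: measurable_tnth => //.
  have -> : [set t : R | `|ratr (tnth i.1 j) - t| < ratr i.2] =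
      `]ratr (tnth i.1 j) - ratr i.2, ratr (tnth i.1 j) + ratr i.2[%classic.
    by apply/seteqP; split => t /=; rewrite in_itv/= ltr_norml; lra.
  exact: measurable_itv.
apply/seteqP; split => [z /= Oz|z [i _]]; last first.
  by rewrite /F; case: asboolP => // sub /= h; exact: sub.
have /nbhs_ballP[e /= e0 he] := open_nbhs_nbhs (conj oO Oz).
(* A radius below [e / 2], with a centre closer to the point than this radius, keeps the cube inside
   the ball of radius [e]. *)
have e2 : 0 < e / 2 by rewrite divr_gt0.
have [r] := rat_in_itvoo e2; rewrite in_itv/= => /andP[r0 re].
have hq j : exists q : rat, `|ratr q - pt_of_tuple z 0 j| < ratr r.
  have [|q] := @rat_in_itvoo R (pt_of_tuple z 0 j) (pt_of_tuple z 0 j + ratr r).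
    by rewrite ltrDl.
  rewrite in_itv/= => /andP[q1 q2]; exists q; rewrite ltr_norml; lra.
have [q hq'] := choice hq.
exists ([tuple q j | j < m], r) => //.
rewrite /F; case: asboolP => [_|]; first by move=> j /=; rewrite tnth_mktuple.
case=> y /= hy; apply: he; split => // i j; rewrite ord1 -ball_normE /=.
have := hy j; have := hq' j; rewrite tnth_mktuple !ltr_norml; lra.
Qed.

Lemma measurable_continuous (f : 'rV[R]_m -> R) : continuous f ->
  measurable_fun setT (f \o @pt_of_tuple R m).
Proof.
move=> cf; apply: (measurability _ (measurable_realfun.RGenOInfty.measurableE R)) => //.
move=> _ [_ [a ->] <-]; rewrite setTI comp_preimage.
apply: measurable_open_preimage; apply: open_comp.
  by move=> x _; exact: cf.
exact: interval_open.
Qed.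

End euclidean.

Lemma lebesgue_tuple_box (R : realType) (m : nat) (M : R) (B := [set z : m.-tuple (measurableTypeR R) | forall i, `|tnth z i| <= M]) :
  measurable B /\ (lebesgue_tuple R m B < +oo)%E.
Proof.
rewrite /B {B}; set B := fun m => [set z : m.-tuple (measurableTypeR R) | forall i, `|tnth z i| <= M].
rewrite -/(B m).
have mB n : measurable (B n).
  have -> : B n = \bigcap_(j in [set: 'I_n]) ((fun z : n.-tuple (measurableTypeR R) => tnth z j) @^-1` `[- M, M]).
    apply/seteqP; split => z /= h j; first by move=> _; rewrite /= in_itv/= -ler_norml.
    by have := h j I; rewrite /= in_itv/= -ler_norml.
  apply: fin_bigcap_measurable => // j _.
  by rewrite -[X in measurable X]setTI; apply: measurable_tnth => //; exact: measurable_itv.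
split => //; elim: m => [|n ih].
  by rewrite /= diracE ltry.
rewrite /= /lebesgue_step.
have -> : @tuple_cons R n @^-1` B n.+1 = `[- M, M]%classic `*` B n.
  apply/seteqP; split => -[x z] /= h.
    split; first by have := h ord0; rewrite /= in_itv/= -ler_norml.
    by move=> i; have := h (lift ord0 i); rewrite tnthS.
  case: h => hx hz i; case: (unliftP ord0 i) => [j ->|->].
    by rewrite tnthS; exact: hz.
  by move: hx; rewrite in_itv/= -ler_norml.
have itv_fin : (@lebesgue_measure R `[(- M)%R, M]%classic < +oo)%E.
  by rewrite lebesgue_measure_itv/=; case: ifP => _; rewrite ltry.
rewrite product_measure1E; [|exact: measurable_itv|exact: mB].
by apply: lte_mul_pinfty => //; rewrite ge0_fin_numE.
Qed.

(* The spaces [L2], [H01] and [H01v] are predicates [inS] on all functions; [elt]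
   turns such a predicate into a module, to which the abstract error bound
   applies. *)
Record lsubspace (R : realType) (X : lmodType R) := LSubspace {
  lsubspace_set : set X;
  lsubspace0 : lsubspace_set 0;
  lsubspace_lin : forall r x y, lsubspace_set x -> lsubspace_set y ->
    lsubspace_set (r *: x + y) }.

Section subspace_module.
Context {R : realType} {X : lmodType R} (E : lsubspace X).

Definition lsubspace_pred : {pred X} := fun x => `[< lsubspace_set E x >].

Let lsubspace_closed : GRing.submod_closed lsubspace_pred.
Proof.
split; first exact/asboolP/lsubspace0.
by move=> r x y /asboolP Ex /asboolP Ey; exact/asboolP/lsubspace_lin.
Qed.

HB.instance Definition _ := GRing.isSubmodClosed.Build R X lsubspace_pred lsubspace_closed.

Record elt := Elt { elt_val : X; _ : elt_val \in lsubspace_pred }.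
HB.instance Definition _ := [isSub of elt for elt_val].
HB.instance Definition _ := [Choice of elt by <:].
HB.instance Definition _ := [SubChoice_isSubLmodule of elt by <:].

Lemma elt_valP (x : elt) : lsubspace_set E (elt_val x).
Proof. by case: x => x /= /asboolP. Qed.

Lemma elt_val_lin r (x y : elt) : elt_val (r *: x + y) = r *: elt_val x + elt_val y.
Proof. exact: (linearP (val : elt -> X)). Qed.

Lemma elt_val0 : elt_val (0 : elt) = 0.
Proof. exact: (raddf0 (val : elt -> X)). Qed.

Lemma elt_valB (x y : elt) : elt_val (x - y) = elt_val x - elt_val y.
Proof. exact: (raddfB (val : elt -> X)). Qed.

Lemma elt_valZ r (x : elt) : elt_val (r *: x) = r *: elt_val x.
Proof. by rewrite -[r *: x]addr0 elt_val_lin elt_val0 addr0. Qed.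

Lemma elt_val_sum n (x : 'I_n -> elt) : elt_val (\sum_i x i) = \sum_i elt_val (x i).
Proof. exact: (raddf_sum (val : elt -> X)). Qed.

(** A total map: a vector outside the subspace is sent to 0. *)
Definition to_elt (x : X) : elt := insubd (0 : elt) x.

Lemma to_eltK x : lsubspace_set E x -> elt_val (to_elt x) = x.
Proof. by move=> Ex; apply: insubdK; exact/asboolP. Qed.

Lemma elt_val_inj : injective elt_val. Proof. exact: val_inj. Qed.

End subspace_module.

Section L2_space.
Context (R : realType) (m : nat) (Omega : set 'rV[R]_m) (oO : open Omega).
Local Notation D := (@pt_of_tuple R m @^-1` Omega).
Local Notation mu := (lebesgue_tuple R m).
Local Notation HQ := (L2 Omega).
Local Notation pt := (@pt_of_tuple R m).
Implicit Types f g : 'rV[R]_m -> R.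

Let mD : measurable D. Proof. exact: measurable_open_preimage. Qed.

Lemma L2_mul_integrable f g : inS (f : HQ) -> inS (g : HQ) ->
  mu.-integrable D (EFin \o (fun z => f (pt z) * g (pt z))).
Proof.
move=> [mf f2] [mg g2].
(* The product is dominated by the sum of the two squares. *)
apply: le_integrable (integrableD mD f2 g2) => //.
  by apply/measurable_EFinP; exact: measurable_funM.
move=> z Dz /=; rewrite lee_fin (le_trans _ (ler_norm _))//.
have := sqr_ge0 (f (pt z) - g (pt z)); have := sqr_ge0 (f (pt z) + g (pt z)).
by rewrite sqrrD sqrrB ler_norml; have := sqr_ge0 (f (pt z)); have := sqr_ge0 (g (pt z)); lra.
Qed.

Lemma L2_lin r f g : inS (f : HQ) -> inS (g : HQ) -> inS (r *: f + g : HQ).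
Proof.
move=> hf hg; have [mf f2] := hf; have [mg g2] := hg.
have mrf : measurable_fun D (fun z => r * f (pt z)).
  by apply: measurable_funM => //; exact: measurable_cst.
split; first exact: measurable_funD mrf mg.
(* The square of [r * f + g] is at most [2 * r ^+ 2 * f ^+ 2 + 2 * g ^+ 2]. *)
have i1 := integrableZl mD (2 * r ^+ 2) f2; have i2 := integrableZl mD 2 g2.
apply: le_integrable (integrableD mD i1 i2) => //.
  apply/measurable_EFinP; apply: measurable_funX; exact: measurable_funD mrf mg.
move=> z Dz /=; rewrite lee_fin ger0_norm ?sqr_ge0//.
rewrite (le_trans _ (ler_norm _))//.
have := sqr_ge0 (r * f (pt z) - g (pt z)).
by rewrite (_ : (r *: f + g) (pt z) = r * f (pt z) + g (pt z))//; lra.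
Qed.

Lemma L2_0 : inS (0 : HQ).
Proof.
split; first exact: measurable_cst.
rewrite (_ : (fun z => _) = cst 0%E); first exact: integrable0.
by apply/funext => z /=; rewrite expr0n.
Qed.

Lemma ip_lin r f f' g : inS (f : HQ) -> inS (f' : HQ) -> inS (g : HQ) ->
  ip Omega (r *: (f : HQ) + (f' : HQ)) g = r * ip Omega f g + ip Omega f' g.
Proof.
move=> hf hf' hg; rewrite /ip.
have i1 := L2_mul_integrable hf hg; have i2 := L2_mul_integrable hf' hg.
rewrite -RintegralZl// -RintegralD//.
  apply: eq_Rintegral => z _ /=.
  by rewrite (_ : (_ + _) (pt z) = r * f (pt z) + f' (pt z))//; ring.
exact: (integrableZl mD r i1).
Qed.

Lemma ipC f g : ip Omega f g = ip Omega g f.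
Proof. by apply: eq_Rintegral => z _; rewrite mulrC. Qed.

Lemma ip_ge0 f : 0 <= ip Omega f f.
Proof. by apply: Rintegral_ge0 => z _; rewrite -expr2 sqr_ge0. Qed.

End L2_space.

Section L2_norm.
Context (R : realType) (m : nat) (Omega : set 'rV[R]_m) (oO : open Omega).
Local Notation HQ := (L2 Omega).

Definition L2_subspace : lsubspace HQ :=
  @LSubspace R HQ (@inS R HQ) (L2_0 Omega) (L2_lin oO).

Definition ip_elt (x y : elt L2_subspace) : R := ip Omega (elt_val x) (elt_val y).

Lemma ip_elt_psd : psd_form ip_elt.
Proof.
split=> [r x x' y|x y|x]; rewrite /ip_elt.
- rewrite elt_val_lin ip_lin//; [exact: (elt_valP x)|exact: (elt_valP x')|exact: (elt_valP y)].
- exact: ipC.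
- exact: ip_ge0.
Qed.

Lemma fnorm_ip (x : elt L2_subspace) : fnorm ip_elt x = nrm (elt_val x).
Proof. by []. Qed.

Lemma L2_nrm_lin r (f g : HQ) : inS f -> inS g ->
  nrm (r *: f + g) <= `|r| * nrm f + nrm g.
Proof.
move=> hf hg; pose x := to_elt L2_subspace f; pose y := to_elt L2_subspace g.
have xE : elt_val x = f by exact: to_eltK.
have yE : elt_val y = g by exact: to_eltK.
rewrite -xE -yE -elt_val_lin -!fnorm_ip (le_trans (fnormD ip_elt_psd _ _))//.
by rewrite fnormZ//; exact: ip_elt_psd.
Qed.

Lemma L2_inB (f g : HQ) : inS f -> inS g -> inS (f - g).
Proof. by move=> hf hg; rewrite addrC -scaleN1r; exact: L2_lin. Qed.

End L2_norm.

Lemma cvg0_comb (R : realType) (r : R) (u v : nat -> R) :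
  u j @[j --> \oo] --> (0 : R) -> v j @[j --> \oo] --> (0 : R) ->
  r * u j + v j @[j --> \oo] --> (0 : R).
Proof.
move=> cu cv; have := cvgD (cvgM (cvg_cst r) cu) cv.
by rewrite mulr0 addr0; exact.
Qed.

Section test_functions.
Context (R : realType) (m : nat) (Omega : set 'rV[R]_m).
Implicit Types f g : 'rV[R]_m -> R.

Lemma partial_lin r f g i : (forall x, derivable f x (delta_mx 0 i)) ->
  (forall x, derivable g x (delta_mx 0 i)) ->
  partial i (r *: f + g) = r *: partial i f + partial i g.
Proof.
move=> df dg; apply/funext => x; rewrite /partial deriveD//; last exact: derivableZ.
by rewrite deriveZ.
Qed.

Lemma smooth_lin k r f g : smooth k f -> smooth k g -> smooth k (r *: f + g).
Proof.
elim: k f g => [|k ih] f g /= sf sg.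
  by move=> x; apply: continuousD; [apply: continuousZl_tmp; exact: sf|exact: sg].
move=> i; have [df pf] := sf i; have [dg pg] := sg i; split.
  by move=> x; apply: derivableD => //; exact: derivableZ.
rewrite partial_lin//; exact: ih.
Qed.

Let supp f := [set x | f x != 0].

Lemma supp_lin r f g : supp (r *: f + g) `<=` supp f `|` supp g.
Proof.
move=> x; rewrite /supp /mkset; have [f0|] := eqVneq (f x) 0; last by left.
have [g0|] := eqVneq (g x) 0; last by right.
by move=> /negP; elim; rewrite (_ : _ x = r * f x + g x)// f0 g0 mulr0 addr0.
Qed.

Lemma test_function_lin r f g : test_function Omega f -> test_function Omega g ->
  test_function Omega (r *: f + g).
Proof.
move=> [sf cf Of] [sg cg Og].
have sub : closure (supp (r *: f + g)) `<=` closure (supp f) `|` closure (supp g).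
  by rewrite -closureU; apply: closureS; exact: supp_lin.
split => [k||]; first exact: smooth_lin.
  apply: subclosed_compact sub; [exact: closed_closure|exact: compactU].
by move=> x /sub[]; [exact: Of|exact: Og].
Qed.

Lemma test_function0 : test_function Omega (0 : 'rV[R]_m -> R).
Proof.
have s0 : supp 0 = set0 by apply/seteqP; split => x // /negP; case; apply/eqP.
split; last 2 first.
- by rewrite -/(supp 0) s0 closure0; exact: compact0.
- by rewrite -/(supp 0) s0 closure0.
move=> k; elim: k => [|k ih] /=; first by move=> x; exact: cst_continuous.
move=> i; split; first by move=> x; exact: derivable_cst.
suff -> : partial i (0 : 'rV[R]_m -> R) = (0 : 'rV[R]_m -> R) by [].
by apply/funext => x; rewrite /partial derive_cst.
Qed.

(** Off the closed support, the function vanishes on a whole neighbourhood. *)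
Lemma supp_partial i f : supp (partial i f) `<=` closure (supp f).
Proof.
move=> x /=; apply: contraNP => nx; rewrite /partial.
rewrite (near_eq_derive (g := cst 0)); first by rewrite derive_cst.
have : open_nbhs x (~` closure (supp f)) by split => //; exact/closed_openC/closed_closure.
move=> /open_nbhs_nbhs; apply: filterS => y ny.
by apply/eqP; apply: contraT => fy; exfalso; apply: ny; exact: subset_closure.
Qed.

Hypotheses (oO : open Omega) (bO : bounded_set Omega).

(** A continuous function is bounded on [K], and the bounded set [Omega] lies in a box of finite
    measure. *)
Lemma compact_support_L2 f K : continuous f -> compact K -> supp f `<=` K ->
  inS (f : L2 Omega).
Proof.
move=> cf cK fK.
have mD : measurable (@pt_of_tuple R m @^-1` Omega) by exact: measurable_open_preimage.
have mf := measurable_continuous cf.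
have mfD : measurable_fun (@pt_of_tuple R m @^-1` Omega) (f \o @pt_of_tuple R m).
  exact: measurable_funTS.
split=> //.
have [M [Mr hM]] := compact_bounded (continuous_compact (continuous_subspaceT cf) cK).
have [B [Br hB]] := bO.
apply: measurable_bounded_integrable => //.
- have [mbox fbox] := lebesgue_tuple_box m (`|B| + 1 + 1).
  apply: le_lt_trans fbox; apply: le_measure; rewrite ?inE//.
  move=> z /= Oz i.
  have /(_ _ Oz) zB := hB (`|B| + 1) (ltr_pwDr ltr01 (ler_norm B)).
  have : ball (0 : 'rV[R]_m) (`|B| + 1 + 1) (pt_of_tuple z).
    by rewrite mx_norm_ball /ball_ /= sub0r normrN (le_lt_trans zB)// ltrDl.
  move=> [_ /(_ 0 i)]; rewrite -ball_normE /ball_ /= !mxE sub0r normrN.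
  exact: ltW.
- exact: measurable_funX.
exists ((`|M| + 1) ^+ 2); split; first exact: num_real.
move=> C MC z Oz /=; rewrite (le_trans _ (ltW MC))// normrX lerXn2r ?nnegrE ?addr_ge0//.
have [f0|f0] := eqVneq (f (pt_of_tuple z)) 0; first by rewrite f0 normr0 addr_ge0.
apply: (hM (`|M| + 1)); first by rewrite ltr_pwDr// ler_norm.
by exists (pt_of_tuple z) => //; exact: fK.
Qed.

Lemma test_function_L2 f : test_function Omega f -> inS (f : L2 Omega).
Proof.
move=> [sf cf _]; apply: compact_support_L2 (sf 0%N) cf _.
exact: subset_closure.
Qed.

Lemma test_partial_L2 f i : test_function Omega f -> inS (partial i f : L2 Omega).
Proof.
move=> [sf cf _]; apply: (compact_support_L2 _ cf (@supp_partial i f)).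
by have [_] := sf 1%N i.
Qed.

(** Combinations of approximating test functions approximate the combination, which makes [H01] a
    subspace. *)
Lemma has_gradient_lin r f g F G : inS (f : L2 Omega) -> inS (g : L2 Omega) ->
  has_gradient Omega f F -> has_gradient Omega g G ->
  has_gradient Omega (r *: f + g) (fun i => r *: F i + G i).
Proof.
move=> hf hg [hF [phi [t1 c1 d1]]] [hG [psi [t2 c2 d2]]]; split.
  by move=> i; exact: L2_lin.
exists (fun j => r *: phi j + psi j); split.
- by move=> j; exact: test_function_lin.
- have lim : `|r| * nrm (phi j - f : L2 Omega) + nrm (psi j - g : L2 Omega) @[j --> \oo] --> (0 : R).
    exact: cvg0_comb.
  apply: squeeze_cvgr (cvg_cst 0) lim; near=> j; rewrite sqrtr_ge0/=.
  have -> : (r *: phi j + psi j - (r *: f + g) : L2 Omega)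
      = r *: ((phi j : L2 Omega) - f) + ((psi j : L2 Omega) - g).
    by rewrite scalerBr opprD addrACA.
  by apply: L2_nrm_lin => //; apply: L2_inB => //; exact: test_function_L2.
move=> i.
have lim : `|r| * nrm (partial i (phi j) - F i : L2 Omega) + nrm (partial i (psi j) - G i : L2 Omega) @[j --> \oo] --> (0 : R).
  exact: cvg0_comb.
apply: squeeze_cvgr (cvg_cst 0) lim; near=> j; rewrite sqrtr_ge0/=.
have -> : (partial i (r *: phi j + psi j) - (r *: F i + G i) : L2 Omega)
    = r *: ((partial i (phi j) : L2 Omega) - F i) + ((partial i (psi j) : L2 Omega) - G i).
  have [/(_ 1%N i)[dphi _] _ _] := t1 j; have [/(_ 1%N i)[dpsi _] _ _] := t2 j.
  by rewrite partial_lin// scalerBr opprD addrACA.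
by apply: L2_nrm_lin => //; apply: L2_inB => //; exact: test_partial_L2.
Unshelve. all: end_near.
Qed.

Lemma H01_lin r (f g : H01 Omega) : inS f -> inS g -> inS (r *: f + g).
Proof.
move=> [hf [F fF]] [hg [G gG]]; split; first exact: L2_lin.
by exists (fun i => r *: F i + G i); exact: has_gradient_lin.
Qed.

Lemma H01_0 : inS (0 : H01 Omega).
Proof.
split; first exact: L2_0.
exists (fun _ => 0); split; first by move=> i; exact: L2_0.
have nrm0 : nrm (0 - 0 : L2 Omega) = 0.
  by rewrite subr0 -(fnorm0 (ip_elt_psd oO)) fnorm_ip elt_val0.
exists (fun _ => 0); split.
- by move=> _; exact: test_function0.
- by rewrite nrm0; exact: cvg_cst.
move=> i; rewrite (_ : partial i _ = 0) ?nrm0; first exact: cvg_cst.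
by apply/funext => x; rewrite /partial derive_cst.
Qed.

Lemma H01v_lin r (f g : H01v Omega) : inS f -> inS g -> inS (r *: f + g).
Proof.
move=> hf hg i.
have -> : (fun x => (r *: f + g) x 0 i) = r *: ((fun x => f x 0 i) : H01 Omega) + (fun x => g x 0 i).
  by apply/funext => x; rewrite /= !mxE.
exact: H01_lin.
Qed.

Lemma H01v_0 : inS (0 : H01v Omega).
Proof.
move=> i; have -> : (fun x => (0 : H01v Omega) x 0 i) = (0 : H01 Omega).
  by apply/funext => x; rewrite /= mxE.
exact: H01_0.
Qed.

End test_functions.

(** * From the norms of the function spaces to the seminorms of the forms *)

Section forms_on_elements.
Context {R : realType} (X : fun_space R) (X0 : inS (0 : X))
  (Xlin : forall r (x y : X), inS x -> inS y -> inS (r *: x + y))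
  (nrm_ge0 : forall x : X, 0 <= nrm x).

Definition elements : lsubspace X := @LSubspace R X (@inS R X) X0 Xlin.
Local Notation E := (elt elements).
Local Notation val := (@elt_val R X elements).
Local Notation mk := (@to_elt R X elements).

Definition elt_form (s : X -> X -> R) (x y : E) : R := s (val x) (val y).

Lemma elt_inS (x : E) : inS (val x).
Proof. exact: (elt_valP x). Qed.

Lemma mkK (x : X) : inS x -> val (mk x) = x.
Proof. exact: (@to_eltK R X elements). Qed.

Context (s : X -> X -> R) (c C : R) (c0 : 0 < c) (C0 : 0 < C)
  (ls : bilinear_on s) (cs : symmetric_on s) (bs : bounded_on s C)
  (es : elliptic_on s c).
Local Notation N := (fnorm (elt_form s)).

Lemma elt_form_psd : psd_form (elt_form s).
Proof.
split=> [r x x' y|x y|x]; rewrite /elt_form.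
- by rewrite elt_val_lin ls.1//; exact: elt_inS.
- by apply: cs; exact: elt_inS.
- by apply: le_trans (es (elt_inS x)); rewrite mulr_ge0 ?sqr_ge0// ltW.
Qed.

(** Together with [fnorm_le_nrm] this makes [nrm] equivalent to the seminorm of the form, in which
    all abstract estimates run. *)
Lemma nrm_le_fnorm x : nrm (val x) <= (Num.sqrt c)^-1 * N x.
Proof.
have sc : 0 < Num.sqrt c by rewrite sqrtr_gt0.
rewrite ler_pdivlMl// -(ler_pXn2r (n := 2)) ?nnegrE ?mulr_ge0 ?fnorm_ge0//.
  by rewrite exprMn (sqr_sqrtr (ltW c0)) (fnorm_sqr elt_form_psd) es//; exact: elt_inS.
Qed.

Lemma fnorm_le_nrm x : N x <= Num.sqrt C * nrm (val x).
Proof.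
rewrite -(ler_pXn2r (n := 2)) ?nnegrE ?mulr_ge0 ?fnorm_ge0// ?sqrtr_ge0//.
rewrite exprMn (sqr_sqrtr (ltW C0)) (fnorm_sqr elt_form_psd).
rewrite (le_trans (ler_norm _))// expr2 mulrA bs//; exact: elt_inS.
Qed.

(** Here [nrm] is any nonnegative function, so this comes from ellipticity. *)
Lemma nrm0 : nrm (0 : X) = 0.
Proof.
apply/eqP; rewrite eq_le nrm_ge0 andbT.
have := nrm_le_fnorm 0; rewrite fnorm0; last exact: elt_form_psd.
by rewrite mulr0 elt_val0.
Qed.

Lemma dual_bound (F : dual_space X) x : inS F ->
  `|F (val x)| <= (Num.sqrt c)^-1 * nrm F * N x.
Proof.
move=> [lF [B bF]]; set k := (Num.sqrt c)^-1.
have k0 : 0 < k by rewrite invr_gt0 sqrtr_gt0.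
have [x0|x0] := eqVneq (N x) 0.
  have n0 : nrm (val x) = 0.
    by apply/eqP; rewrite eq_le nrm_ge0 andbT (le_trans (nrm_le_fnorm x))// x0 mulr0.
  by have := bF _ (elt_inS x); rewrite n0 x0 !mulr0.
have xp : 0 < N x by rewrite lt0r x0 fnorm_ge0.
(* Scales [x] into the unit ball of [nrm], over which the dual norm is a supremum. *)
pose r := (k * N x)^-1; have r0 : 0 < r by rewrite invr_gt0 mulr_gt0.
have Fr : F (val (r *: x)) = r * F (val x).
  have F0 : F 0 = 0.
    have := bF _ X0; rewrite nrm0 mulr0 normr_le0 => /eqP.
    exact: id.
  rewrite -[r *: x]addr0 elt_val_lin elt_val0 lF//; last exact: elt_inS.
  by rewrite F0 addr0.
have rx1 : nrm (val (r *: x)) <= 1.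
  rewrite (le_trans (nrm_le_fnorm _))// fnormZ; last exact: elt_form_psd.
  rewrite gtr0_norm// /r -/k mulrCA mulVf//.
  by rewrite mulf_neq0 ?gt_eqF.
have : `|F (val (r *: x))| <= nrm F.
  apply: ub_le_sup; last by exists (val (r *: x)) => //; split => //; exact: elt_inS.
  exists `|B| => _ [y [yS y1] <-]; rewrite (le_trans (bF y yS))//.
  rewrite (le_trans (ler_wpM2r (nrm_ge0 y) (ler_norm B)))//.
  by rewrite -[leRHS]mulr1 ler_wpM2l.
rewrite Fr normrM gtr0_norm// /r ler_pdivrMl ?mulr_gt0// => /le_trans; apply.
by rewrite mulrAC.
Qed.

Lemma dual_lin (F : dual_space X) : inS F -> lin (fun x => F (val x)).
Proof.
by move=> [lF _] r x y; rewrite elt_val_lin lF//; exact: elt_inS.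
Qed.

Lemma dual_inS_lin r (F G : dual_space X) : inS F -> inS G -> inS (r *: F + G).
Proof.
move=> [lF [B bF]] [lG [B' bG]]; split.
  move=> t x y xS yS.
  have e z : (r *: F + G) z = r * F z + G z by [].
  by rewrite !e lF// lG//; ring.
exists (`|r| * B + B') => x xS.
have -> : (r *: F + G) x = r * F x + G x by [].
rewrite (le_trans (ler_normD _ _))// normrM mulrDl lerD ?bG// -mulrA ler_wpM2l ?bF//.
Qed.

Lemma time_deriv_eps T (u u' : R -> X) : time_deriv T u u' ->
  forall t, 0 <= t <= T -> forall e, 0 < e ->
  exists2 del, 0 < del & forall r, 0 <= r <= T -> `|r - t| < del -> r != t ->
    nrm ((r - t)^-1 *: (u r - u t) - u' t) <= e.
Proof.
move=> du t ht e e0; have tT : t \in `[0, T] by rewrite in_itv.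
have /cvgrPdist_le/(_ e e0) := du t tT.
rewrite near_withinE => -[del /= del0 h]; exists del => // r hr rt rnt.
have := h r; rewrite /= distrC => /(_ rt rnt).
by rewrite in_itv/= => /(_ hr); rewrite sub0r normrN; apply: le_trans; exact: ler_norm.
Qed.

Lemma inS_comb (r : R) (x y z : X) : inS x -> inS y -> inS z ->
  inS (r *: (x - y) - z).
Proof.
move=> xS yS zS; have zN : inS (- z) by rewrite -[- z]addr0 -scaleN1r; exact: Xlin.
by apply: Xlin => //; rewrite addrC -scaleN1r; exact: Xlin.
Qed.

Lemma time_deriv_vderiv T (u u' : R -> X) :
  (forall t, 0 <= t <= T -> inS (u t)) -> (forall t, 0 <= t <= T -> inS (u' t)) ->
  time_deriv T u u' -> vderiv (elt_form s) 0 T (mk \o u) (mk \o u').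
Proof.
move=> uS u'S du t ht e e0; have sC : 0 < Num.sqrt C by rewrite sqrtr_gt0.
have [del del0 h] := time_deriv_eps du ht (divr_gt0 e0 sC).
exists del => // r hr rt; have [->|rnt] := eqVneq r t.
  by rewrite !subrr scale0r subr0 normr0 mulr0 fnorm0//; exact: elt_form_psd.
have rt0 : r - t != 0 by rewrite subr_eq0.
have cS : inS ((r - t)^-1 *: (u r - u t) - u' t).
  by apply: inS_comb; [exact: uS|exact: uS|exact: u'S].
have -> : (mk \o u) r - (mk \o u) t - (r - t) *: (mk \o u') t
   = (r - t) *: mk ((r - t)^-1 *: (u r - u t) - u' t).
  apply: elt_val_inj.
  rewrite !(elt_valB, elt_valZ) /= (mkK cS) (mkK (uS _ hr)) (mkK (uS _ ht)).
  rewrite (mkK (u'S _ ht)).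
  by rewrite scalerBr scalerA divff// scale1r.
rewrite fnormZ; last exact: elt_form_psd.
rewrite mulrC ler_wpM2r// (le_trans (fnorm_le_nrm _))//.
by rewrite (mkK cS) -ler_pdivlMl// mulrC h.
Qed.

Lemma cont_vcont T (u : R -> X) : (forall t, 0 <= t <= T -> inS (u t)) ->
  (forall t, t \in `[0, T] ->
     nrm (u r - u t) @[r --> within `[0, T] (nbhs t)] --> (0 : R)) ->
  vcont (elt_form s) 0 T (mk \o u).
Proof.
move=> uS cu t ht e e0; have sC : 0 < Num.sqrt C by rewrite sqrtr_gt0.
have tT : t \in `[0, T] by rewrite in_itv.
have /cvgrPdist_le/(_ _ (divr_gt0 e0 sC)) := cu t tT.
rewrite near_withinE => -[del /= del0 h]; exists del => // r hr rt.
have := h r; rewrite /= distrC in_itv/= => /(_ rt hr).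
rewrite sub0r normrN => /(le_trans (ler_norm _)) {}h.
rewrite (le_trans (fnorm_le_nrm _))// -ler_pdivlMl// mulrC.
have -> // : val ((mk \o u) r - (mk \o u) t) = u r - u t.
by rewrite elt_valB /= (mkK (uS _ hr)) (mkK (uS _ ht)).
Qed.

Lemma dual_fderiv T (f f' : R -> dual_space X) :
  (forall t, 0 <= t <= T -> inS (f t)) -> (forall t, 0 <= t <= T -> inS (f' t)) ->
  (forall t, 0 <= t <= T -> forall e, 0 < e ->
    exists2 del, 0 < del & forall r, 0 <= r <= T -> `|r - t| < del -> r != t ->
    nrm ((r - t)^-1 *: (f r - f t) - f' t) <= e) ->
  fderiv (elt_form s) 0 T (fun t x => f t (val x)) (fun t x => f' t (val x)).
Proof.
move=> fS f'S df t ht e e0; have sc : 0 < Num.sqrt c by rewrite sqrtr_gt0.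
have [del del0 h] := df t ht _ (mulr_gt0 e0 sc).
exists del => // r hr rt x; have [->|rnt] := eqVneq r t.
  by rewrite !subrr mul0r subr0 normr0 mulr0 mul0r.
have rt0 : r - t != 0 by rewrite subr_eq0.
have GS : inS ((r - t)^-1 *: (f r - f t) - f' t).
  have opp (F : dual_space X) : inS F -> inS (- F).
    move=> FS; rewrite -[- F]addr0 -scaleN1r; apply: dual_inS_lin => //.
    split; first by move=> *; rewrite mulr0 addr0.
    by exists 0 => *; rewrite normr0 !mul0r.
  apply: dual_inS_lin; last by apply: opp; exact: f'S.
  rewrite addrC -scaleN1r; apply: dual_inS_lin; exact: fS.
have -> : f r (val x) - f t (val x) - (r - t) * f' t (val x) =
    (r - t) * ((r - t)^-1 *: (f r - f t) - f' t) (val x).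
  rewrite [X in _ = _ * X](_ : _ = (r - t)^-1 * (f r (val x) - f t (val x)) - f' t (val x))//.
  by field.
rewrite normrM [e * _]mulrC -mulrA ler_wpM2l// (le_trans (dual_bound _ GS))//.
rewrite ler_wpM2r ?fnorm_ge0// -ler_pdivlMl ?invr_gt0// invrK mulrC.
exact: h.
Qed.

Lemma dual_fcont T (f : R -> dual_space X) :
  (forall t, 0 <= t <= T -> inS (f t)) ->
  (forall t, t \in `[0, T] ->
     nrm (f r - f t) @[r --> within `[0, T] (nbhs t)] --> (0 : R)) ->
  fcont (elt_form s) 0 T (fun t x => f t (val x)).
Proof.
move=> fS cf t ht e e0; have sc : 0 < Num.sqrt c by rewrite sqrtr_gt0.
have tT : t \in `[0, T] by rewrite in_itv.
have /cvgrPdist_le/(_ _ (mulr_gt0 e0 sc)) := cf t tT.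
rewrite near_withinE => -[del /= del0 h]; exists del => // r hr rt x.
have := h r; rewrite /= distrC in_itv/= => /(_ rt hr).
rewrite sub0r normrN => /(le_trans (ler_norm _)) {}h.
have GS : inS (f r - f t).
  by rewrite addrC -scaleN1r; apply: dual_inS_lin; exact: fS.
have := dual_bound x GS; rewrite [X in `|X|](_ : _ = f r (val x) - f t (val x))//.
move=> /le_trans; apply; rewrite ler_wpM2r ?fnorm_ge0//.
by rewrite -ler_pdivlMl ?invr_gt0// invrK mulrC.
Qed.

End forms_on_elements.

Lemma class_C_derivs (R : realType) (X : fun_space R) (T : R) k (u : R -> X) :
  class_C T k u -> exists us : nat -> R -> X, [/\ us 0%N = u,
    forall j t, (j <= k)%N -> 0 <= t <= T -> inS (us j t),
    forall j, (j < k)%N -> time_deriv T (us j) (us j.+1) &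
    forall t, t \in `[0, T] ->
      nrm (us k r - us k t) @[r --> within `[0, T] (nbhs t)] --> (0 : R)].
Proof.
elim: k u => [|k ih] u /= [uS].
  move=> cu; exists (fun _ => u); split=> // j t _ ht.
  by apply: uS; rewrite in_itv.
move=> [u' [du /ih[us [us0 usS dus cus]]]].
exists (fun j => if j is j'.+1 then us j' else u); split=> //.
  by move=> [|j] t jk ht; [apply: uS; rewrite in_itv|exact: usS].
by move=> [|j] jk; [rewrite us0|exact: dus].
Qed.

(** The open interval between [t] and a nearby point has positive measure, so a null set cannot
    contain it. *)
Lemma ae_dense (R : realType) (T : R) (P : R -> Prop) : 0 < T ->
  {ae @lebesgue_measure R, forall t, t \in `[0, T] -> P t} ->
  forall t, 0 <= t <= T -> forall del, 0 < del ->
  exists2 s, 0 <= s <= T & `|s - t| < del /\ P s.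
Proof.
move=> T0 [A [mA A0 sub]] t ht del del0.
have [r hr [rnt rt]] := near_point T0 ht del0.
pose x := Num.min r t; pose y := Num.max r t.
have xy : x < y by rewrite /x /y; case: (ltgtP r t) rnt.
apply: contrapT => no.
have subA : `]x, y[%classic `<=` A.
  move=> s; rewrite /= in_itv/= => /andP[xs sy]; apply: sub => /= h.
  have hs : 0 <= s <= T.
    move: xs sy; rewrite /x /y gt_min lt_max => /orP xs /orP sy.
    by case: xs; case: sy; lra.
  apply: no; exists s => //; split; last by apply: h; rewrite in_itv.
  have : `|s - t| <= `|r - t|.
    move: xs sy; rewrite /x /y gt_min lt_max.
    by have [h1|h1] := lerP r t; rewrite ?(ler0_norm (x := r - t)) ?(gtr0_norm (x := r - t)) ?subr_le0 ?subr_gt0// ler_norml => /orP[] ? /orP[] ?; lra.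
  by move=> /le_lt_trans; apply.
have : (@lebesgue_measure R `]x, y[%classic <= @lebesgue_measure R A)%E.
  by apply: le_measure; rewrite ?inE//; exact: measurable_itv.
by rewrite A0 lebesgue_measure_itv/= lte_fin xy -EFinB lee_fin leNgt subr_gt0 xy.
Qed.

(** The derivatives in [is_solution] and those from [class_C] are separate witnesses. They agree up
    to the kernel of the seminorm, which bounded forms do not see. *)
Lemma vderiv_unique (R : realType) (X : lmodType R) (s : X -> X -> R)
    (hs : psd_form s) (T : R) x x' x'' : 0 < T ->
  vderiv s 0 T x x' -> vderiv s 0 T x x'' ->
  forall t, 0 <= t <= T -> fnorm s (x' t - x'' t) = 0.
Proof.
move=> T0 d1 d2 t ht; apply/eqP; rewrite eq_le fnorm_ge0 andbT.
apply: (@le_of_eps _ _ _ 2) => e e0 _; rewrite add0r.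
have [a a0 h1] := d1 t ht e e0; have [b b0 h2] := d2 t ht e e0.
have ab0 : 0 < Num.min a b by rewrite lt_min a0.
have [r hr [rnt]] := near_point T0 ht ab0.
rewrite lt_min => /andP[ra rb].
have {}h1 := h1 r hr ra; have {}h2 := h2 r hr rb.
have rt0 : 0 < `|r - t| by rewrite normr_gt0 subr_eq0.
rewrite -(ler_pM2l rt0) -(fnormZ hs).
have -> : (r - t) *: (x' t - x'' t) = (x r - x t - (r - t) *: x'' t)
    - (x r - x t - (r - t) *: x' t).
  by rewrite scalerBr opprB [RHS]addrC addrA subrK.
rewrite (le_trans (fnormB hs _ _))//; lra.
Qed.

Lemma class_C_dual (R : realType) (X : fun_space R) (X0 : inS (0 : X))
    (Xlin : forall r (x y : X), inS x -> inS y -> inS (r *: x + y))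
    (nrm_ge0 : forall x : X, 0 <= nrm x) (s : X -> X -> R) (c T : R) k
    (f : R -> dual_space X) :
  0 < c -> bilinear_on s -> symmetric_on s -> elliptic_on s c ->
  class_C T k f ->
  exists fs : nat -> R -> elt (elements X0 Xlin) -> R,
  [/\ forall t x, fs 0 t x = f t (elt_val x),
      forall j, (j < k)%N -> fderiv (elt_form s) 0 T (fs j) (fs j.+1),
      fcont (elt_form s) 0 T (fs k) &
      forall j t, (j <= k)%N -> 0 <= t <= T ->
        lin (fs j t) /\ exists C, fbounded (elt_form s) (fs j t) C].
Proof.
move=> c0 ls cs es /class_C_derivs[fs [fs0 fsS dfs cfs]].
exists (fun j t x => fs j t (elt_val x)); split.
- by rewrite fs0.
- move=> j jk; apply: (dual_fderiv X0 Xlin nrm_ge0 c0 ls cs es).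
  + by move=> t; apply: fsS; exact: ltnW.
  + by move=> t; exact: fsS.
  exact: time_deriv_eps (dfs j jk).
- by apply: (dual_fcont X0 Xlin nrm_ge0 c0 ls cs es) => // t; exact: fsS.
move=> j t jk ht; split; first exact: dual_lin (fsS j t jk ht).
by eexists => x; exact: (dual_bound nrm_ge0 c0 ls cs es _ (fsS j t jk ht)).
Qed.

Lemma class_C_elt (R : realType) (X : fun_space R) (X0 : inS (0 : X))
    (Xlin : forall r (x y : X), inS x -> inS y -> inS (r *: x + y))
    (nrm_ge0 : forall x : X, 0 <= nrm x) (s : X -> X -> R) (c C T : R) k
    (u : R -> X) :
  0 < c -> 0 < C -> bilinear_on s -> symmetric_on s -> bounded_on s C ->
  elliptic_on s c -> class_C T k u ->
  exists us : nat -> R -> elt (elements X0 Xlin),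
  [/\ forall t, 0 <= t <= T -> elt_val (us 0%N t) = u t,
      forall j, (j < k)%N -> vderiv (elt_form s) 0 T (us j) (us j.+1),
      vcont (elt_form s) 0 T (us k) &
      us 0%N = to_elt (elements X0 Xlin) \o u].
Proof.
move=> c0 C0 ls cs bs es /class_C_derivs[us [us0 usS dus cus]].
exists (fun j => to_elt (elements X0 Xlin) \o us j); split.
- by move=> t ht; rewrite /= mkK ?us0// -us0; exact: usS.
- move=> j jk; apply: (time_deriv_vderiv X0 Xlin nrm_ge0 c0 C0 ls cs bs es _ _ (dus j jk)).
  + by move=> t; apply: usS; exact: ltnW.
  + by move=> t; exact: usS.
- by apply: (cont_vcont X0 Xlin nrm_ge0 c0 C0 ls cs bs es _ cus) => t; exact: usS.
by rewrite us0.
Qed.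

(** * Transfer of the abstract bound to the iterated scheme *)

Theorem theorem3p2 (R : realType) (m : nat) (hm : m = 2%N \/ m = 3%N)
    (Omega : set 'rV[R]_m) (hOmega : bounded_lipschitz_domain Omega)
    (T : R) (hT : 0 < T)
    (a : H01v Omega -> H01v Omega -> R) (b : H01 Omega -> H01 Omega -> R)
    (c : L2 Omega -> L2 Omega -> R) (d : H01v Omega -> L2 Omega -> R)
    (ca cb cc Ca Cb Cc Cd : R)
    (hca : 0 < ca) (hcb : 0 < cb) (hcc : 0 < cc)
    (hCa : 0 < Ca) (hCb : 0 < Cb) (hCc : 0 < Cc) (hCd : 0 < Cd)
    (ha : [/\ bilinear_on a, symmetric_on a, bounded_on a Ca &
              elliptic_on a ca])
    (hb : [/\ bilinear_on b, symmetric_on b, bounded_on b Cb &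
              elliptic_on b cb])
    (hc : [/\ bilinear_on c, symmetric_on c, bounded_on c Cc &
              elliptic_on c cc])
    (hd : bilinear_on d /\ bounded_on d Cd)
    (k : nat) (hk : (1 <= k <= 5)%N) (L : R) (hL : 0 < L)
    (f : R -> dual_space (H01v Omega)) (g : R -> dual_space (H01 Omega))
    (hf : class_C T k.+1 f) (hg : class_C T k.+1 g)
    (u : R -> H01v Omega) (p : R -> L2 Omega)
    (hu : class_C T k u) (hp : class_C T k p)
    (hsol : is_solution a b c d f g T u p) :
  exists Ct C : R, [/\ 0 < Ct, 0 < C &
    forall (tau TOL : R) (u0 : nat -> H01v Omega) (p0 : nat -> L2 Omega)
      (J : nat -> nat) (un : nat -> nat -> H01v Omega)
      (pn : nat -> nat -> L2 Omega) (n : nat),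
    0 < tau -> 0 < TOL ->
    (forall l, (l < k)%N -> [/\ inS (u0 l), inS (p0 l) &
       elliptic_equation a d f (l%:R * tau) (u0 l) (p0 l)]) ->
    (k <= n)%N -> n%:R * tau <= T ->
    decoupled_bdf a b c d f g k L tau TOL ca cb cc u0 p0 J un pn n ->
    nrm (un n (J n) - u (n%:R * tau)) ^+ 2
      + nrm (pn n (J n) - p (n%:R * tau)) ^+ 2
    <= Ct * expR (C * (n%:R * tau)) *
       (TOL ^+ 2 / tau ^+ 3 + tau ^+ (2 * k)
        + \sum_(l < k) nrm (p0 l - p (l%:R * tau)) ^+ 2)].
Proof.
have [_ oO _ bO _] := hOmega.
have [la sa ba ea] := ha; have [lb sb bb eb] := hb; have [lc sc bc ec] := hc.
have [ld bd] := hd.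
have V0 : inS (0 : H01v Omega) by exact: H01v_0.
have Vl := H01v_lin oO bO.
have Q0 : inS (0 : H01 Omega) by exact: H01_0.
have Ql := H01_lin oO bO.
have H0 : inS (0 : L2 Omega) by exact: L2_0.
have Hl := L2_lin oO.
have nV (x : H01v Omega) : 0 <= nrm x by exact: sqrtr_ge0.
have nQ (x : H01 Omega) : 0 <= nrm x by exact: sqrtr_ge0.
have nH (x : L2 Omega) : 0 <= nrm x by exact: sqrtr_ge0.
pose EV := elements V0 Vl; pose EQ := elements Q0 Ql; pose EH := elements H0 Hl.
have pa := elt_form_psd V0 Vl hca la sa ea.
have pb := elt_form_psd Q0 Ql hcb lb sb eb.
have pc := elt_form_psd H0 Hl hcc lc sc ec.
have [fs [fs0 dfs cfs lfs]] := class_C_dual V0 Vl nV hca la sa ea hf.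
have [gs [gs0 dgs cgs lgs]] := class_C_dual Q0 Ql nQ hcb lb sb eb hg.
have [us [us0 dus cus usE]] := class_C_elt V0 Vl nV hca hCa la sa ba ea hu.
have [ps [ps0 dps cps psE]] := class_C_elt H0 Hl nH hcc hCc lc sc bc ec hp.
have k0 : (0 < k)%N by case/andP: hk.
pose io (q : elt EQ) : elt EH := to_elt EH (elt_val q : L2 Omega).
have ioE q : elt_val (io q) = elt_val q :> ('rV[R]_m -> R).
  exact: mkK (elt_inS q).1.
have lio r x y : io (r *: x + y) = r *: io x + io y.
  by apply: elt_val_inj; rewrite elt_val_lin !ioE elt_val_lin.
pose dE (x : elt EV) (y : elt EH) := d (elt_val x) (elt_val y).
have ld1 y : lin (dE ^~ y).
  by move=> r x x'; rewrite /dE elt_val_lin ld.1//; exact: elt_inS.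
have ld2 x : lin (dE x).
  by move=> r y y'; rewrite /dE elt_val_lin ld.2//; exact: elt_inS.
have nle_a := nrm_le_fnorm (X0 := V0) (Xlin := Vl) nV hca la sa ea.
have nle_b := nrm_le_fnorm (X0 := Q0) (Xlin := Ql) nQ hcb lb sb eb.
have nle_c := nrm_le_fnorm (X0 := H0) (Xlin := Hl) nH hcc lc sc ec.
pose ka := (Num.sqrt ca)^-1; pose kb := (Num.sqrt cb)^-1; pose kc := (Num.sqrt cc)^-1.
have ka0 : 0 < ka by rewrite invr_gt0 sqrtr_gt0.
have kb0 : 0 < kb by rewrite invr_gt0 sqrtr_gt0.
have kc0 : 0 < kc by rewrite invr_gt0 sqrtr_gt0.
have nHQ (q : H01 Omega) : nrm (q : L2 Omega) <= nrm q.
  rewrite -[leLHS]ger0_norm// -sqrtr_sqr ler_wsqrtr// lerDl.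
  by apply: sumr_ge0 => i _; exact: sqr_ge0.
have nQb (q : elt EQ) : nrm (elt_val q : L2 Omega) <= kb * fnorm (elt_form b) q.
  exact: le_trans (nHQ _) (nle_b q).
have bio q : fnorm (elt_form c) (io q) <= Num.sqrt Cc * kb * fnorm (elt_form b) q.
  rewrite (le_trans (fnorm_le_nrm nH hcc hCc lc sc bc ec _))// -mulrA ler_wpM2l ?sqrtr_ge0//.
  by rewrite ioE; exact: nQb.
have bdE x y : `|dE x y| <= Cd * ka * kc * fnorm (elt_form a) x * fnorm (elt_form c) y.
  rewrite (le_trans (bd _ _ (elt_inS x) (elt_inS y)))//.
  have -> : Cd * ka * kc * fnorm (elt_form a) x * fnorm (elt_form c) y =
    Cd * (ka * fnorm (elt_form a) x) * (kc * fnorm (elt_form c) y) by ring.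
  by rewrite ler_pM ?mulr_ge0 ?(ltW hCd)// ler_wpM2l ?(ltW hCd)//.
have K0 : 0 <= Num.sqrt Cc * kb by rewrite mulr_ge0 ?sqrtr_ge0 ?(ltW kb0).
have Cd0 : 0 <= Cd * ka * kc by rewrite !mulr_ge0 ?(ltW hCd) ?(ltW ka0) ?(ltW kc0).
have uS t : 0 <= t <= T -> inS (u t).
  by move=> ht; rewrite -us0//; exact: elt_inS.
have pS t : 0 <= t <= T -> inS (p t).
  by move=> ht; rewrite -ps0//; exact: elt_inS.
have sol t : 0 <= t <= T -> forall del, 0 < del ->
    exists2 s, 0 <= s <= T & [/\ `|s - t| < del,
      forall v, elt_form a (us 0%N s) v - dE v (ps 0%N s) = fs 0%N s v &
      exists2 y, io y = ps 0%N s & forall q,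
        dE (us 1%N s) (io q) + elt_form c (ps 1%N s) (io q) + elt_form b y q = gs 0%N s q].
  move=> ht del del0.
  have [du [dp [dS tdu tdp _ ae]]] := hsol.
  have [s hs [st [pQ ell par]]] := ae_dense hT ae ht del0.
  exists s => //; split => //.
    move=> v; rewrite fs0 -(ell (elt_val v) (elt_inS v)) /dE /elt_form.
    by rewrite us0// ps0.
  exists (to_elt EQ (p s)).
    by apply: elt_val_inj; rewrite ioE (mkK Q0 Ql pQ) ps0.
  move=> q; rewrite gs0 -(par _ (elt_inS q)).
  have dS' r : 0 <= r <= T -> inS (du r) /\ inS (dp r).
    by move=> hr; apply: dS; rewrite in_itv.
  have vdu : vderiv (elt_form a) 0 T (us 0%N) (to_elt EV \o du).
    rewrite usE; apply: (time_deriv_vderiv V0 Vl nV hca hCa la sa ba ea uS _ tdu).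
    by move=> r /dS'[].
  have vdp : vderiv (elt_form c) 0 T (ps 0%N) (to_elt EH \o dp).
    rewrite psE; apply: (time_deriv_vderiv H0 Hl nH hcc hCc lc sc bc ec pS _ tdp).
    by move=> r /dS'[].
  have eu := vderiv_unique pa hT (dus 0%N k0) vdu hs.
  have ep := vderiv_unique pc hT (dps 0%N k0) vdp hs.
  have -> : dE (us 1%N s) (io q) = d (du s) (elt_val q : L2 Omega).
    have := bdE (us 1%N s - (to_elt EV \o du) s) (io q).
    rewrite eu mulr0 mul0r normr_le0 (linB (ld1 _)) subr_eq0 => /eqP ->.
    by rewrite /dE /= (mkK V0 Vl (dS' s hs).1) ioE.
  have -> : elt_form c (ps 1%N s) (io q) = c (dp s) (elt_val q : L2 Omega).
    have := psd_CS pc (ps 1%N s - (to_elt EH \o dp) s) (io q).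
    rewrite ep mul0r normr_le0 (linB (psd_linl pc _)) subr_eq0 => /eqP ->.
    by rewrite /elt_form /= (mkK H0 Hl (dS' s hs).2) ioE.
  by rewrite /elt_form (mkK Q0 Ql pQ).
have lip : bilinear_on (ip Omega : L2 Omega -> L2 Omega -> R).
  split=> [t x x' y|t x y y'] xS yS zS; first exact: ip_lin.
  by rewrite !(ipC Omega x) ip_lin.
have eip : elliptic_on (ip Omega : L2 Omega -> L2 Omega -> R) 1.
  by move=> x _; rewrite mul1r sqr_sqrtr// ip_ge0.
have pip := elt_form_psd H0 Hl ltr01 lip (fun x y _ _ => ipC Omega x y) eip.
have [C C0 main] := scheme_error pa pc pb lio K0 bio ld1 ld2 Cd0 bdE hT k0
  dus cus dps cps dfs cfs lfs dgs lgs sol hk.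
have [xi0 xi0E] : {x | bdf_coef R k 0 = x} by exists (bdf_coef R k 0).
have xi0_gt0 : 0 < xi0 by rewrite -xi0E; exact: bdf_coef0_gt0.
(* From the summand with weight [ca / 2] in the stopping test; [kc] plays the same part for the
   summand with weight [cc]. *)
pose al := Num.sqrt (2 / ca).
have al0 : 0 <= al by exact: sqrtr_ge0.
have al2 : al ^+ 2 = 2 / ca by rewrite sqr_sqrtr// divr_ge0// ltW.
(* Size of the residual left by stopping: [d] and the stabilization act on the last increments,
   [xi0] stems from the BDF quotient, and [kb] bounds the [L2] norm of the test function by its
   b-norm. *)
pose Cm := xi0 * (Cd * al + L * kc) * kb.
have Cm0 : 0 <= Cm.
  rewrite !mulr_ge0 ?(ltW xi0_gt0) ?(ltW kb0)// addr_ge0// mulr_ge0//; exact: ltW.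
pose K1 := ca^-1 + cc^-1.
have K10 : 0 < K1 by rewrite addr_gt0 ?invr_gt0.
(* [K1] returns from the energies to the norms, and [Cc] bounds the energy of the starting errors.
   Any positive rate is valid in the exponential, which is at least 1. *)
exists (K1 * C * (Cm ^+ 2 * T + 1 + Cc)), 1; split => //.
  apply: mulr_gt0; first exact: mulr_gt0.
  rewrite ltr_wpDl// addr_ge0// mulr_ge0 ?sqr_ge0//; exact: ltW.
move=> tau TOL u0 p0 J un pn n tau0 TOL0 init kn nT [hinit hrun].
have nle_T l : (l <= n)%N -> 0 <= l%:R * tau <= T.
  move=> ln; rewrite mulr_ge0 ?(ltW tau0)//= (le_trans _ nT)//.
  by rewrite ler_wpM2r ?(ltW tau0)// ler_nat.
have it l : (l <= n)%N -> [/\ inS (un l (J l)), inS (pn l (J l) : L2 Omega) &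
    elliptic_equation a d f (l%:R * tau) (un l (J l)) (pn l (J l))].
  move=> ln; have [lk|kl] := ltnP l k.
    by have [-> ->] := hinit l lk; have [] := init l lk.
  have [|[_ _ h] [J0 _ _]] := hrun l; first by rewrite kl.
  by have [h1 h2 h3 _] := h (J l) J0; split=> //; exact: h2.1.
pose U l := to_elt EV (un l (J l)); pose P l := to_elt EH (pn l (J l)).
pose Y l := to_elt EQ (pn l (J l)).
have UE l : (l <= n)%N -> elt_val (U l) = un l (J l).
  by move=> /it[h _ _]; exact: mkK.
have PE l : (l <= n)%N -> elt_val (P l) = pn l (J l).
  by move=> /it[_ h _]; exact: mkK.
have ell l v : (l <= n)%N -> elt_form a (U l) v - dE v (P l) = fs 0%N (l%:R * tau) v.
  move=> ln; have [_ _ h] := it l ln.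
  by rewrite fs0 -(h _ (elt_inS v)) /elt_form /dE UE// PE.
pose M := Cm * (TOL / tau).
have M0 : 0 <= M by rewrite mulr_ge0// divr_ge0// ltW.
(* What is left when the lagged iterate is replaced by the final one. Between inner iterations only
   the newest value changes, and it has the coefficient [xi0 / tau]. *)
pose r l (q : elt EQ) := xi0 / tau *
  (d (un l (J l) - un l (J l).-1) (elt_val q : L2 Omega)
   - L * ip Omega (pn l (J l) - pn l (J l).-1) (elt_val q)).
have scheme l : (k <= l <= n)%N -> io (Y l) = P l /\
    fbounded (elt_form b) (r l) M /\
    forall q,
      dE (tau^-1 *: \sum_(i < k.+1) bdf_coef R k i *: U (l - i)%N) (io q)
      + elt_form c (tau^-1 *: \sum_(i < k.+1) bdf_coef R k i *: P (l - i)%N) (io q)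
      + elt_form b (Y l) q = gs 0%N (l%:R * tau) q + r l q.
  move=> hl; have [kl ln] := andP hl.
  have [[uS0 pS0 hit] [J0 [dpQ hstop] _]] := hrun l hl.
  have [uJ pJ _ par] := hit (J l) J0.
  (* For [J l = 1] the previous iterate is the initial guess, whose [p] is known only to lie in
     [L2]. *)
  have [uJ1 pJ1] : inS (un l (J l).-1) /\ inS (pn l (J l).-1 : L2 Omega).
    case: (J l) J0 => [//|[|j]] _ //=.
    by have [h1 h2 _ _] := hit j.+1 isT; split => //; exact: h2.1.
  have duS : inS (un l (J l) - un l (J l).-1).
    by rewrite addrC -scaleN1r; exact: (Vl _ _ _ uJ1 uJ).
  have dpS : inS (pn l (J l) - pn l (J l).-1 : L2 Omega) by exact: dpQ.1.
  pose dp := to_elt EH (pn l (J l) - pn l (J l).-1 : L2 Omega).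
  have dpE q : ip Omega (pn l (J l) - pn l (J l).-1) (elt_val q) =
      elt_form (ip Omega : L2 Omega -> L2 Omega -> R) dp (io q).
    by rewrite /elt_form ioE /dp (mkK H0 Hl dpS).
  have TOL_ge0 := ltW TOL0; have TOL2 : 0 <= TOL ^+ 2 by exact: sqr_ge0.
  (* All summands of the stopping test are nonnegative, so each increment is bounded separately. *)
  have [stop_u stop_p] : nrm (un l (J l) - un l (J l).-1) <= al * TOL /\
      nrm (pn l (J l) - pn l (J l).-1 : L2 Omega) <= kc * TOL.
    set x := nrm (un l _ - _) in hstop *; set y := nrm (pn l _ - _ : L2 Omega) in hstop *.
    have t3 : 0 <= tau / bdf_coef R k 0 * cb * nrm (pn l (J l) - pn l (J l).-1 : H01 Omega) ^+ 2.
      by rewrite xi0E mulr_ge0 ?sqr_ge0// mulr_ge0 ?(ltW hcb)// divr_ge0 ?(ltW xi0_gt0)// ltW.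
    have t2 : 0 <= L / 2 * y ^+ 2 by rewrite mulr_ge0 ?sqr_ge0// divr_ge0// ltW.
    have t1 : 0 <= ca / 2 * x ^+ 2 by rewrite mulr_ge0 ?sqr_ge0// divr_ge0// ltW.
    have t4 : 0 <= cc * y ^+ 2 by rewrite mulr_ge0 ?sqr_ge0// ltW.
    have hsum : ca / 2 * x ^+ 2 + (cc * y ^+ 2 + L / 2 * y ^+ 2) <= TOL ^+ 2.
      rewrite -mulrDl; apply: le_trans hstop; rewrite lerDl; exact: t3.
    split.
      rewrite -(ler_pXn2r (n := 2)) ?nnegrE ?mulr_ge0// ?nV// exprMn al2.
      rewrite -(ler_pM2l (divr_gt0 hca (ltr0n R 2))).
      have -> : ca / 2 * (2 / ca * TOL ^+ 2) = TOL ^+ 2 by field; rewrite gt_eqF.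
      by move: hsum t2 t4; move=> *; lra.
    rewrite -(ler_pXn2r (n := 2)) ?nnegrE ?mulr_ge0 ?(ltW kc0)// ?nH// exprMn exprVn.
    rewrite (sqr_sqrtr (ltW hcc)) ler_pdivlMl//.
    by move: hsum t2 t1; move=> *; lra.
  split; first by apply: elt_val_inj; rewrite ioE (mkK Q0 Ql pJ) PE.
  split.
    move=> q; rewrite /r dpE normrM (gtr0_norm (divr_gt0 xi0_gt0 tau0)).
    have b1 := bd _ _ duS (elt_inS q).1.
    have b2 := psd_CS pip dp (io q).
    have e1 : fnorm (elt_form (ip Omega : L2 Omega -> L2 Omega -> R)) dp = nrm (pn l (J l) - pn l (J l).-1 : L2 Omega).
      by rewrite /fnorm /elt_form /dp (mkK H0 Hl dpS).
    have e2 : fnorm (elt_form (ip Omega : L2 Omega -> L2 Omega -> R)) (io q) = nrm (elt_val q : L2 Omega).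
      by rewrite /fnorm /elt_form ioE.
    rewrite e1 e2 in b2.
    have nq := nQb q; have nq0 := nH (elt_val q : L2 Omega).
    have -> : M * fnorm (elt_form b) q = xi0 / tau *
       (Cd * (al * TOL) * (kb * fnorm (elt_form b) q) + L * ((kc * TOL) * (kb * fnorm (elt_form b) q))).
      by rewrite /M /Cm; field; rewrite gt_eqF.
    rewrite ler_wpM2l ?divr_ge0 ?(ltW xi0_gt0) ?(ltW tau0)//.
    rewrite (le_trans (ler_normB _ _))// lerD//.
      rewrite (le_trans b1)// ler_pM// ?mulr_ge0 ?(ltW hCd) ?nV//.
      by rewrite ler_wpM2l// ltW.
    rewrite normrM (gtr0_norm hL) ler_wpM2l ?(ltW hL)// (le_trans b2)//.
    by rewrite ler_pM.
  move=> q; have qS := elt_inS q.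
  have il (i : 'I_k.+1) : (l - i <= n)%N by rewrite (leq_trans (leq_subr _ _)).
  have QU : elt_val (tau^-1 *: \sum_(i < k.+1) bdf_coef R k i *: U (l - i)%N)
      = bdf_quot k tau J un l (J l).
    rewrite elt_valZ elt_val_sum /bdf_quot; congr (_ *: _).
    rewrite big_ord_recl elt_valZ subn0 UE// big_add1 big_mkord; congr (_ + _).
    by apply: eq_bigr => i _; rewrite elt_valZ UE// lift0.
  have QP : elt_val (tau^-1 *: \sum_(i < k.+1) bdf_coef R k i *: P (l - i)%N)
      = bdf_quot k tau (X := L2 Omega) J pn l (J l).
    rewrite elt_valZ elt_val_sum /bdf_quot; congr (_ *: _).
    rewrite big_ord_recl elt_valZ subn0 PE// big_add1 big_mkord; congr (_ + _).
    by apply: eq_bigr => i _; rewrite elt_valZ PE// lift0.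
  have quot_incr (X : fun_space R) (y : nat -> nat -> X) :
      bdf_quot k tau J y l (J l) =
      (xi0 / tau) *: (y l (J l) - y l (J l).-1) + bdf_quot k tau J y l (J l).-1.
    rewrite /bdf_quot xi0E scalerBr !scalerDr !scalerA [tau^-1 * xi0]mulrC.
    by rewrite addrA subrK.
  have QU1 : inS (bdf_quot k tau J un l (J l).-1).
    have -> : bdf_quot k tau J un l (J l).-1 =
        - (xi0 / tau) *: (un l (J l) - un l (J l).-1) + bdf_quot k tau J un l (J l).
      by rewrite (quot_incr _ un) scaleNr addKr.
    apply: (Vl _ _ _ duS); rewrite -QU; exact: elt_inS.
  have dincr : d (bdf_quot k tau J un l (J l)) (elt_val q : L2 Omega) =
      xi0 / tau * d (un l (J l) - un l (J l).-1) (elt_val q : L2 Omega)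
      + d (bdf_quot k tau J un l (J l).-1) (elt_val q : L2 Omega).
    by rewrite quot_incr ld.1//; exact: qS.1.
  have := par _ qS.
  rewrite [X in ip _ X _](_ : _ = (xi0 / tau) *: (pn l (J l) - pn l (J l).-1 : L2 Omega)); last first.
    by rewrite (quot_incr (L2 Omega) pn) addrK.
  have -> : ip Omega ((xi0 / tau) *: (pn l (J l) - pn l (J l).-1 : L2 Omega)) (elt_val q)
      = xi0 / tau * ip Omega (pn l (J l) - pn l (J l).-1) (elt_val q).
    by rewrite dpE -(psdZl pip) /elt_form elt_valZ /dp (mkK H0 Hl dpS) ioE.
  rewrite gs0 => <-.
  rewrite /dE /elt_form QU QP ioE dincr /r (mkK Q0 Ql pJ).
  by ring.
have {}main := main tau M n U P Y r tau0 M0 kn nT ell scheme.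
have tn := nle_T n (leqnn n).
have valU : elt_val (U n - us 0%N (n%:R * tau)) = un n (J n) - u (n%:R * tau).
  by rewrite elt_valB UE// us0.
have valP : elt_val (P n - ps 0%N (n%:R * tau)) = pn n (J n) - p (n%:R * tau) :> L2 Omega.
  by rewrite elt_valB PE// ps0.
have bu : nrm (un n (J n) - u (n%:R * tau)) ^+ 2 <= ca^-1 *
    elt_form a (U n - us 0%N (n%:R * tau)) (U n - us 0%N (n%:R * tau)).
  by rewrite ler_pdivlMl// -valU; apply: ea; exact: elt_inS.
have bp : nrm (pn n (J n) - p (n%:R * tau) : L2 Omega) ^+ 2 <= cc^-1 *
    elt_form c (P n - ps 0%N (n%:R * tau)) (P n - ps 0%N (n%:R * tau)).
  by rewrite ler_pdivlMl// -valP; apply: ec; exact: elt_inS.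
set a2 := elt_form a _ _ in main bu; set c2 := elt_form c _ _ in main bp.
have a20 : 0 <= a2 by exact: (psd_ge0 pa).
have c20 : 0 <= c2 by exact: (psd_ge0 pc).
set S := \sum_(l < k) nrm _ ^+ 2.
have S0 : 0 <= S by apply: sumr_ge0 => i _; exact: sqr_ge0.
have bS : \sum_(l < k) elt_form c (P l - ps 0%N (l%:R * tau)) (P l - ps 0%N (l%:R * tau))
    <= Cc * S.
  rewrite mulr_sumr; apply: ler_sum => l _.
  have lk := ltn_ord l; have ln : (l <= n)%N by rewrite (leq_trans (ltnW lk)).
  have vl : elt_val (P l - ps 0%N (l%:R * tau)) = p0 l - p (l%:R * tau) :> L2 Omega.
    by rewrite elt_valB PE// ps0 ?nle_T//; have [_ ->] := hinit l lk.
  have := bc _ _ (elt_inS (P l - ps 0%N (l%:R * tau))) (elt_inS (P l - ps 0%N (l%:R * tau))).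
  rewrite -mulrA -expr2 => /(le_trans (ler_norm _)) h.
  by rewrite -vl; exact: h.
have tauT : tau <= T.
  rewrite (le_trans _ nT)// -[leLHS]mul1r ler_wpM2r ?(ltW tau0)//.
  by rewrite ler1n (leq_trans k0).
have bM : M ^+ 2 <= Cm ^+ 2 * T * (TOL ^+ 2 / tau ^+ 3).
  have -> : M ^+ 2 = Cm ^+ 2 * tau * (TOL ^+ 2 / tau ^+ 3).
    by rewrite /M; field; rewrite gt_eqF.
  rewrite ler_wpM2r ?divr_ge0 ?sqr_ge0 ?exprn_ge0 ?(ltW tau0)//.
  by rewrite ler_wpM2l ?sqr_ge0.
set Z := TOL ^+ 2 / tau ^+ 3 in bM *.
have Z0 : 0 <= Z by rewrite divr_ge0 ?sqr_ge0// exprn_ge0// ltW.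
set W := tau ^+ (2 * k) in main *.
have W0 : 0 <= W by rewrite exprn_ge0// ltW.
have exp1 : 1 <= expR (1 * (n%:R * tau)).
  have := expR_ge1Dx (1 * (n%:R * tau)); have /andP[tn0 _] := tn.
  by rewrite mul1r => h; lra.
have CT0 : 0 <= Cm ^+ 2 * T by rewrite mulr_ge0 ?sqr_ge0// ltW.
have le1 : M ^+ 2 + W + \sum_(l < k) elt_form c (P l - ps 0%N (l%:R * tau)) (P l - ps 0%N (l%:R * tau))
    <= (Cm ^+ 2 * T + 1 + Cc) * (Z + W + S).
  have p1 := mulr_ge0 CT0 W0; have p2 := mulr_ge0 CT0 S0.
  have p3 := mulr_ge0 (ltW hCc) Z0; have p4 := mulr_ge0 (ltW hCc) W0.
  by move: bM bS; move: p1 p2 p3 p4 Z0 W0 S0; move=> *; lra.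
have le2 : nrm (un n (J n) - u (n%:R * tau)) ^+ 2
    + nrm (pn n (J n) - p (n%:R * tau) : L2 Omega) ^+ 2 <= K1 * (a2 + c2).
  rewrite (le_trans (lerD bu bp))// /K1.
  have ca1 : 0 <= ca^-1 by rewrite invr_ge0 ltW.
  have cc1 : 0 <= cc^-1 by rewrite invr_ge0 ltW.
  have q1 := mulr_ge0 ca1 c20; have q2 := mulr_ge0 cc1 a20.
  by rewrite mulrDl !mulrDr; lra.
apply: (le_trans le2).
apply: (le_trans (ler_wpM2l (ltW K10) (le_trans main (ler_wpM2l (ltW C0) le1)))).
have KT0 : 0 <= Cm ^+ 2 * T + 1 + Cc by have := ltW hCc; move: CT0; move=> *; lra.
have ZWS0 : 0 <= Z + W + S by rewrite !addr_ge0.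
rewrite -(mulrA (K1 * C * _)) -(mulrA K1 C) -(mulrA K1 (C * _)) -(mulrA C).
apply: (ler_wpM2l (ltW K10)); apply: (ler_wpM2l (ltW C0)); apply: (ler_wpM2l KT0).
by rewrite -[leLHS]mul1r (ler_wpM2r ZWS0).
Qed.
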